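(* All Bier spheres with at most eleven vertices are polytopal; in particular, all $3$-dimensional Bier spheres are polytopal. Moreover, up to isomorphism, there are exactly $88$ non-threshold simplicial complexes on $5$ vertices, and the Bier spheres $Bier(K)$ of these complexes $K\subset 2^{[5]}$ form exactly $48$ isomorphism classes.
   Context: Notation: $[n]=\{1,\dots,n\}$. A simplicial complex $K\subseteq 2^{[n]}$ is a family of subsets with $\emptyset\in K$ that is closed under taking subsets; it is proper if $K\neq 2^{[n]}$. An element $i\in[n]$ with $\{i\}\notin K$ (a ghost vertex) is allowed for general $K$. A simplicial complex on $5$ vertices is one on $[5]$ with $\{i\}\in K$ for all $i\in[5]$, considered up to relabelling of the vertices. The Alexander dual of $K$ is $K^\circ=\{A\subseteq[n] : [n]\setminus A\notin K\}$. For a proper simplicial complex $K\subsetneq2^{[n]}$, the Bier sphere $Bier(K)=K*_\Delta K^\circ$ is the simplicial complex whose simplices are the sets $A_1\cup\overline{A_2}\subseteq [n]\cup[\bar n]$, where $[\bar n]=\{\bar1,\dots,\bar n\}$ is a disjoint copy of $[n]$, $\overline{C}=\{\bar i : i\in C\}$, $A_1\in K$, $A_2\in K^\circ$ and $A_1\cap A_2=\emptyset$. It is a triangulated sphere of dimension $n-2$ with at most $2n$ vertices (its vertices are the elements $v$ such that $\{v\}$ is a simplex). A Bier sphere is polytopal if it is isomorphic, as a simplicial complex, to the boundary complex of a simplicial convex polytope. $K$ is a threshold complex if there are strictly positive real weights $w_1,\dots,w_n$ and a real number $q$ such that $K=\{A\subseteq[n] : \sum_{i\in A}w_i<q\}$;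 otherwise it is non-threshold. *)

(* Defs.v *)
From mathcomp Require Import all_boot all_order all_algebra.
From mathcomp Require Import boolp classical_sets reals.

Set Implicit Arguments.
Unset Strict Implicit.
Unset Printing Implicit Defensive.

Import Order.TTheory GRing.Theory Num.Theory.
Local Open Scope ring_scope.

(* Simplicial complexes on a finite ground set. An element x of the ground set
   with [set x] \notin K (a ghost vertex) is allowed. *)

Definition simplicial_complex (T : finType) (K : {set {set T}}) : bool :=
  (finset.set0 \in K) && [forall A in K, powerset A \subset K].

Definition proper_complex (T : finType) (K : {set {set T}}) : bool :=
  simplicial_complex K && (K != powerset [set: T]%SET).

Definition vertices (T : finType) (K : {set {set T}}) : {set T} :=
  [set x | [set x]%SET \in K]%SET.

(* K contains a simplex with d.+1 elements and none with more *)
Definition has_dimension (T : finType) (K : {set {set T}}) (d : nat) : Prop :=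
  (\max_(A in K) #|A|)%N = d.+1.

(* The values of f on ghost vertices are irrelevant. As K and L have the same
   ground set, any bijection from the vertices of K to those of L is the
   restriction of such an f. *)
Definition complex_iso (T : finType) (K L : {set {set T}}) : bool :=
  [exists f : {ffun T -> T},
     dinjectiveb f (mem (vertices K)) && (L == [set f @: (A : {set T}) | A in K]%SET)].

Definition iso_classes (T : finType) (D : {set {set {set T}}}) :
    {set {set {set {set T}}}} :=
  equivalence_partition (@complex_iso T) D.

Definition alexander_dual (T : finType) (K : {set {set T}}) : {set {set T}} :=
  [set A : {set T} | ~: A \notin K]%SET.

(* The disjoint copy of [n] is the right summand. *)
Definition bier (n : nat) (K : {set {set 'I_n}}) : {set {set ('I_n + 'I_n)}} :=
  [set inl @: (A1 : {set 'I_n}) :|: inr @: (A2 : {set 'I_n})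
     | A1 in K, A2 in alexander_dual K & [disjoint A1 & A2]]%SET.

Definition threshold (R : realType) (n : nat) (K : {set {set 'I_n}}) : Prop :=
  exists (w : 'I_n -> R) (q : R),
    (forall i, 0 < w i) /\
    (forall A : {set 'I_n}, (A \in K) = (\sum_(i in A) w i < q)).

(* labelled complexes, without ghost vertices *)
Definition nonthreshold_complexes (R : realType) (n : nat) :
    {set {set {set 'I_n}}} :=
  [set K | [&& simplicial_complex K, vertices K == [set: 'I_n]
             & ~~ `[< threshold R K >]]]%SET.

Section Polytopes.
Variables (R : realType) (d : nat).
Implicit Types (P F : set 'rV[R]_d).

Definition conv (m : nat) (v : 'I_m -> 'rV[R]_d) : set 'rV[R]_d :=
  [set x | exists l : 'I_m -> R,
     [/\ forall i, 0 <= l i, \sum_i l i = 1 & x = \sum_i l i *: v i]]%classic.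

Definition polytope P : Prop :=
  exists (m : nat) (v : 'I_m -> 'rV[R]_d), P = conv v.

(* F is cut out of P by a valid inequality <x, c> <= b; the choices c = 0,
   b = 0 or 1 make P and the empty set faces of P. *)
Definition face P F : Prop :=
  exists (c : 'cV[R]_d) (b : R),
    (forall x, P x -> (x *m c) 0 0 <= b) /\
    F = [set x | P x /\ (x *m c) 0 0 = b]%classic.

Definition proper_face P F : Prop := face P F /\ F <> P.

Definition polytope_vertices P : set 'rV[R]_d :=
  [set x | face P [set x]]%classic.

Definition affinely_independent (k : nat) (v : 'I_k -> 'rV[R]_d) : Prop :=
  forall l : 'I_k -> R,
    \sum_i l i = 0 -> \sum_i l i *: v i = 0 -> forall i, l i = 0.

Definition simplex F : Prop :=
  exists (k : nat) (v : 'I_k -> 'rV[R]_d), affinely_independent v /\ F = conv v.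

Definition simplicial_polytope P : Prop :=
  polytope P /\ forall F, proper_face P F -> simplex F.

(* the vertex sets of the proper faces of P *)
Definition boundary_complex P : set (set 'rV[R]_d) :=
  [set polytope_vertices F | F in proper_face P]%classic.

End Polytopes.

(* f restricts to an isomorphism from K to the boundary complex of P *)
Definition polytopal (R : realType) (T : finType) (K : {set {set T}}) : Prop :=
  exists (d : nat) (P : set 'rV[R]_d) (f : T -> 'rV[R]_d),
    [/\ simplicial_polytope P,
        {in vertices K &, injective f}
      & [set (f @` [set` A]) | A in [set` K]]%classic = boundary_complex P].

(* Main.v *)
(* Let p_v be points such that every facet s of a sphere has a functional c_s with
   <p_v, c_s> <= 1, with equality exactly for v in s, and such that every ridge is
   in a second facet. Then the sphere is the boundary of the convex hull: a facet s
   maximizing <x, c_s> has x in its cone, as a negative coefficient would allow a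
   simplex-method pivot, so the cones over the facets cover the space.

   For a threshold complex K the vectors e_i and - e_i modulo (1, ..., 1), suitably
   scaled, are such points. A ghost vertex of K can be given a huge weight, and
   Bier(K) and the Bier sphere of the dual are isomorphic, so if K is not
   threshold and Bier(K) has at most 11 vertices one may assume that K has m <= 5
   vertices and n - m ghosts, where n + m <= 11. All monotone families on at most
   five elements are enumerated: each is threshold, or isomorphic to one of 3
   (m = 4) or 88 (m = 5) complexes, for which points with small integer coordinates
   are given. Their Bier spheres are identified by explicit
   isomorphisms and distinguished by a numerical invariant. A complex is not
   threshold if two faces and two nonfaces have the same sum of indicator vectors. *)
From HB Require Import structures.
From Stdlib Require Import BinNat BinInt.
Require Import Defs.
From mathcomp Require Import all_boot all_order all_algebra.
From mathcomp Require Import boolp classical_sets reals.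
From mathcomp Require Import ring lra ssrZ zify.
From mathcomp Require Import fintype finset.

Set Implicit Arguments.
Unset Strict Implicit.
Unset Printing Implicit Defensive.

Import Order.TTheory GRing.Theory Num.Theory.
Local Open Scope ring_scope.

(** * Polytopality of simplicial spheres *)

(** The criterion turns polytopality into finitely many sign conditions, one functional per facet,
    so a realization is certified by integer arithmetic alone. The facets and ridges of a Bier
    sphere can be read off from K: a facet is a step from A to j |: A that leaves K, and a ridge is
    an interval of length two with its bottom in K and its top outside.

    Completeness of the list of complexes needs no theory of threshold functions: every enumerated
    family either receives explicit weights or occurs among the relabellings of the list. As sets of
    finite sets do not compute, subsets become bit words and families become binary trees, and all
    checks run on this encoding.

    For m <= 3 every complex is threshold; m = 4 leaves n = 4, ..., 7 and m = 5 leaves n = 5, 6. For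
    n = 5 one realization per class of spheres is enough. *)

Section Criterion.
Variables (R : realType) (T : finType) (d : nat).
Variables (S Fs : {set {set T}}) (p : T -> 'rV[R]_d) (c : {set T} -> 'cV[R]_d).

Local Notation pairing x y := ((x *m y) 0 0).

Lemma pairing_suml (I : finType) (P : pred I) (l : I -> R) (q : I -> 'rV[R]_d)
    (y : 'cV[R]_d) :
  pairing (\sum_(i | P i) l i *: q i) y = \sum_(i | P i) l i * pairing (q i) y.
Proof.
rewrite mulmx_suml summxE; apply: eq_bigr => i _.
by rewrite -scalemxAl mxE.
Qed.

Lemma pairing_sumr (I : finType) (P : pred I) (x : 'rV[R]_d) (y : I -> 'cV[R]_d) :
  pairing x (\sum_(i | P i) y i) = \sum_(i | P i) pairing x (y i).
Proof. by rewrite mulmx_sumr summxE. Qed.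

Lemma pairing0 (y : 'cV[R]_d) : pairing (0 : 'rV_d) y = 0.
Proof. by rewrite mul0mx mxE. Qed.

(** Coefficients are indexed by all of [T], so that passing to a subset needs no reindexing;
    [hull_conv] returns to the ordinals of [conv]. *)
Definition hull (A : {set T}) : set 'rV[R]_d :=
  [set x | exists l : T -> R,
     [/\ forall v, 0 <= l v, \sum_(v in A) l v = 1
       & x = \sum_(v in A) l v *: p v]]%classic.

Lemma extend_enum_val (A : {set T}) (l : 'I_#|A| -> R) :
  exists l' : T -> R, [/\ forall j, l' (enum_val j) = l j,
    forall v, v \notin A -> l' v = 0 & (forall j, 0 <= l j) -> forall v, 0 <= l' v].
Proof.
exists (fun v => \sum_j (enum_val j == v)%:R * l j); split=> [j|v vA|l0 v].
- rewrite (bigD1 j) //= eqxx mul1r big1 ?addr0 // => k kj.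
  by rewrite (inj_eq enum_val_inj) (negbTE kj) mul0r.
- rewrite big1 // => j _; case: eqP => [E|]; rewrite ?mul0r //.
  by case/negP: vA; rewrite -E enum_valP.
- by rewrite sumr_ge0 // => j _; rewrite mulr_ge0 // ler0n.
Qed.

Lemma hull_conv A : hull A = conv (fun i : 'I_#|A| => p (enum_val i)).
Proof.
apply/seteqP; split=> x /=.
- case=> l [l0 l1 ->]; exists (fun i => l (enum_val i)); split=> //.
  + by rewrite -l1 [RHS]big_enum_val.
  + by rewrite big_enum_val.
- case=> l [l0 l1 ->].
  have [l' [l'E _ l'0]] := extend_enum_val l; exists l'; split; first exact: l'0.
  + by rewrite [LHS]big_enum_val -l1; apply: eq_bigr => i _; rewrite l'E.
  + by rewrite [RHS]big_enum_val; apply: eq_bigr => i _; rewrite l'E.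
Qed.

Lemma hull_mem (A : {set T}) v : v \in A -> hull A (p v).
Proof.
move=> vA; exists (fun u => (u == v)%:R); split=> //.
- by rewrite (bigD1 v) //= eqxx big1 ?addr0 // => u /andP[_ /negbTE ->].
- rewrite (bigD1 v) //= eqxx scale1r big1 ?addr0 // => u /andP[_ /negbTE ->].
  by rewrite scale0r.
Qed.

Lemma hull1 v : hull [set v]%SET = [set p v]%classic.
Proof.
apply/seteqP; split=> x /=; last by move=> ->; apply: hull_mem; rewrite inE.
by case=> l [_]; rewrite !big_set1 => -> ->; rewrite scale1r.
Qed.

Lemma hull_sub (A B : {set T}) : A \subset B -> (hull A `<=` hull B)%classic.
Proof.
move=> /subsetP AB x [l [l0 l1 ->]].
exists (fun v => if v \in A then l v else 0); split.
- by move=> v; case: ifP.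
- rewrite -l1 -big_mkcondr; apply: eq_bigl => v /=.
  by case vA: (v \in A); rewrite ?andbT ?andbF // AB.
- under [RHS]eq_bigr => v _ do rewrite (fun_if (fun r => r *: p v)) scale0r.
  rewrite -big_mkcondr; apply: eq_bigl => v /=.
  by case vA: (v \in A); rewrite ?andbT ?andbF // AB.
Qed.

(** The pairing of a convex combination with [y] is the weighted average of those of its points, so
    the value [b] forces the coefficient of every point below [b] to vanish. *)
Lemma hull_face (A : {set T}) (y : 'cV[R]_d) b :
  (forall v, v \in A -> pairing (p v) y <= b) ->
  (forall x, hull A x -> pairing x y <= b) /\
  [set x | hull A x /\ pairing x y = b]%classic
    = hull [set v in A | pairing (p v) y == b]%SET.
Proof.
move=> yb.
have le_b x l : (forall v, 0 <= l v) -> \sum_(v in A) l v = 1 ->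
    x = \sum_(v in A) l v *: p v -> pairing x y <= b ?= iff
      [forall (v | v \in A), l v * pairing (p v) y == l v * b].
  move=> l0 l1 ->; rewrite pairing_suml -[X in _ <= X ?= iff _]mul1r -l1 mulr_suml.
  apply: leif_sum => v vA; apply/leifP; case: ifP => [/eqP ->//|/negbT H].
  by rewrite lt_neqAle H ler_wpM2l // yb.
split=> [x [l [l0 l1 xE]]|]; first by rewrite (le_b x l).
apply/seteqP; split=> x /=.
- case=> -[l [l0 l1 xE]] /eqP; rewrite (le_b x l) // => /forall_inP lE.
  have l_off v : v \in A -> pairing (p v) y != b -> l v = 0.
    move=> vA pvy; apply/eqP; case: eqP => // /eqP lv.
    have /eqP/(mulfI lv)/eqP := lE v vA; by rewrite (negbTE pvy).
  exists l; split=> //.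
  + rewrite -[RHS]l1 [RHS](bigID (fun v => pairing (p v) y == b)) /=.
    rewrite [X in _ + X]big1 ?addr0 => [|v /andP[vA H]]; last by rewrite l_off.
    by apply: eq_bigl => v; rewrite inE.
  + rewrite xE [LHS](bigID (fun v => pairing (p v) y == b)) /=.
    rewrite [X in _ + X]big1 ?addr0 => [|v /andP[vA H]]; last by rewrite l_off ?scale0r.
    by apply: eq_bigl => v; rewrite inE.
- move=> Hx; split; first by apply: hull_sub Hx; apply/subsetP => v; rewrite inE => /andP[].
  case: Hx => l [l0 l1 ->]; rewrite pairing_suml.
  under eq_bigr => v do rewrite inE => /andP[_ /eqP ->].
  by rewrite -mulr_suml l1 mul1r.
Qed.

Hypothesis S_facets : forall A, (A \in S) = [exists s in Fs, A \subset s].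
Hypothesis Fs_neq0 : Fs != finset.set0.
Hypothesis Fs_card : forall s, s \in Fs -> #|s| = d.
Hypothesis Fs_neqT : forall s, s \in Fs -> s != setT.
Hypothesis flip : forall s v, s \in Fs -> v \in s ->
  exists2 t, t \in Fs & (s :\ v \subset t) && (v \notin t).
(** This also concerns the ghost elements of [T]: lying in no facet, their points must satisfy every
    facet inequality strictly, and they then add nothing to the boundary of [hull setT]. *)
Hypothesis c_facet : forall s v, s \in Fs -> pairing (p v) (c s) <= 1 ?= iff (v \in s).

Lemma c_le1 s v : s \in Fs -> pairing (p v) (c s) <= 1.
Proof. by move=> sF; rewrite (c_facet v sF). Qed.

Lemma c_eq1 s v : s \in Fs -> v \in s -> pairing (p v) (c s) = 1.
Proof. by move=> sF vs; apply/eqP; rewrite (c_facet v sF). Qed.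

Lemma c_lt1 s v : s \in Fs -> v \notin s -> pairing (p v) (c s) < 1.
Proof. by move=> sF vs; rewrite lt_neqAle (c_facet v sF) vs c_le1. Qed.

(** The functionals of [s] and [t] are both 1 on [s :\ v], so they differ only through the
    coefficient of [v]. Its factor is negative when [v] is not in [t]: the flip increases the
    pairing exactly when [l v] is negative. *)
Lemma pairing_flip s t v (l : T -> R) : s \in Fs -> t \in Fs -> v \in s ->
  s :\ v \subset t ->
  pairing (\sum_(u in s) l u *: p u) (c t)
    = pairing (\sum_(u in s) l u *: p u) (c s) + l v * (pairing (p v) (c t) - 1).
Proof.
move=> sF tF vs /subsetP st; rewrite !pairing_suml !(bigD1 v vs) /=.
rewrite (c_eq1 sF vs); set X := \sum_(i in s | _) _; set Y := \sum_(i in s | _) _.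
suff -> : X = Y by ring.
apply: eq_bigr => u /andP[us uv]; rewrite !c_eq1 //.
by apply: st; rewrite !inE uv.
Qed.

Lemma facet_free s (l : T -> R) : s \in Fs ->
  \sum_(v in s) l v *: p v = 0 -> forall v, v \in s -> l v = 0.
Proof.
move=> sF l0 v vs; have [t tF /andP[st vt]] := flip sF vs.
have := pairing_flip l sF tF vs st; rewrite l0 !pairing0 add0r => /esym/eqP.
by rewrite mulf_eq0 subr_eq0 (lt_eqF (c_lt1 tF vt)) orbF => /eqP.
Qed.

Lemma facet_span s x : s \in Fs -> exists l : T -> R, x = \sum_(v in s) l v *: p v.
Proof.
move=> sF; pose M := \matrix_(i < #|s|) p (enum_val i).
have M_free : row_free M.
  apply/row_freeP/row_freeP; apply: inj_row_free => u uM; apply/rowP => i.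
  have [l [lE _ _]] := extend_enum_val (fun j => u 0 j).
  rewrite mxE -lE; apply: (facet_free sF); last exact: enum_valP.
  rewrite big_enum_val -[RHS]uM mulmx_sum_row; apply: eq_bigr => j _.
  by rewrite lE rowK.
have : row_full M by rewrite -col_leq_rank -{1}(Fs_card sF); exact/eq_leq/esym/eqP.
move=> /row_fullP[B BM]; pose u := x *m B.
have xE : x = u *m M by rewrite -mulmxA BM mulmx1.
have [l [lE _ _]] := extend_enum_val (fun j => u 0 j).
exists l; rewrite big_enum_val xE mulmx_sum_row; apply: eq_bigr => j _.
by rewrite lE rowK.
Qed.

(* The simplex method: a facet maximising [x] over the vertices [c s] of the
   polar polytope has [x] in its cone, as otherwise some flip increases [x]. *)
Lemma facet_cone x : exists2 s, s \in Fs &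
  exists2 l : T -> R, (forall v, v \in s -> 0 <= l v)
    & x = \sum_(v in s) l v *: p v.
Proof.
have [s0 s0F] := set0Pn _ Fs_neq0.
case: (@Order.TotalTheory.arg_maxP _ _ _ s0 (mem Fs) (fun s => pairing x (c s)) s0F).
move=> s sF s_max; have [l xE] := facet_span x sF.
exists s => //; exists l => // v vs; rewrite leNgt; apply/negP => lv.
have [t tF /andP[st vt]] := flip sF vs.
have := s_max t tF; rewrite /= xE (pairing_flip l sF tF vs st) gerDl.
by rewrite leNgt nmulr_rgt0 // subr_lt0 c_lt1.
Qed.

Lemma polytope_hullT : polytope (hull setT).
Proof. by exists #|[set: T]|, (fun i => p (enum_val i)); exact: hull_conv. Qed.

(** Sum the functionals of all facets containing [A]: the bound is attained exactly on the
    intersection of these facets. That intersection is [A], since flipping a vertex outside [A] out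
    of a facet leaves a facet that still contains [A]. *)
Lemma face_functional A : A \in S -> exists (y : 'cV[R]_d) b,
  forall v, pairing (p v) y <= b ?= iff (v \in A).
Proof.
rewrite S_facets => /exists_inP[s sF As].
exists (\sum_(t in Fs | A \subset t) c t), (\sum_(t in Fs | A \subset t) 1) => v.
rewrite pairing_sumr.
have -> : (v \in A) = [forall (t | (t \in Fs) && (A \subset t)), v \in t].
  apply/idP/forall_inP => [vA t /andP[_ /subsetP]|H]; first exact.
  have vs : v \in s by apply: H; rewrite sF.
  have [t tF /andP[/subsetP st vt]] := flip sF vs.
  apply/negPn/negP => vA; case/negP: vt; apply: H; rewrite tF /=.
  apply/subsetP => u uA; apply: st; rewrite !inE (subsetP As) // andbT.
  by apply: contraNneq vA => <-.
by apply: leif_sum => t /andP[tF _]; apply: c_facet.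
Qed.

Lemma face_hull (A B : {set T}) : A \in S -> A \subset B -> face (hull B) (hull A).
Proof.
move=> AS /subsetP AB; have [y [b yb]] := face_functional AS.
exists y, b; have [H1 ->] := @hull_face B y b (fun v _ => leif_le (yb v)).
split=> //; congr hull; apply/setP => v; rewrite inE (yb v).
by case vA : (v \in A); rewrite ?andbT ?andbF // AB.
Qed.

(** A face of [hull A] is the hull of the points attaining its bound. If it is a single point, these
    are not empty, as their coefficients sum to 1, so the point is some [p v]. *)
Lemma polytope_vertices_hull (A : {set T}) : A \in S ->
  polytope_vertices (hull A) = (p @` [set` A])%classic.
Proof.
move=> AS; apply/seteqP; split=> x.
- case=> y [b [H]].
  have Hb v : v \in A -> pairing (p v) y <= b by move=> vA; apply/H/hull_mem.
  have [_ ->] := hull_face Hb => xE.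
  have : hull [set v in A | pairing (p v) y == b]%SET x by rewrite -xE.
  case=> l [_ l1 _].
  have [E|[v vB]] := set_0Vmem [set v in A | pairing (p v) y == b]%SET.
    by move/eqP: l1; rewrite E big_set0 eq_sym oner_eq0.
  have : hull [set v in A | pairing (p v) y == b]%SET (p v) by exact: hull_mem.
  by rewrite -xE /= => <-; exists v => //; move: vB; rewrite inE => /andP[].
- case=> v /= vA <-; rewrite /polytope_vertices /= -hull1.
  apply: face_hull; last by rewrite sub1set.
  move: AS; rewrite !S_facets => /exists_inP[s sF /subsetP As].
  by apply/exists_inP; exists s; rewrite // sub1set As.
Qed.

Lemma hull_neq (A : {set T}) : A \in S -> hull A <> hull setT.
Proof.
rewrite S_facets => /exists_inP[s sF As] AT.
have [v vs] : exists v, v \notin s.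
  by have := Fs_neqT sF; rewrite -subTset => /subsetPn[v _]; exists v.
have : hull A (p v) by rewrite AT; apply: hull_mem; rewrite inE.
move=> /(hull_sub As)[l [_ l1 E]].
have := c_lt1 sF vs; rewrite E pairing_suml.
under eq_bigr => u us do rewrite (c_eq1 sF us) mulr1.
by rewrite l1 ltxx.
Qed.

(** With [V] the set of points attaining the bound, the facet containing [V] is one whose cone
    contains the sum of [V]. *)
Lemma proper_faceP F : proper_face (hull setT) F -> exists2 A, A \in S & F = hull A.
Proof.
case=> -[y [b [H FE]]] FT.
have yb v : pairing (p v) y <= b by apply/H/hull_mem; rewrite inE.
pose V := [set v | pairing (p v) y == b]%SET.
have FV : F = hull V.
  by rewrite FE; have [_ ->] := @hull_face setT y b (fun v _ => yb v); congr hull;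
     apply/setP => v; rewrite !inE.
exists V => //; rewrite S_facets.
have [V0|[v0 v0V]] := set_0Vmem V.
  have [s sF] := set0Pn _ Fs_neq0.
  by apply/exists_inP; exists s => //; rewrite V0 sub0set.
(* If [b] were not positive, [y] would pair nonpositively with every point, hence with its own
   transpose, which lies in the cone over some facet. So [y] and [b] would vanish and the face would
   be the whole polytope. *)
have b_gt0 : 0 < b.
  rewrite ltNge; apply/negP => b_le0; apply: FT.
  have [s sF [l l0 yE]] := facet_cone y^T.
  have : pairing y^T y <= 0.
    rewrite yE pairing_suml sumr_le0 // => v vs.
    by rewrite mulr_ge0_le0 ?l0 // (le_trans (yb v)).
  rewrite mxE => yy.
  have y0 : y = 0.
    apply/colP => i; rewrite [RHS]mxE; apply/eqP; rewrite -sqrf_eq0 eq_le sqr_ge0 andbT.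
    apply: le_trans yy; rewrite (bigD1 i) //= mxE -expr2 lerDl sumr_ge0 // => j _.
    by rewrite mxE -expr2 sqr_ge0.
  move: v0V; rewrite inE y0 mulmx0 mxE => /eqP b0.
  rewrite FE y0 -b0; apply/seteqP; split=> x /=; first by case.
  by move=> xT; split=> //; rewrite mulmx0 mxE.
(* Pairing with [y] shows that the [l u] add up to at least the cardinality of [V]; pairing with
   [c s] shows that they add up to a sum over [V] of terms at most 1. Hence all these terms are 1,
   and [V] lies in [s]. *)
have [s sF [l l0 zE]] := facet_cone (\sum_(v in V) 1 *: p v).
apply/exists_inP; exists s => //; apply/subsetP => v vV.
have l_sum : \sum_(v in V) pairing (p v) (c s) = \sum_(u in s) l u.
  have := congr1 (fun x => pairing x (c s)) zE; rewrite !pairing_suml.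
  under eq_bigr do rewrite mul1r.
  by move=> ->; apply: eq_bigr => u us; rewrite (c_eq1 sF us) mulr1.
have V_le : #|V|%:R <= \sum_(u in s) l u.
  rewrite -(ler_pM2r b_gt0) mulr_natl -[X in X *+ _ <= _]mul1r.
  have := congr1 (fun x => pairing x y) zE; rewrite !pairing_suml.
  under eq_bigr => u do rewrite inE => /eqP ->.
  rewrite sumr_const => ->; rewrite mulr_suml ler_sum // => u us.
  by rewrite ler_wpM2l ?l0.
have /leifP : \sum_(v in V) pairing (p v) (c s) <= \sum_(v in V) 1
    ?= iff [forall (v | v \in V), v \in s].
  by apply: leif_sum => u _; apply: c_facet.
case: ifP => [/forall_inP/(_ v vV) //|_].
by rewrite sumr_const l_sum ltNge V_le.
Qed.

Lemma simplex_hull A : A \in S -> simplex (hull A).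
Proof.
rewrite S_facets => /exists_inP[s sF /subsetP As].
exists #|A|, (fun i => p (enum_val i)); split; last exact: hull_conv.
move=> l _ l0 i.
have [l' [l'E l'0 _]] := extend_enum_val l.
rewrite -l'E; apply: (facet_free sF); last exact/As/enum_valP.
rewrite (bigID (mem A)) /= [X in _ + X]big1 ?addr0; last first.
  by move=> v /andP[_ vA]; rewrite l'0 ?scale0r.
rewrite (eq_bigl (mem A)); last first.
  by move=> v; case vA: (v \in A); rewrite ?andbT ?andbF // As.
by rewrite big_enum_val -[RHS]l0; apply: eq_bigr => j _; rewrite l'E.
Qed.

Lemma polytopal_criterion : polytopal R S.
Proof.
exists d, (hull setT), p; split.
- split; first exact: polytope_hullT.
  by move=> F /proper_faceP[A AS ->]; exact: simplex_hull.
- move=> u v; rewrite !inE => uS vS puv.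
  have [y [b yb]] := face_functional uS.
  have : v \in [set u]%SET by rewrite -(yb v) -puv (yb u) inE.
  by rewrite inE => /eqP.
- apply/seteqP; split=> X /=.
  + case=> A AS <-; rewrite -polytope_vertices_hull //; exists (hull A) => //.
    by split; [apply: face_hull; rewrite ?subsetT | exact: hull_neq].
  + case=> F /proper_faceP[A AS ->] <-; exists A => //.
    by rewrite polytope_vertices_hull.
Qed.

End Criterion.

(** * Bier spheres *)

Section SumSets.
Variables (T U : finType).
Implicit Types (A C : {set T}) (B D : {set U}) (X : {set T + U}).

Definition sumset A B : {set T + U} := inl @: A :|: inr @: B.

Lemma in_sumset A B v :
  (v \in sumset A B) = match v with inl i => i \in A | inr i => i \in B end.
Proof.
rewrite inE; case: v => i; rewrite mem_imset; try by move=> ? ? [].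
  by rewrite orbC; case: imsetP => // -[].
by case: imsetP => // -[].
Qed.

Lemma sumset_preim X : X = sumset (inl @^-1: X) (inr @^-1: X).
Proof. by apply/setP => -[] i; rewrite in_sumset inE. Qed.

Lemma preim_inl_sumset A B : inl @^-1: sumset A B = A.
Proof. by apply/setP => i; rewrite inE in_sumset. Qed.

Lemma preim_inr_sumset A B : inr @^-1: sumset A B = B.
Proof. by apply/setP => i; rewrite inE in_sumset. Qed.

Lemma sumset_sub A B C D :
  (sumset A B \subset sumset C D) = (A \subset C) && (B \subset D).
Proof.
apply/subsetP/andP => [H|[/subsetP AC /subsetP BD] [] i]; last first.
- by rewrite !in_sumset; apply: BD.
- by rewrite !in_sumset; apply: AC.
split; apply/subsetP => i Hi.
  by have := H (inl i); rewrite !in_sumset; apply.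
by have := H (inr i); rewrite !in_sumset; apply.
Qed.

Lemma card_sumset A B : #|sumset A B| = (#|A| + #|B|)%N.
Proof.
rewrite cardsU !card_imset; try by move=> ? ? [].
suff -> : inl @: A :&: inr @: B = set0 :> {set T + U} by rewrite cards0 subn0.
by apply/setP => v; rewrite !inE; apply/andP => -[/imsetP[i _ ->] /imsetP[]].
Qed.

End SumSets.

Lemma simplicial_complexP (T : finType) (K : {set {set T}}) :
  reflect (set0 \in K /\ forall A B : {set T}, A \subset B -> B \in K -> A \in K)
    (simplicial_complex K).
Proof.
apply: (iffP andP) => -[K0 Kd]; split=> //.
  by move=> A B AB /(forall_inP Kd)/subsetP; apply; rewrite powersetE.
by apply/forall_inP => B BK; apply/subsetP => A; rewrite powersetE => /Kd; apply.
Qed.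

Lemma in_bier n (K : {set {set 'I_n}}) X :
  (X \in bier K) = [&& inl @^-1: X \in K, ~: (inr @^-1: X) \notin K
                     & [disjoint inl @^-1: X & inr @^-1: X]].
Proof.
apply/imset2P/and3P => [[A B AK]|[H1 H2 H3]].
  rewrite !inE => /andP[BK dAB ->].
  by rewrite -/(sumset A B) preim_inl_sumset preim_inr_sumset.
exists (inl @^-1: X) (inr @^-1: X); rewrite ?inE ?H2 //.
exact: sumset_preim.
Qed.

(** * Facets and ridges of a Bier sphere *)

Section BierFacets.
Variables (n : nat) (K : {set {set 'I_n}}).
Hypothesis K_proper : proper_complex K.

(** The facet belongs to the step from [A] to [j |: A] out of the complex; [j] is the only index
    used in neither copy. *)
Definition bier_facet (A : {set 'I_n}) j := sumset A (~: (j |: A)).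

Definition bier_facets : {set {set ('I_n + 'I_n)}} :=
  [set bier_facet u.1 u.2 | u : {set 'I_n} * 'I_n
     & (u.1 \in K) && (u.2 |: u.1 \notin K)].

Lemma bier_facetsP s :
  reflect (exists A j, [/\ A \in K, j |: A \notin K & s = bier_facet A j])
    (s \in bier_facets).
Proof.
apply: (iffP imsetP) => [[[A j]]|[A [j [AK jAK ->]]]].
  by rewrite inE /= => /andP[AK jAK ->]; exists A, j.
by exists (A, j); rewrite // inE /= AK.
Qed.

Lemma bier_facets_mem A j : A \in K -> j |: A \notin K ->
  bier_facet A j \in bier_facets.
Proof. by move=> AK jAK; apply/bier_facetsP; exists A, j. Qed.

Lemma proper_down (A B : {set _}) : A \subset B -> B \in K -> A \in K.
Proof. by case/andP: K_proper => /simplicial_complexP[_ +] _; apply. Qed.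

Lemma proper_set0 : set0 \in K.
Proof. by case/andP: K_proper => /simplicial_complexP[]. Qed.

Lemma proper_setT : setT \notin K.
Proof.
case/andP: K_proper => _; apply: contra => TK.
by apply/eqP/setP => A; rewrite powersetE subsetT (proper_down (subsetT A)).
Qed.

Lemma bier_facet_exists (A B : {set _}) : A \in K -> B \notin K -> A \subset B ->
  exists C j, [/\ C \in K, j |: C \notin K & (A \subset C) && (j |: C \subset B)].
Proof.
move=> AK BK AB.
pose P := [pred C : {set 'I_n} | [&& C \in K, A \subset C & C \subset B]].
have [C /maxsetP[/= /and3P[CK AC CB] Cmax] _] : {C | maxset P C & A \subset C}.
  by apply: maxset_exists; rewrite /= AK subxx.
have [j jB jC] : exists2 j, j \in B & j \notin C.
  apply/subsetPn; apply: contra BK => BC.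
  by rewrite (proper_down BC).
exists C, j; split=> //; last by rewrite AC subUset sub1set jB CB.
apply: contra jC => jCK.
by rewrite -(Cmax (j |: C)) ?setU11 ?subsetUr //=
  jCK subUset sub1set jB CB (subset_trans AC) ?subsetUr.
Qed.

(** A simplex with parts A and B is an interval from A, in [K], to the complement of B, not in [K].
    The facets above it are the steps leaving [K] inside this interval. *)
Lemma bier_facets_cover X : (X \in bier K) = [exists s in bier_facets, X \subset s].
Proof.
apply/idP/exists_inP => [|[_ /bier_facetsP[A [j [AK jAK ->]]]]]; last first.
  rewrite [X]sumset_preim sumset_sub -sumset_preim in_bier => /andP[XA XB].
  rewrite (proper_down XA AK) /= -setI_eq0 -subset0.
  have XB' : j |: A \subset ~: (inr @^-1: X) by rewrite -[_ |: _]setCK setCS.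
  rewrite (contra (proper_down XB') jAK) /=.
  have : inl @^-1: X \subset ~: (inr @^-1: X).
    by apply: subset_trans XA (subset_trans _ XB'); rewrite subsetUr.
  by rewrite -disjoints_subset -setI_eq0 subset0.
rewrite in_bier => /and3P[XK XnK]; rewrite disjoints_subset => dX.
have [C [j [CK jCK /andP[AC jCB]]]] := bier_facet_exists XK XnK dX.
exists (bier_facet C j); first exact: bier_facets_mem.
by rewrite [X]sumset_preim sumset_sub AC -[_ @^-1: _]setCK setCS.
Qed.

Lemma bier_facets_neq0 : bier_facets != set0.
Proof.
have [C [j [CK jCK _]]] := bier_facet_exists proper_set0 proper_setT (sub0set _).
by apply/set0Pn; exists (bier_facet C j); exact: bier_facets_mem.
Qed.

Lemma bier_facet_card A j : A \in K -> j |: A \notin K -> #|bier_facet A j| = n.-1.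
Proof.
move=> AK jAK; have jA : j \notin A.
  by apply: contra jAK => jA; rewrite (setUidPr _) // sub1set.
have := cardsC (j |: A); rewrite card_ord cardsU1 jA => E.
by rewrite card_sumset -[in RHS]E.
Qed.

(* The facet through the ridge opposite to a vertex is found by moving that
   vertex, or the vertex [j] missing from both parts, across. *)
Lemma bier_facet_flip s v : s \in bier_facets -> v \in s ->
  exists2 t, t \in bier_facets & (s :\ v \subset t) && (v \notin t).
Proof.
move=> /bier_facetsP[A [j [AK jAK ->]]]; rewrite in_sumset => vs.
have flipP C k : C \in K -> k |: C \notin K ->
    v \notin bier_facet C k ->
    (forall i, i \in A -> inl i != v -> i \in C) ->
    (forall i, inr i != v -> i \in k |: C -> i \in j |: A) ->
    exists2 t, t \in bier_facets & (bier_facet A j :\ v \subset t) && (v \notin t).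
  move=> CK kCK vC H1 H2; exists (bier_facet C k); first exact: bier_facets_mem.
  rewrite vC andbT; apply/subsetP => u; rewrite in_setD1 !in_sumset => /andP[uv].
  case: u uv => i iv; first by move/H1; apply.
  by rewrite !in_setC; apply: contra; apply: H2.
case: v vs flipP => a.
(* The ridge is the interval from [A :\ a] to [j |: A]. Of its two maximal chains one passes through
   [A]; the other passes through [j |: A :\ a] and leaves [K] at its first or its second step. The
   case of a vertex in the second copy is the same with the interval from [A] to [a |: (j |: A)]. *)
- move=> aA flipP; have [ajK|ajK] := boolP (j |: A :\ a \in K).
  + apply: (flipP (j |: A :\ a) a) => //.
    * rewrite setUCA setD1K //.
    * rewrite in_sumset !inE eqxx orbF; apply: contra jAK => /eqP <-.
      by rewrite setUC (setUidPl _) ?sub1set.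
    * by move=> i iA; rewrite !inE iA andbT orbC => ->.
    * move=> i _; rewrite setUCA setD1K //.
  + apply: (flipP (A :\ a) j) => //.
    * by apply: proper_down AK; rewrite subsetDl.
    * by rewrite in_sumset !inE eqxx.
    * by move=> i iA; rewrite !inE iA andbT.
    * by move=> i _; rewrite !inE => /orP[->//|/andP[_ ->]]; rewrite orbT.
- rewrite inE => ajA flipP; have [aK|aK] := boolP (a |: A \in K).
  + apply: (flipP (a |: A) j) => //.
    * by apply: contra jAK; apply: proper_down; rewrite setUCA subsetUr.
    * by rewrite in_sumset !inE eqxx orbT.
    * by move=> i iA _; rewrite !inE iA orbT.
    * by move=> i ia; rewrite !inE orbCA => /orP[/eqP E|//]; rewrite E eqxx in ia.
  + apply: (flipP A a) => //.
    * by rewrite in_sumset !inE eqxx.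
    * by move=> i ia; rewrite !inE => /orP[/eqP E|->]; [rewrite E eqxx in ia | rewrite orbT].
Qed.

Lemma bier_polytopal (R : realType) (p : 'I_n + 'I_n -> 'rV[R]_n.-1) :
  (forall A j, A \in K -> j |: A \notin K ->
     exists c : 'cV_n.-1, forall v, (p v *m c) 0 0 <= 1 ?= iff (v \in bier_facet A j)) ->
  polytopal R (bier K).
Proof.
(* [good] is vacuous off the facets, so that [choice] can produce one function on all sets. *)
move=> pc; pose good (s : {set 'I_n + 'I_n}) (c : 'cV[R]_n.-1) :=
  s \in bier_facets -> forall v, (p v *m c) 0 0 <= 1 ?= iff (v \in s).
have /choice[c cP] : forall s, exists c, good s c.
  move=> s; have [/bier_facetsP[A [j [AK jAK ->]]]|sF] := boolP (s \in bier_facets).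
    by have [c H] := pc A j AK jAK; exists c.
  by exists 0 => sF'; case/negP: sF.
apply: (polytopal_criterion (Fs := bier_facets) (p := p) (c := c)).
- exact: bier_facets_cover.
- exact: bier_facets_neq0.
- by move=> s /bier_facetsP[A [j [AK jAK ->]]]; exact: bier_facet_card.
- move=> s /bier_facetsP[A [j [AK jAK ->]]]; apply/eqP => /setP/(_ (inr j)).
  by rewrite in_sumset !inE eqxx.
- exact: bier_facet_flip.
- by move=> s v sF; exact: cP.
Qed.

End BierFacets.

(** * Isomorphisms of complexes and transport of polytopality *)

Section Isomorphism.
Variable (T : finType).
Implicit Types (K L M : {set {set T}}).

Lemma simplicial_vertices K (A : {set T}) : simplicial_complex K -> A \in K -> A \subset vertices K.
Proof.
move=> /simplicial_complexP[_ Kd] AK; apply/subsetP => x xA.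
by rewrite inE (Kd _ A) ?sub1set.
Qed.

Lemma complex_isoP K L :
  reflect (exists2 f : T -> T, {in vertices K &, injective f}
             & L = [set f @: (A : {set T}) | A in K])
    (complex_iso K L).
Proof.
apply: (iffP existsP) => [[f /andP[/dinjectiveP fI /eqP LE]]|[f fI LE]].
  by exists f.
exists [ffun x => f x]; apply/andP; split.
  by apply/dinjectiveP => x y xK yK; rewrite !ffunE; apply: fI.
rewrite LE; apply/eqP/eq_imset => A; apply: eq_imset => x; by rewrite ffunE.
Qed.

Lemma complex_iso_bij (f : T -> T) K L : injective f ->
  (forall A : {set _}, (f @: A \in L) = (A \in K)) -> complex_iso K L.
Proof.
move=> fI KL; apply/complex_isoP; exists f; first by move=> x y _ _; apply: fI.
have [g fK gK] := injF_bij fI.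
apply/setP => B; apply/idP/imsetP => [BL|[A AK ->]]; last by rewrite KL.
have BE : B = f @: (g @: B).
  by rewrite -imset_comp (eq_imset _ (_ : f \o g =1 id)) ?imset_id.
by exists (g @: B); rewrite // -KL -BE.
Qed.

Lemma vertices_iso f K L : simplicial_complex K ->
  L = [set f @: (A : {set T}) | A in K] -> vertices L = f @: vertices K.
Proof.
move=> Ks LE; apply/setP => w; rewrite inE LE; apply/imsetP/imsetP.
- case=> A AK wE; have: w \in f @: A by rewrite -wE set11.
  case/imsetP => v vA ->; exists v => //.
  exact: (subsetP (simplicial_vertices Ks AK)).
- by case=> v; rewrite inE => vK ->; exists [set v]; rewrite ?imset_set1.
Qed.

Lemma complex_iso_refl K : complex_iso K K.
Proof. by apply: (complex_iso_bij (f := id)) => // A; rewrite imset_id. Qed.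

(** Isomorphisms are injective on vertices only, so their inverses are found by a search in the
    vertex set, with a junk value elsewhere. *)
Lemma partial_inverse (V : {set T}) (f : T -> T) : {in V &, injective f} ->
  exists2 h : T -> T, {in V, cancel f h} & forall A : {set T}, A \subset V -> h @: (f @: A) = A.
Proof.
move=> fI; pose h w := if [pick v in V | f v == w] is Some v then v else w.
have hf : {in V, cancel f h}.
  move=> v vV; rewrite /h; case: pickP => [u /andP[uV /eqP fuv]|/(_ v)]; first exact: fI.
  by rewrite vV eqxx.
exists h => // A /subsetP AV; rewrite -imset_comp -[RHS]imset_id.
by apply: eq_in_imset => v vA /=; apply/hf/AV.
Qed.

Lemma complex_iso_sym K L : simplicial_complex K -> complex_iso K L -> complex_iso L K.
Proof.
move=> Ks /complex_isoP[f fI LE]; have [h hf hfA] := partial_inverse fI.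
apply/complex_isoP; exists h.
  move=> u v; rewrite (vertices_iso Ks LE) => /imsetP[u' u'K ->] /imsetP[v' v'K ->].
  by rewrite !hf // => ->.
rewrite LE -imset_comp -[LHS]imset_id; apply: eq_in_imset => A AK /=.
by rewrite hfA // simplicial_vertices.
Qed.

Lemma complex_iso_trans K L M : simplicial_complex K ->
  complex_iso K L -> complex_iso L M -> complex_iso K M.
Proof.
move=> Ks /complex_isoP[f fI LE] /complex_isoP[g gI ME].
apply/complex_isoP; exists (g \o f).
  move=> u v uK vK /= /gI; rewrite (vertices_iso Ks LE) !imset_f // => /(_ isT isT).
  exact: fI.
by rewrite ME LE -imset_comp; apply: eq_imset => A /=; rewrite -imset_comp.
Qed.

Lemma polytopal_iso (R : realType) K L : simplicial_complex K ->
  complex_iso K L -> polytopal R K -> polytopal R L.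
Proof.
move=> Ks /complex_isoP[f fI LE] [d [P [q [Ps qI qE]]]].
have [h hf hfA] := partial_inverse fI; have KV := simplicial_vertices Ks.
exists d, P, (q \o h); split=> //.
- move=> u v; rewrite (vertices_iso Ks LE) => /imsetP[u' u'K ->] /imsetP[v' v'K ->].
  by rewrite /= !hf // => /qI ->.
- have qhE A : A \in K -> ((q \o h) @` [set` f @: A] = q @` [set` A])%classic.
    move=> /KV/subsetP AV; apply/seteqP; split=> x /=.
      by case=> _ /imsetP[v vA ->] <-; exists v; rewrite ?hf ?AV.
    by case=> v vA <-; exists (f v); rewrite ?imset_f /= ?hf ?AV.
  rewrite -qE; apply/seteqP; split=> X /=.
    by case=> B; rewrite LE => /imsetP[A AK ->] <-; exists A; rewrite ?qhE.
  by case=> A AK <-; exists (f @: A); rewrite ?qhE // LE; exact: imset_f.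
Qed.

End Isomorphism.

Lemma bier_simplicial n (K : {set {set 'I_n}}) : proper_complex K ->
  simplicial_complex (bier K).
Proof.
move=> Kp; apply/simplicial_complexP; split.
  rewrite bier_facets_cover //; have /set0Pn[s sF] := bier_facets_neq0 Kp.
  by apply/exists_inP; exists s; rewrite ?sub0set.
move=> X Y XY; rewrite !bier_facets_cover // => /exists_inP[s sF Ys].
by apply/exists_inP; exists s => //; exact: subset_trans XY Ys.
Qed.

Lemma imsetC_inj (T : finType) (f : T -> T) (A : {set T}) : injective f ->
  f @: (~: A) = ~: (f @: A).
Proof.
move=> fI; have [g fK gK] := injF_bij fI.
by apply/setP => x; rewrite -[x]gK in_setC !mem_imset // in_setC.
Qed.

(** The definition of a Bier sphere involves complements in the whole ground set, ghosts included;
    images commute with them because [f] is injective everywhere. *)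
Lemma bier_iso n (K L : {set {set 'I_n}}) (f : 'I_n -> 'I_n) : injective f ->
  (forall A : {set _}, (f @: A \in L) = (A \in K)) -> complex_iso (bier K) (bier L).
Proof.
move=> fI KL.
pose F (v : 'I_n + 'I_n) := match v with inl i => inl (f i) | inr i => inr (f i) end.
have FI : injective F by move=> [i|i] [j|j] //= [/fI ->].
apply: (complex_iso_bij FI) => X; rewrite !in_bier.
have FX : F @: X = sumset (f @: (inl @^-1: X)) (f @: (inr @^-1: X)).
  apply/setP => v; rewrite in_sumset; apply/imsetP/idP.
    by case=> -[i|i] iX -> /=; rewrite imset_f // inE.
  by case: v => i /imsetP[j]; rewrite inE => jX ->; [exists (inl j)|exists (inr j)].
rewrite FX preim_inl_sumset preim_inr_sumset -imsetC_inj // !KL.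
congr [&& _, _ & _]; rewrite -!setI_eq0 -imsetI; last by move=> x y _ _; apply: fI.
by rewrite imset_eq0.
Qed.

Lemma bier_alexander_dual n (K : {set {set 'I_n}}) :
  complex_iso (bier (alexander_dual K)) (bier K).
Proof.
pose F (v : 'I_n + 'I_n) : 'I_n + 'I_n := match v with inl i => inr i | inr i => inl i end.
have FI : injective F by move=> [i|i] [j|j] //= [->].
apply: (complex_iso_bij FI) => X; rewrite !in_bier.
have FX : F @: X = sumset (inr @^-1: X) (inl @^-1: X).
  apply/setP => v; rewrite in_sumset; apply/imsetP/idP.
    by case=> -[i|i] iX -> /=; rewrite inE.
  by case: v => i; rewrite inE => iX; [exists (inr i)|exists (inl i)].
rewrite FX preim_inl_sumset preim_inr_sumset !inE setCK negbK disjoint_sym.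
by rewrite andbCA.
Qed.

(** * Threshold complexes *)

(* The images of the coordinate vectors in the quotient of R^(n+1) by (1,...,1),
   on which functionals are the vectors with zero sum. *)
Definition simplex_vector (R : realType) n (i : 'I_n.+1) : 'rV[R]_n :=
  \row_k ((i == lift ord_max k)%:R - (i == ord_max)%:R).

Lemma simplex_vector_pairing (R : realType) n (y : 'I_n.+1 -> R) i :
  \sum_i y i = 0 ->
  (simplex_vector R i *m \col_k y (lift ord_max k)) 0 0 = y i.
Proof.
rewrite (bigD1_ord ord_max) //= => /eqP; rewrite addrC addr_eq0 => /eqP yS.
rewrite mxE; under eq_bigr do rewrite !mxE.
case: (unliftP ord_max i) => [k|] ->.
- rewrite (bigD1 k) //= eqxx eq_sym (negbTE (neq_lift _ _)) subr0 mul1r.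
  rewrite big1 ?addr0 // => l lk; rewrite (inj_eq lift_inj) eq_sym (negbTE lk).
  by rewrite subr0 mul0r.
- rewrite -[RHS]opprK -yS -sumrN; apply: eq_bigr => k _.
  by rewrite eqxx (negbTE (neq_lift _ _)) sub0r mulN1r.
Qed.

Lemma proper_ord_gt0 n (K : {set {set 'I_n}}) : proper_complex K -> (0 < n)%N.
Proof.
case: n K => // K Kp; have := proper_setT Kp.
suff -> : setT = set0 :> {set 'I_0} by rewrite proper_set0.
by apply/setP => -[].
Qed.

(* Scaling [e_i] and [- e_i] by [1 / a_i] and [1 / b_i], where [a_i + b_i] is the
   weight of [i] and the quota is the sum of the [b_i], makes the facet
   inequalities say exactly that [A] is below and [j |: A] above the quota. *)
Lemma threshold_polytopal (R : realType) n (K : {set {set 'I_n}}) :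
  proper_complex K -> threshold R K -> polytopal R (bier K).
Proof.
move=> Kp; have := proper_ord_gt0 Kp; case: n K Kp => // n K Kp _ [w [q [w_gt0 KE]]].
case: (@Order.TotalTheory.arg_maxP _ _ _ set0 (mem K) (fun A => \sum_(i in A) w i)
  (proper_set0 Kp)) => B BK B_max.
(* The midpoint between the largest weight of a face and [q] makes the comparison strict on both
   sides. *)
pose W := \sum_i w i; pose q' := ((\sum_(i in B) w i) + q) / 2%:R.
have B_lt : \sum_(i in B) w i < q by rewrite -KE.
have B_ge0 : 0 <= \sum_(i in B) w i by apply: sumr_ge0 => i _; exact/ltW.
have K_lt (A : {set 'I_n.+1}) : A \in K -> \sum_(i in A) w i < q'.
  by move=> /B_max /= AB; rewrite /q'; lra.
have K_gt (A : {set 'I_n.+1}) : A \notin K -> q' < \sum_(i in A) w i.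
  by rewrite KE -leNgt /q' => AB; lra.
have q'_gt0 : 0 < q' by rewrite /q'; lra.
have q'_lt : q' < W.
  by have := K_gt _ (proper_setT Kp); rewrite (eq_bigl xpredT) // => i; rewrite inE.
have W_gt0 : 0 < W by lra.
pose b i := q' / W * w i; pose a i := w i - b i.
have b_gt0 i : 0 < b i by apply: mulr_gt0 => //; apply: divr_gt0.
have a_gt0 i : 0 < a i.
  by rewrite subr_gt0 gtr_pMl // ltr_pdivrMr // mul1r.
have b_sum : \sum_i b i = q' by rewrite -mulr_sumr divfK // gt_eqF.
pose p v : 'rV[R]_n := match v with
  | inl i => (a i)^-1 *: simplex_vector R i
  | inr i => - (b i)^-1 *: simplex_vector R i
  end.
apply: (bier_polytopal Kp (p := p)) => A j AK jAK.
have jA : j \notin A.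
  by apply: contra jAK => jA; rewrite (setUidPr _) // sub1set.
(* The value at [j] is forced by the zero sum. It is above [- b j] because [A] is below the quota
   and below [a j] because [j |: A] is above it. *)
pose x := q' - b j - \sum_(i in A) w i.
have x_lt : x < a j.
  by have := K_gt _ jAK; rewrite (big_setU1 _ jA) /= /x /a; lra.
have x_gt : - b j < x by have := K_lt _ AK; rewrite /x; lra.
pose y i := if i \in A then a i else if i == j then x else - b i.
have y_sum : \sum_i y i = 0.
  rewrite (bigD1 j) //= /y (negbTE jA) eqxx.
  have : \sum_(i | i != j) (y i + b i) = \sum_(i in A) w i.
    rewrite (bigID (mem A)) /= [X in _ + X]big1 ?addr0 => [|i /andP[ij iA]].
      apply: eq_big => i; first by case: eqP => [->|]; rewrite ?(negbTE jA).
      by move=> /andP[_ iA]; rewrite /y iA /a subrK.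
    by rewrite /y (negbTE ij) (negbTE iA) addNr.
  rewrite big_split /= -/(y) => yb.
  move: b_sum; rewrite (bigD1 j) //= => bs.
  rewrite -/(y) /x; lra.
exists (\col_k y (lift ord_max k)) => v; apply/leifP.
case: v => i; rewrite in_sumset /p -scalemxAl mxE simplex_vector_pairing // /y.
- case: (boolP (i \in A)) => iA; first by rewrite mulVf ?eqxx ?gt_eqF ?a_gt0.
  rewrite mulrC ltr_pdivrMr // mul1r; case: eqP => [->//|_].
  by rewrite (lt_trans _ (a_gt0 i)) // oppr_lt0.
- rewrite !inE negb_or; case: eqP => [->|_] /=.
    by rewrite (negbTE jA) mulNr mulrC ltrNl ltr_pdivlMr ?mulN1r.
  case: (boolP (i \in A)) => iA /=.
    by rewrite mulNr (lt_trans _ ltr01) // oppr_lt0 mulr_gt0 ?invr_gt0.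
  by rewrite mulrNN mulVf ?eqxx ?gt_eqF ?b_gt0.
Qed.

(** * Complexes as decision trees *)

Fixpoint words n : seq bitseq :=
  if n is m.+1 then map (cons false) (words m) ++ map (cons true) (words m) else [:: [::]].

Lemma mem_words n a : (a \in words n) = (size a == n).
Proof.
elim: n a => [|n IH] [|b a] //=.
  by rewrite mem_cat; apply/negP => /orP[] /mapP[].
rewrite mem_cat eqSS -IH; case: b; last first.
  rewrite mem_map; last by move=> ? ? [].
  by rewrite orbC; case: mapP => // -[].
by case: mapP => [[]|_] //=; rewrite mem_map // => ? ? [].
Qed.

Lemma words_uniq n : uniq (words n).
Proof.
elim: n => //= n IH; rewrite cat_uniq !map_inj_uniq ?IH; try by move=> ? ? [].
by rewrite andbT; apply/hasPn => _ /mapP[a _ ->]; apply/mapP => -[].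
Qed.

(** * Subsets as bit words *)

Section Words.
Variables (T : finType) (n : nat) (e : T -> 'I_n) (g : 'I_n -> T).
Hypotheses (eK : cancel e g) (gK : cancel g e).
Implicit Types (A : {set T}) (a : bitseq).

(** The enumeration is a parameter because two ground sets occur: ['I_n], with identities, and its
    double, with [unsplit] and [split]. *)
Definition word A : bitseq := [seq g i \in A | i <- enum 'I_n].
Definition word_set a : {set T} := [set x | nth false a (e x)].

Lemma size_word A : size (word A) = n.
Proof. by rewrite size_map -cardE card_ord. Qed.

Lemma nth_word A x : nth false (word A) (e x) = (x \in A).
Proof.
rewrite (nth_map (e x)) ?nth_ord_enum ?eK // -cardE card_ord //.
Qed.

Lemma nth_word_ord A (i : 'I_n) : nth false (word A) i = (g i \in A).
Proof. by rewrite -nth_word gK. Qed.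

Lemma wordK A : word_set (word A) = A.
Proof. by apply/setP => x; rewrite inE nth_word. Qed.

Lemma word_setK a : size a = n -> word (word_set a) = a.
Proof.
move=> an; apply: (@eq_from_nth _ false); rewrite size_word // => k kn.
by rewrite -[k]/(val (Ordinal kn)) nth_word_ord inE gK.
Qed.

Lemma word_eqP A a : size a = n ->
  (forall x, nth false a (e x) = (x \in A)) -> word A = a.
Proof.
by move=> an aA; rewrite -[RHS]word_setK //; congr word; apply/setP => x; rewrite inE aA.
Qed.

Lemma big_words (F : {set T} -> nat) (P : pred {set T}) :
  (\sum_(A | P A) F A = \sum_(a <- words n | P (word_set a)) F (word_set a))%N.
Proof.
rewrite -(big_map word_set P F); apply: perm_big; apply: uniq_perm.
- exact: index_enum_uniq.
- rewrite map_inj_in_uniq ?words_uniq // => a b; rewrite !mem_words => /eqP an /eqP bn ab.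
  by rewrite -(word_setK an) ab word_setK.
- move=> A; rewrite mem_index_enum; apply/esym/mapP.
  by exists (word A); rewrite ?wordK // mem_words size_word.
Qed.

End Words.

Notation ord_word := (@word _ _ id).
Notation ord_set := (@word_set _ _ id).

Lemma nth_ord_word n (A : {set 'I_n}) (i : 'I_n) : nth false (ord_word A) i = (i \in A).
Proof. exact: (@nth_word_ord _ _ id id). Qed.

Lemma ord_setK n (a : bitseq) : size a = n -> ord_word (ord_set a : {set 'I_n}) = a.
Proof. exact: (@word_setK _ _ id id). Qed.

(* Families of words of length [m], as decision trees. Words longer than a
   branch belong to the family only if the remaining letters are [false], so
   that the table of a complex on [m] elements also describes the complexes
   obtained from it by adding ghost vertices. *)
Inductive table := Leaf of bool | Node of table & table.

Fixpoint lookup t (a : bitseq) :=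
  match t, a with
  | Leaf b, _ => b && ~~ has id a
  | Node t0 _, [::] => lookup t0 [::]
  | Node t0 t1, b :: a' => if b then lookup t1 a' else lookup t0 a'
  end.

Fixpoint tabulate m (f : bitseq -> bool) :=
  if m is m'.+1
  then Node (tabulate m' (fun a => f (false :: a))) (tabulate m' (fun a => f (true :: a)))
  else Leaf (f [::]).

Lemma lookup_tabulate m f a b : size a = m ->
  lookup (tabulate m f) (a ++ b) = f a && ~~ has id b.
Proof.
by elim: m f a => [f [|//]|m IH f [//|[] a] [am] /=]; rewrite // IH.
Qed.

Fixpoint table_sub t t' :=
  match t, t' with
  | Leaf b, Leaf b' => b ==> b'
  | Node t0 t1, Node t0' t1' => table_sub t0 t0' && table_sub t1 t1'
  | _, _ => false
  end.

Lemma tabulate_sub m (f f' : pred bitseq) : (forall a, size a = m -> f a -> f' a) ->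
  table_sub (tabulate m f) (tabulate m f').
Proof.
elim: m f f' => [|m IH] f f' ff' /=; first exact/implyP/ff'.
by apply/andP; split; apply: IH => a am; apply: ff'; rewrite /= am.
Qed.

Lemma table_sub_lookup t t' a : table_sub t t' -> lookup t a -> lookup t' a.
Proof.
elim: t t' a => [b|t0 IH0 t1 IH1] [b'|t0' t1'] a //=.
  by move=> /implyP bb' /andP[/bb' -> ->].
by move=> /andP[/IH0 H0 /IH1 H1]; case: a => [|[] a]; auto.
Qed.

Definition subword (a b : bitseq) := forall k, nth false a k -> nth false b k.

(** The branches at a node are the deletion and the link of the first element; besides being closed
    under subsets, the link must lie in the deletion. *)
Fixpoint is_complex t :=
  if t is Node t0 t1 then [&& is_complex t0, is_complex t1 & table_sub t1 t0] else true.

Lemma lookup_nil t a : ~~ has id a -> lookup t a = lookup t [::].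
Proof. by elim: t a => [b|t0 IH0 t1 IH1] [|[] a] //= H; [rewrite H | rewrite IH0]. Qed.

Lemma is_complex_lookup t a b : is_complex t -> subword a b -> lookup t b -> lookup t a.
Proof.
elim: t a b => [c|t0 IH0 t1 IH1] a b.
  move=> _ ab /= /andP[-> /hasPn bF]; apply/hasPn => x /(nthP false)[k ka <-].
  apply/negP => /ab bk; have kb : (k < size b)%N.
    by rewrite ltnNge; apply/negP => H; rewrite nth_default in bk.
  by have := bF _ (mem_nth false kb); rewrite bk.
move=> /= /and3P[c0 c1 s10] ab.
have tl x a' : a = x :: a' -> subword a' (behead b).
  by move=> aE k; rewrite nth_behead; have := ab k.+1; rewrite aE.
have H : lookup (Node t0 t1) b -> lookup t0 (behead b).
  by case: (b) => [|[] b'] //=; apply: table_sub_lookup.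
case: a ab tl => [|[] a] ab tl Hb.
- by apply: (IH0 _ _ c0 _ (H Hb)) => k; rewrite nth_nil.
- have := ab 0; case: b ab tl Hb {H} => [|[] b] //= ab tl Hb; try by move/(_ isT).
  by move=> _; exact: (IH1 _ _ c1 (tl _ _ erefl) Hb).
- exact: (IH0 _ _ c0 (tl _ _ erefl) (H Hb)).
Qed.

(** Pairs of a deletion and a link are enumerated in continuation-passing style, so no list of
    families is ever built. *)
Fixpoint all_complexes m (P : pred table) :=
  if m is m'.+1
  then all_complexes m' (fun t0 => all_complexes m' (fun t1 =>
    if table_sub t1 t0 then P (Node t0 t1) else true))
  else P (Leaf false) && P (Leaf true).

Lemma all_complexes_tabulate m P (f : pred bitseq) : all_complexes m P ->
  (forall a b, size a = m -> size b = m -> subword a b -> f b -> f a) -> P (tabulate m f).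
Proof.
elim: m P f => [|m IH] P f /=; first by case/andP => P0 P1 _; case: (f [::]).
move=> H fd; have cons_sub x y a b : (x ==> y) -> subword a b -> subword (x :: a) (y :: b).
  by move=> /implyP xy ab [|k] //=; apply: ab.
have fdc x a b : size a = m -> size b = m -> subword a b -> f (x :: b) -> f (x :: a).
  by move=> am bm ab; apply: fd; rewrite /= ?am ?bm //; apply: cons_sub; rewrite ?implybb.
have := IH _ _ (IH _ _ H (fdc false)) (fdc true); rewrite ifT //.
by apply: tabulate_sub => a am; apply: fd; rewrite /= ?am //; apply: cons_sub.
Qed.

Definition model n t : {set {set 'I_n}} := [set A | lookup t (ord_word A)].
Arguments model : clear implicits.

Lemma simplicial_model n t : is_complex t -> lookup t [::] -> simplicial_complex (model n t).
Proof.
move=> tc t0; apply/simplicial_complexP; split.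
  rewrite inE lookup_nil //; apply/hasPn => _ /mapP[i _ ->]; by rewrite inE.
move=> A B /subsetP AB; rewrite !inE; apply: is_complex_lookup => // k.
have [kn|kn] := ltnP k n; last by rewrite nth_default // size_word.
by rewrite -[k]/(val (Ordinal kn)) !nth_ord_word; apply: AB.
Qed.

Lemma in_model_tabulate n m f (A : {set 'I_n}) : (m <= n)%N ->
  (A \in model n (tabulate m f))
    = f (take m (ord_word A)) && (A \subset [set i : 'I_n | (i < m)%N]).
Proof.
move=> mn; rewrite inE -[ord_word A](cat_take_drop m).
rewrite lookup_tabulate ?cat_take_drop ?size_takel ?size_word //; congr (_ && _).
apply/hasPn/subsetP => [H i iA|H x xd].
- rewrite inE ltnNge; apply/negP => mi.
  have im : (i - m < size (drop m (ord_word A)))%N.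
    by rewrite size_drop size_word ltn_sub2r // (leq_ltn_trans mi).
  by have := H _ (mem_nth false im); rewrite /= nth_drop subnKC // nth_ord_word iA.
- case/(nthP false): xd => k; rewrite size_drop size_word ltn_subRL nth_drop => kn <-.
  rewrite -[(m + k)%N]/(val (Ordinal kn)) nth_ord_word.
  by apply/negP => /H; rewrite inE /= ltnNge leq_addr.
Qed.

Lemma ord_set_take n m (A : {set 'I_n}) : A \subset [set i : 'I_n | (i < m)%N] ->
  ord_set (take m (ord_word A)) = A.
Proof.
move=> /subsetP Am; apply/setP => i; rewrite inE.
have [im|mi] := ltnP i m; first by rewrite nth_take // nth_ord_word.
rewrite nth_default; last by rewrite size_take_min geq_min mi.
by apply/esym/negP => /Am; rewrite inE ltnNge mi.
Qed.

Definition table_of n m (K : {set {set 'I_n}}) := tabulate m (fun a => ord_set a \in K).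

Lemma model_table_of n m (K : {set {set 'I_n}}) : (m <= n)%N -> simplicial_complex K ->
  vertices K = [set i : 'I_n | (i < m)%N] -> K = model n (table_of m K).
Proof.
move=> mn Ks Kv; apply/setP => A; rewrite in_model_tabulate //.
have [Am|Am] := boolP (A \subset _); first by rewrite ord_set_take ?andbT.
rewrite andbF; apply/negbTE; apply: contra Am => AK.
by rewrite -Kv; apply: simplicial_vertices.
Qed.

Lemma all_complexes_table_of n m (P : pred table) (K : {set {set 'I_n}}) :
  all_complexes m P -> simplicial_complex K -> P (table_of m K).
Proof.
move=> HP /simplicial_complexP[_ Kd]; apply: all_complexes_tabulate => // a b _ _ ab.
by apply: Kd; apply/subsetP => i; rewrite !inE; apply: ab.
Qed.

(** * Relabelling words and tables *)

Definition permute (s : seq nat) (a : bitseq) : bitseq := [seq nth false a i | i <- s].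

(** [f] sends the element in position k to the one in position [nth 0 s k], so reading the word of
    an image along [s] gives back the original word. *)
Lemma permute_word (T : finType) n (e : T -> 'I_n) (g : 'I_n -> T) s :
  cancel e g -> cancel g e -> perm_eq s (iota 0 n) ->
  exists2 f : T -> T, injective f
    & forall A : {set T}, permute s (word g (f @: A)) = word g A.
Proof.
move=> eK gK sn; have ss : size s = n by rewrite (perm_size sn) size_iota.
have s_lt k : (k < n)%N -> (nth 0%N s k < n)%N.
  move=> kn; have := mem_nth 0%N (_ : k < size s)%N; rewrite ss => /(_ kn).
  by rewrite (perm_mem sn) mem_iota.
pose f x := g (Ordinal (s_lt _ (ltn_ord (e x)))).
have fI : injective f.
  move=> x y /(can_inj gK)/(congr1 val)/= /eqP.
  rewrite nth_uniq ?ss // ?(perm_uniq sn) ?iota_uniq // => /eqP/val_inj; exact: can_inj.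
exists f => // A; apply: (@eq_from_nth _ false); rewrite size_map ss ?size_word // => k kn.
rewrite (nth_map 0%N) ?ss // -[k in RHS]/(val (Ordinal kn)) (nth_word_ord eK gK).
rewrite -(mem_imset A (g (Ordinal kn)) fI).
by rewrite -(nth_word eK _ (f _)) /f gK gK.
Qed.

Lemma model_permute n m s (f h : pred bitseq) : (m <= n)%N -> perm_eq s (iota 0 m) ->
  (forall a, size a = m -> f a = h (permute s a)) ->
  exists2 g : 'I_n -> 'I_n, injective g & forall A : {set 'I_n},
    (g @: A \in model n (tabulate m f)) = (A \in model n (tabulate m h)).
Proof.
(* The permutation of the first [m] elements is extended by the identity on the ghosts. *)
move=> mn sm fh; have sn : perm_eq (s ++ iota m (n - m)) (iota 0 n).
  by rewrite -[in iota 0 n](subnKC mn) iotaD perm_cat2r.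
have [g gI gE] := @permute_word _ n id id _ (fun=> erefl) (fun=> erefl) sn.
exists g => // A; rewrite !inE -(gE A); set w := ord_word (g @: A).
have wn : size w = n by rewrite size_word.
have -> : permute (s ++ iota m (n - m)) w = permute s (take m w) ++ drop m w.
  rewrite /permute map_cat; congr cat.
    apply/eq_in_map => i; rewrite (perm_mem sm) mem_iota => im.
    by rewrite nth_take.
  apply: (@eq_from_nth _ false); first by rewrite size_map size_iota size_drop wn.
  rewrite size_map size_iota => k kn.
  by rewrite (nth_map 0%N) ?size_iota // nth_iota // nth_drop.
have tm : size (take m w) = m by rewrite size_takel ?wn.
rewrite -{1}[w](cat_take_drop m) !lookup_tabulate ?fh //.
by rewrite size_map (perm_size sm) size_iota.
Qed.

(** Elements beyond the list of weights weigh [q]. With [q] the quota, as in [has_weights], every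
    ghost alone reaches it. *)
Fixpoint wsum q (w : seq nat) (a : bitseq) : nat :=
  if a is b :: a' then (b * head q w + wsum q (behead w) a')%N else 0%N.

Lemma wsumE q w a : wsum q w a = (\sum_(i < size a) nth false a i * nth q w i)%N.
Proof.
elim: a w => [|b a IH] w; first by rewrite big_ord0.
rewrite /= IH big_ord_recl /= nth0; congr addn.
by apply: eq_bigr => i _; rewrite nth_behead.
Qed.

Lemma wsum_cat q w a b : ~~ has id b -> wsum q w (a ++ b) = wsum q w a.
Proof.
move=> bF; elim: a w => [|x a IH] w /=; last by rewrite IH.
by elim: b bF w => //= -[] // b IH /IH H w; rewrite H.
Qed.

Lemma wsum_ord_word q w n (A : {set 'I_n}) :
  wsum q w (ord_word A) = (\sum_(i in A) nth q w i)%N.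
Proof.
rewrite wsumE size_word [RHS]big_mkcond; apply: eq_bigr => i _.
by rewrite nth_ord_word; case: (i \in A); rewrite ?mul1n.
Qed.

Definition has_weights m t w q :=
  [&& (0 < q)%N, size w == m, all (leq 1) w
    & all (fun a => lookup t a == (wsum q w a < q)%N) (words m)].

Lemma has_weights_threshold (R : realType) n m f w q : (m <= n)%N ->
  has_weights m (tabulate m f) w q -> threshold R (model n (tabulate m f)).
Proof.
move=> mn /and4P[q_gt0 /eqP wm w_gt0 /allP fw].
exists (fun i => (nth q w i)%:R), q%:R; split=> [i|A].
  rewrite ltr0n; have [im|im] := ltnP i (size w); last by rewrite nth_default.
  by apply: (allP w_gt0); exact: mem_nth.
rewrite -natr_sum ltr_nat in_model_tabulate //.
have [Am|/subsetPn[i iA]] := boolP (A \subset _).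
  have sm : size (take m (ord_word A)) = m by rewrite size_takel ?size_word.
  have dF : ~~ has id (drop m (ord_word A)).
    apply/hasPn => x /(nthP false)[k]; rewrite size_drop size_word ltn_subRL nth_drop => kn <-.
    rewrite -[(m + k)%N]/(val (Ordinal kn)) nth_ord_word; apply/negP => /(subsetP Am).
    by rewrite inE /= ltnNge leq_addr.
  have := fw _ (_ : take m (ord_word A) \in words m); rewrite mem_words sm => /(_ (eqxx _)).
  rewrite -[X in lookup _ X]cats0 lookup_tabulate // => /eqP.
  by rewrite -(wsum_cat _ _ _ dF) cat_take_drop wsum_ord_word.
(* A set containing a ghost is not a face, and the default weight of the ghost already reaches the
   quota. *)
rewrite inE -leqNgt => mi; rewrite andbF; apply/esym/negbTE.
by rewrite -leqNgt (bigD1 i) //= nth_default ?wm // leq_addr.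
Qed.

(* Weights are guessed: the Chow parameters of the complex plus one, truncated at
   one of three caps, turn out to work for all threshold complexes on at most
   five vertices. *)
Definition chow m t i := count (fun a =>
  [&& ~~ nth false a i, lookup t a & ~~ lookup t (set_nth false a i true)]) (words m).

(** The quota is the least integer exceeding the weights of all faces. The guess needs no
    justification, as [has_weights] verifies it. *)
Definition is_threshold m t :=
  let c := [seq chow m t i | i <- iota 0 m] in
  has (fun cap => let w := [seq (minn x cap).+1 | x <- c] in
    has_weights m t w (foldr maxn 0 [seq wsum 0 w a | a <- words m & lookup t a]).+1)
  [:: 16; 8; 4].

(** * Recognition of the listed complexes up to relabelling *)

Inductive trie := Empty | Accept | Branch of trie & trie.

Fixpoint trie_add (k : bitseq) t :=
  match k, t with
  | [::], _ => Accept
  | b :: k', Branch l r => if b then Branch l (trie_add k' r) else Branch (trie_add k' l) r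
  | b :: k', _ => if b then Branch Empty (trie_add k' Empty) else Branch (trie_add k' Empty) Empty
  end.

Fixpoint trie_mem (k : bitseq) t :=
  match k, t with
  | [::], Accept => true
  | b :: k', Branch l r => if b then trie_mem k' r else trie_mem k' l
  | _, _ => false
  end.

Lemma trie_mem_add k k' t : trie_mem k (trie_add k' t) -> (k == k') || trie_mem k t.
Proof.
elim: k' k t => [|b k' IH] [|c k] t.
- by [].
- by case: t.
- by case: t b => [||l r] [].
have IH0 t' : trie_mem k (trie_add k' t') -> (c :: k == c :: k') || trie_mem k t'.
  by move=> /IH; rewrite eqseq_cons eqxx.
have emptyE k1 : trie_mem k1 Empty = false by case: k1.
by case: t b c IH0 => [||l r] [] [] //= H; rewrite ?emptyE //; move=> /H; rewrite ?emptyE.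
Qed.

Lemma trie_mem_foldr k s : trie_mem k (foldr trie_add Empty s) -> k \in s.
Proof.
elim: s => [|k' s IH] /=; first by case: k.
by move=> /trie_mem_add/orP[/eqP ->|/IH]; rewrite inE ?eqxx // => ->; rewrite orbT.
Qed.

Definition facets_fun m (fs : seq (seq nat)) (a : bitseq) :=
  has (fun F => all (fun i => nth false a i ==> (i \in F)) (iota 0 m)) fs.

Definition facets_table m fs := tabulate m (facets_fun m fs).

(** A complex is keyed by its truth table, a word with one letter per subset. For [m = 5] there are
    120 keys for each of the 88 complexes; in a trie a search costs only the length of a key. *)
Definition orbits m (fss : seq (seq (seq nat))) : seq bitseq :=
  flatten [seq let t := facets_table m fs in
    [seq [seq lookup t (permute s a) | a <- words m] | s <- permutations (iota 0 m)]
    | fs <- fss].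

Definition unit_word m i := set_nth false (nseq m false) i true.

Lemma nth_unit_word m i k : nth false (unit_word m i) k = (k == i).
Proof. by rewrite nth_set_nth /= nth_nseq if_same; case: eqP. Qed.

(* Nested conditionals rather than a disjunction, whose operands would all be
   evaluated. *)
Definition classified m T t :=
  if ~~ lookup t (nseq m false) then true else
  if ~~ all (fun i => lookup t (unit_word m i)) (iota 0 m) then true else
  if trie_mem [seq lookup t a | a <- words m] T then true else is_threshold m t.

Definition classification m fss :=
  let T := foldr trie_add Empty (orbits m fss) in all_complexes m (classified m T).

(** The first two outcomes of [classified] contradict that [K] contains the empty set and has the
    first [m] elements as vertices. A key found in the trie yields a relabelling, and the last
    outcome yields weights. *)
Lemma classification_sound (R : realType) n m fss (K : {set {set 'I_n}}) : (m <= n)%N ->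
  classification m fss -> simplicial_complex K -> vertices K = [set i : 'I_n | (i < m)%N] ->
  threshold R K \/ exists2 fs, fs \in fss & exists2 g : 'I_n -> 'I_n, injective g &
    forall A : {set 'I_n}, (g @: A \in K) = (A \in model n (facets_table m fs)).
Proof.
move=> mn cl Ks Kv; have := all_complexes_table_of cl Ks.
have KE := model_table_of mn Ks Kv.
have lookupE a : size a = m -> lookup (table_of m K) a = (ord_set a \in K).
  by move=> am; rewrite -[a in LHS]cats0 lookup_tabulate // andbT.
(* The nested conditionals are convertible to a disjunction. *)
rewrite /classified -!/(_ || _).
case/or4P => [||/trie_mem_foldr/flatten_mapP[fs fs_in /mapP[s sm keyE]]|/hasP[cap _ w]].
- rewrite lookupE ?size_nseq //; suff -> : ord_set (nseq m false) = set0 :> {set 'I_n}.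
    by case/simplicial_complexP: Ks => ->.
  by apply/setP => j; rewrite !inE nth_nseq if_same.
- case/allPn => i; rewrite mem_iota /= => im; rewrite lookupE; last first.
    by rewrite size_set_nth size_nseq (maxn_idPr im).
  suff -> : ord_set (unit_word m i) = [set (Ordinal (leq_trans im mn))].
    have := (_ : Ordinal (leq_trans im mn) \in vertices K).
    by rewrite {1}Kv !inE /= => /(_ im) ->.
  by apply/setP => j; rewrite !inE nth_unit_word.
- right; exists fs => //; rewrite {1}KE; apply: (@model_permute _ _ s) => //.
    by rewrite -mem_permutations.
  move=> a am; have /eq_in_map/(_ a) := keyE.
  rewrite mem_words am eqxx => /(_ isT); rewrite lookupE // => ->.
  rewrite -[permute s a]cats0 lookup_tabulate ?cats0 ?andbT //.
  by rewrite size_map (perm_size (_ : perm_eq s (iota 0 m))) ?size_iota // -mem_permutations.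
- by left; rewrite KE; apply: has_weights_threshold w.
Qed.

(** * Integer realizations *)

Fixpoint dot (u v : seq Z) : Z :=
  match u, v with
  | x :: u', y :: v' => Z.add (Z.mul x y) (dot u' v')
  | _, _ => Z0
  end.

(** Dividing by the content keeps the integers small during the elimination. *)
Definition primitive (u : seq Z) : seq Z :=
  let d := foldr Z.gcd Z0 u in [seq Z.div x d | x <- u].

(* From a basis of a lattice of finite index in the orthogonal complement of
   some vectors, one for those vectors and [x]. *)
Fixpoint kernel_step (x : seq Z) (seen basis : seq (seq Z)) :=
  if basis is u :: basis' then
    let ux := dot u x in
    if Z.eqb ux Z0 then kernel_step x (u :: seen) basis' else
    seen ++ [seq let wx := dot w x in
       primitive [seq Z.sub (Z.mul ux p.1) (Z.mul wx p.2) | p <- zip w u] | w <- basis']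
  else seen.

Definition unit_basis n : seq (seq Z) :=
  [seq [seq if i == j then Zpos xH else Z0 | j <- iota 0 n] | i <- iota 0 n].

(* An affine hyperplane [dot p c = b] through [n - 1] points of Z^(n-1) is
   encoded by [h = b :: c], the points being extended by [-1]. Nothing is proved
   about the computation of [h]: [is_facet] checks the result. *)
Definition homogeneous (p : seq Z) : seq Z := Zneg xH :: p.

Definition hyperplane n (ps : seq (seq Z)) : seq Z :=
  let h := head [::] (foldr (fun p => kernel_step (homogeneous p) [::]) (unit_basis n) ps) in
  if Z.ltb (head Z0 h) Z0 then map Z.opp h else h.

Fixpoint supports (h : seq Z) (s : bitseq) (ps : seq (seq Z)) : bool :=
  match s, ps with
  | b :: s', p :: ps' => let x := dot (homogeneous p) h in
      (if b then Z.eqb x Z0 else Z.ltb x Z0) && supports h s' ps'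
  | [::], [::] => true
  | _, _ => false
  end.

Definition facet_word (a : bitseq) j := a ++ map negb (set_nth false a j true).

Definition is_facet n ps (s : bitseq) :=
  let h := hyperplane n (mask s ps) in Z.ltb Z0 (head Z0 h) && supports h s ps.

(** The bound on sizes ensures that no coordinate is lost when points are padded by zeros to [n.-1]
    coordinates. For [j] already in [a] the enlarged word is [a] itself, so nothing is checked. *)
Definition realizes n t (ps : seq (seq Z)) :=
  all (fun p => size p <= n.-1)%N ps &&
  all (fun a => if lookup t a then all (fun j =>
    if lookup t (set_nth false a j true) then true else is_facet n ps (facet_word a j))
    (iota 0 n) else true) (words n).

Section Realization.
Variable R : realType.

Definition ZR : Z -> R := intr \o int_of_Z.

HB.instance Definition _ := GRing.RMorphism.copy ZR (intr \o int_of_Z).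

Lemma ZR_lt0 x : Z.ltb x Z0 -> ZR x < 0.
Proof. by case: x => // x _; rewrite /ZR /= ltrz0. Qed.

Lemma ZR_gt0 x : Z.ltb Z0 x -> 0 < ZR x.
Proof. by case: x => // x _; rewrite /ZR /= ltr0z; apply/ssrnat.ltP/Pnat.Pos2Nat.is_pos. Qed.

Lemma ZR_dot d u v : (size u <= d)%N ->
  ZR (dot u v) = \sum_(k < d) ZR (nth Z0 u k) * ZR (nth Z0 v k).
Proof.
elim: u v d => [|x u IH] [|y v] d ud.
- by rewrite big1 ?rmorph0 // => k _; rewrite nth_nil /ZR /= mul0r.
- by rewrite big1 ?rmorph0 // => k _; rewrite nth_nil /ZR /= mul0r.
- by rewrite big1 ?rmorph0 // => k _; rewrite [nth _ [::] _]nth_nil /ZR /= mulr0.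
case: d ud => // d ud; rewrite big_ord_recl /= -IH // -rmorphM -rmorphD //.
Qed.

Lemma supports_nth h s ps k : supports h s ps -> (k < size s)%N ->
  let x := dot (homogeneous (nth [::] ps k)) h in
  if nth false s k then x = Z0 else Z.ltb x Z0.
Proof.
elim: s ps k => // b s IH [|p ps] //= [|k] /andP[H Hs]; last exact: IH.
by move=> _ /=; case: b H => // /Z.eqb_eq.
Qed.

Lemma realizes_polytopal n t ps : proper_complex (model n t) -> realizes n t ps ->
  polytopal R (bier (model n t)).
Proof.
move=> Kp /andP[/allP ps_size /allP tP].
pose point (v : 'I_n + 'I_n) := nth [::] ps (unsplit v).
apply: (bier_polytopal Kp (p := fun v => \row_k ZR (nth Z0 (point v) k))) => A j.
rewrite !inE => At jAt; have jn := ltn_ord j.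
have := tP (ord_word A); rewrite mem_words size_word eqxx At => /(_ isT)/allP/(_ (val j)).
have -> : set_nth false (ord_word A) j true = ord_word (j |: A).
  apply/esym/(@word_eqP _ _ id id) => //.
    by rewrite size_set_nth size_word (maxn_idPr jn).
  by move=> i; rewrite nth_set_nth /= !inE nth_ord_word -val_eqE; case: eqP.
rewrite mem_iota ltn_ord (negbTE jAt) => /(_ isT)/andP[].
set h := hyperplane _ _; set b := head Z0 h => b_gt0 hP.
(* Since [b] is positive, dividing the coefficients by it normalizes the bound to 1. The pairing
   then exceeds 1 by the value of [dot] divided by [b], so the signs checked by [supports]
   decide. *)
exists (\col_k (ZR (nth Z0 (behead h) k) / ZR b)) => v; apply/leifP.
have point_size : (size (point v) <= n.-1)%N.
  rewrite /point; have [H|H] := ltnP (unsplit v) (size ps); first exact/ps_size/mem_nth.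
  by rewrite nth_default.
have -> : (\row_(k < n.-1) ZR (nth Z0 (point v) k) *m
    (\col_(k < n.-1) (ZR (nth Z0 (behead h) k) / ZR b))) 0 0
    = 1 + ZR (dot (homogeneous (point v)) h) / ZR b.
  have -> : ZR (dot (homogeneous (point v)) h) = - ZR b + ZR (dot (point v) (behead h)).
    rewrite -rmorphN -rmorphD; congr (ZR _); rewrite /b.
    by case: (h) => [|x h'] /=; [case: (point v) | case: x].
  rewrite mulrDl mulNr divff ?gt_eqF ?ZR_gt0 // addrA subrr add0r.
  rewrite (ZR_dot _ point_size) mulr_suml mxE; apply: eq_bigr => k _.
  by rewrite !mxE mulrA.
have vn : (unsplit v < size (facet_word (ord_word A) j))%N.
  rewrite size_cat size_map size_set_nth size_word (maxn_idPr jn).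
  exact: ltn_ord.
have -> : (v \in bier_facet A j) = nth false (facet_word (ord_word A) j) (unsplit v).
  rewrite in_sumset nth_cat size_word; case: (v) => i /=.
    by rewrite ltn_ord nth_ord_word.
  rewrite ltnNge leq_addr /= addKn (nth_map false); last first.
    by rewrite size_set_nth size_word (maxn_idPr jn).
  by rewrite nth_set_nth /= nth_ord_word !inE -val_eqE; case: eqP.
have := supports_nth hP vn; rewrite -/(point v) /=.
case: ifP => _ H; first by rewrite H rmorph0 mul0r addr0.
by rewrite gtrDl nmulr_rlt0 ?ZR_lt0 // invr_gt0 ZR_gt0.
Qed.

End Realization.

(** * Non-threshold complexes on at most five vertices *)

(* Representatives, given by their facets, of the non-threshold complexes on five
   and four vertices. The first 48 of the former represent the classes of Bier
   spheres. *)
Definition nonthreshold5 : seq (seq (seq nat)) := [::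
[:: [:: 1; 2]; [:: 0; 3]; [:: 4]];
[:: [:: 0; 1]; [:: 1; 2]; [:: 0; 3]; [:: 4]];
[:: [:: 1; 2]; [:: 0; 3]; [:: 0; 4]];
[:: [:: 0; 1]; [:: 1; 2]; [:: 0; 3]; [:: 0; 4]];
[:: [:: 0; 2]; [:: 1; 2]; [:: 0; 3]; [:: 1; 3]; [:: 4]];
[:: [:: 0; 2]; [:: 1; 2]; [:: 1; 3]; [:: 0; 4]];
[:: [:: 0; 1]; [:: 0; 2]; [:: 1; 2]; [:: 1; 3]; [:: 0; 4]];
[:: [:: 0; 1; 2]; [:: 1; 3]; [:: 0; 4]];
[:: [:: 0; 2]; [:: 1; 2]; [:: 0; 3]; [:: 1; 3]; [:: 0; 4]];
[:: [:: 0; 2]; [:: 1; 2]; [:: 0; 3]; [:: 1; 3]; [:: 0; 4]; [:: 1; 4]];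
[:: [:: 1; 2]; [:: 1; 3]; [:: 2; 3]; [:: 0; 4]];
[:: [:: 0; 1]; [:: 1; 2]; [:: 1; 3]; [:: 2; 3]; [:: 0; 4]];
[:: [:: 0; 1]; [:: 0; 2]; [:: 1; 2]; [:: 1; 3]; [:: 2; 3]; [:: 0; 4]];
[:: [:: 0; 1; 2]; [:: 1; 3]; [:: 2; 3]; [:: 0; 4]];
[:: [:: 1; 2; 3]; [:: 0; 4]];
[:: [:: 0; 1]; [:: 1; 2; 3]; [:: 0; 4]];
[:: [:: 0; 1]; [:: 0; 2]; [:: 1; 2; 3]; [:: 0; 4]];
[:: [:: 0; 1; 2]; [:: 1; 2; 3]; [:: 0; 4]];
[:: [:: 0; 1]; [:: 0; 2]; [:: 0; 3]; [:: 1; 2; 3]; [:: 0; 4]];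
[:: [:: 0; 1; 2]; [:: 0; 3]; [:: 1; 2; 3]; [:: 0; 4]];
[:: [:: 0; 1; 2]; [:: 0; 1; 3]; [:: 1; 2; 3]; [:: 0; 4]];
[:: [:: 0; 1]; [:: 0; 2]; [:: 0; 3]; [:: 2; 3]; [:: 0; 4]; [:: 1; 4]];
[:: [:: 0; 1]; [:: 0; 2; 3]; [:: 0; 4]; [:: 1; 4]];
[:: [:: 0; 2; 3]; [:: 0; 1; 4]];
[:: [:: 1; 2]; [:: 0; 3]; [:: 2; 3]; [:: 0; 4]; [:: 1; 4]];
[:: [:: 0; 1]; [:: 1; 2]; [:: 0; 3]; [:: 2; 3]; [:: 0; 4]; [:: 1; 4]];
[:: [:: 1; 2]; [:: 0; 2; 3]; [:: 0; 4]; [:: 1; 4]];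
[:: [:: 0; 1]; [:: 0; 2]; [:: 1; 2]; [:: 0; 3]; [:: 2; 3]; [:: 0; 4]; [:: 1; 4]];
[:: [:: 0; 1; 2]; [:: 0; 3]; [:: 2; 3]; [:: 0; 4]; [:: 1; 4]];
[:: [:: 0; 1]; [:: 1; 2]; [:: 0; 2; 3]; [:: 0; 4]; [:: 1; 4]];
[:: [:: 0; 1; 2]; [:: 0; 2; 3]; [:: 0; 4]; [:: 1; 4]];
[:: [:: 1; 2]; [:: 0; 2; 3]; [:: 0; 1; 4]];
[:: [:: 0; 2]; [:: 1; 2]; [:: 0; 3]; [:: 1; 3]; [:: 2; 3]; [:: 0; 4]; [:: 1; 4]];
[:: [:: 0; 2]; [:: 1; 2]; [:: 0; 3]; [:: 1; 3]; [:: 2; 3]; [:: 0; 1; 4]];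
[:: [:: 0; 1; 2]; [:: 0; 3]; [:: 1; 3]; [:: 2; 3]; [:: 0; 1; 4]];
[:: [:: 1; 2]; [:: 1; 3]; [:: 0; 2; 3]; [:: 0; 4]; [:: 1; 4]];
[:: [:: 0; 1]; [:: 1; 2]; [:: 1; 3]; [:: 0; 2; 3]; [:: 0; 4]; [:: 1; 4]];
[:: [:: 0; 1; 2]; [:: 1; 3]; [:: 0; 2; 3]; [:: 0; 4]; [:: 1; 4]];
[:: [:: 1; 2]; [:: 1; 3]; [:: 0; 2; 3]; [:: 0; 1; 4]];
[:: [:: 0; 2; 3]; [:: 1; 2; 3]; [:: 0; 4]; [:: 1; 4]];
[:: [:: 0; 1]; [:: 0; 2; 3]; [:: 1; 2; 3]; [:: 0; 4]; [:: 1; 4]];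
[:: [:: 0; 1]; [:: 0; 2]; [:: 0; 3]; [:: 1; 3]; [:: 2; 3]; [:: 0; 4]; [:: 1; 4]; [:: 2; 4]];
[:: [:: 0; 2]; [:: 0; 1; 3]; [:: 2; 3]; [:: 0; 4]; [:: 1; 4]; [:: 2; 4]];
[:: [:: 1; 3]; [:: 0; 2; 3]; [:: 0; 1; 4]; [:: 2; 4]];
[:: [:: 0; 2]; [:: 1; 2]; [:: 0; 1; 3]; [:: 2; 3]; [:: 0; 4]; [:: 1; 4]; [:: 2; 4]];
[:: [:: 0; 1; 2; 3]; [:: 1; 2; 4]; [:: 0; 3; 4]];
[:: [:: 0; 1; 2; 3]; [:: 0; 1; 4]; [:: 1; 2; 4]; [:: 0; 3; 4]];
[:: [:: 0; 1; 2; 3]; [:: 0; 2; 4]; [:: 1; 2; 4]; [:: 0; 3; 4]; [:: 1; 3; 4]];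
[:: [:: 0; 1; 2]; [:: 0; 2; 3]; [:: 0; 1; 4]];
[:: [:: 0; 1; 2]; [:: 1; 3]; [:: 0; 2; 3]; [:: 0; 1; 4]];
[:: [:: 0; 1; 2]; [:: 0; 2; 3]; [:: 1; 2; 3]; [:: 0; 4]; [:: 1; 4]];
[:: [:: 0; 2; 3]; [:: 1; 2; 3]; [:: 0; 1; 4]];
[:: [:: 0; 1; 2]; [:: 0; 2; 3]; [:: 1; 2; 3]; [:: 0; 1; 4]];
[:: [:: 0; 1; 3]; [:: 0; 2; 3]; [:: 0; 4]; [:: 1; 4]; [:: 2; 4]];
[:: [:: 0; 1; 3]; [:: 0; 2; 3]; [:: 0; 1; 4]; [:: 2; 4]];
[:: [:: 0; 1; 3]; [:: 0; 2; 3]; [:: 0; 1; 4]; [:: 0; 2; 4]];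
[:: [:: 0; 2]; [:: 1; 2]; [:: 0; 1; 3]; [:: 2; 3]; [:: 0; 1; 4]; [:: 2; 4]];
[:: [:: 1; 2]; [:: 0; 1; 3]; [:: 0; 2; 3]; [:: 0; 4]; [:: 1; 4]; [:: 2; 4]];
[:: [:: 1; 2]; [:: 1; 3]; [:: 0; 2; 3]; [:: 0; 1; 4]; [:: 2; 4]];
[:: [:: 0; 1; 2]; [:: 1; 3]; [:: 0; 2; 3]; [:: 0; 1; 4]; [:: 2; 4]];
[:: [:: 1; 2]; [:: 0; 1; 3]; [:: 0; 2; 3]; [:: 0; 1; 4]; [:: 2; 4]];
[:: [:: 1; 2]; [:: 0; 1; 3]; [:: 0; 2; 3]; [:: 0; 1; 4]; [:: 0; 2; 4]];
[:: [:: 0; 1; 3]; [:: 0; 2; 3]; [:: 1; 2; 3]; [:: 0; 4]; [:: 1; 4]; [:: 2; 4]];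
[:: [:: 0; 2; 3]; [:: 1; 2; 3]; [:: 0; 1; 4]; [:: 2; 4]];
[:: [:: 0; 1; 2]; [:: 0; 2; 3]; [:: 1; 2; 3]; [:: 0; 1; 4]; [:: 2; 4]];
[:: [:: 0; 1; 3]; [:: 0; 2; 3]; [:: 1; 2; 3]; [:: 0; 1; 4]; [:: 2; 4]];
[:: [:: 0; 1; 3]; [:: 1; 2; 3]; [:: 0; 1; 4]; [:: 0; 2; 4]];
[:: [:: 0; 1; 2]; [:: 0; 1; 3]; [:: 1; 2; 3]; [:: 0; 1; 4]; [:: 0; 2; 4]];
[:: [:: 0; 1; 3]; [:: 0; 2; 3]; [:: 1; 2; 3]; [:: 0; 1; 4]; [:: 0; 2; 4]];
[:: [:: 0; 1; 3]; [:: 0; 2; 3]; [:: 1; 2; 3]; [:: 0; 1; 4]; [:: 0; 2; 4]; [:: 1; 2; 4]];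
[:: [:: 1; 2]; [:: 1; 3]; [:: 0; 2; 3]; [:: 0; 1; 4]; [:: 2; 4]; [:: 3; 4]];
[:: [:: 0; 1; 2]; [:: 1; 3]; [:: 0; 2; 3]; [:: 0; 1; 4]; [:: 2; 4]; [:: 3; 4]];
[:: [:: 1; 2]; [:: 0; 1; 3]; [:: 0; 2; 3]; [:: 0; 1; 4]; [:: 0; 2; 4]; [:: 3; 4]];
[:: [:: 0; 2; 3]; [:: 1; 2; 3]; [:: 0; 1; 4]; [:: 2; 4]; [:: 3; 4]];
[:: [:: 0; 1; 2]; [:: 0; 2; 3]; [:: 1; 2; 3]; [:: 0; 1; 4]; [:: 2; 4]; [:: 3; 4]];
[:: [:: 0; 1; 3]; [:: 1; 2; 3]; [:: 0; 1; 4]; [:: 0; 2; 4]; [:: 3; 4]];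
[:: [:: 0; 1; 2]; [:: 0; 1; 3]; [:: 1; 2; 3]; [:: 0; 1; 4]; [:: 0; 2; 4]; [:: 3; 4]];
[:: [:: 0; 1; 3]; [:: 0; 2; 3]; [:: 1; 2; 3]; [:: 0; 1; 4]; [:: 0; 2; 4]; [:: 3; 4]];
[:: [:: 1; 2; 3]; [:: 0; 1; 4]; [:: 0; 2; 4]; [:: 0; 3; 4]];
[:: [:: 0; 1; 2]; [:: 1; 2; 3]; [:: 0; 1; 4]; [:: 0; 2; 4]; [:: 0; 3; 4]];
[:: [:: 0; 1; 2]; [:: 0; 1; 3]; [:: 1; 2; 3]; [:: 0; 1; 4]; [:: 0; 2; 4]; [:: 0; 3; 4]];
[:: [:: 0; 1; 3]; [:: 0; 2; 3]; [:: 1; 2; 3]; [:: 0; 1; 4]; [:: 0; 2; 4]; [:: 1; 2; 4]; [:: 3; 4]];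
[:: [:: 0; 1; 2]; [:: 0; 1; 3]; [:: 0; 2; 3]; [:: 1; 2; 3]; [:: 1; 2; 4]; [:: 0; 3; 4]];
[:: [:: 0; 2; 3]; [:: 1; 2; 3]; [:: 0; 1; 4]; [:: 1; 2; 4]; [:: 0; 3; 4]];
[:: [:: 0; 1; 2]; [:: 0; 2; 3]; [:: 1; 2; 3]; [:: 0; 1; 4]; [:: 1; 2; 4]; [:: 0; 3; 4]];
[:: [:: 0; 1; 2]; [:: 0; 1; 3]; [:: 0; 2; 3]; [:: 1; 2; 3]; [:: 0; 1; 4]; [:: 1; 2; 4]; [:: 0; 3;
  4]];
[:: [:: 0; 1; 3]; [:: 0; 2; 3]; [:: 1; 2; 3]; [:: 0; 1; 4]; [:: 0; 2; 4]; [:: 1; 2; 4]; [:: 0; 3;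
  4]];
[:: [:: 0; 1; 2]; [:: 0; 1; 3]; [:: 0; 2; 3]; [:: 1; 2; 3]; [:: 0; 2; 4]; [:: 1; 2; 4]; [:: 0; 3;
  4]; [:: 1; 3; 4]]].

Definition nonthreshold4 : seq (seq (seq nat)) := [::
[:: [:: 1; 2]; [:: 0; 3]];
[:: [:: 0; 1]; [:: 1; 2]; [:: 0; 3]];
[:: [:: 0; 2]; [:: 1; 2]; [:: 0; 3]; [:: 1; 3]]].

(* For each complex of [nonthreshold5] from the 49th on, the index of the complex
   with an isomorphic Bier sphere among the first 48 and the images of the
   vertices 0, ..., 4 and then of their copies, numbered 5, ..., 9. *)
Definition bier_maps5 : seq (nat * seq nat) := [::
(23, [:: 0; 6; 7; 1; 2; 5; 9; 8; 3; 4]);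
(30, [:: 5; 7; 6; 8; 9; 0; 2; 1; 3; 4]);
(19, [:: 6; 7; 5; 8; 9; 1; 2; 0; 3; 4]);
(39, [:: 7; 8; 5; 6; 9; 2; 3; 0; 1; 4]);
(17, [:: 6; 7; 0; 8; 3; 1; 2; 5; 9; 4]);
(38, [:: 5; 7; 8; 6; 9; 0; 2; 3; 1; 4]);
(31, [:: 0; 6; 1; 7; 2; 5; 9; 3; 8; 4]);
(23, [:: 0; 6; 9; 7; 8; 5; 1; 4; 2; 3]);
(33, [:: 5; 6; 9; 7; 8; 0; 1; 4; 2; 3]);
(36, [:: 5; 7; 8; 6; 9; 0; 2; 3; 1; 4]);
(42, [:: 5; 6; 8; 9; 7; 0; 1; 3; 4; 2]);
(28, [:: 5; 7; 6; 8; 9; 0; 2; 1; 3; 4]);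
(29, [:: 5; 7; 8; 6; 9; 0; 2; 3; 1; 4]);
(22, [:: 5; 7; 8; 6; 9; 0; 2; 3; 1; 4]);
(18, [:: 6; 7; 8; 5; 9; 1; 2; 3; 0; 4]);
(35, [:: 7; 8; 5; 6; 9; 2; 3; 0; 1; 4]);
(13, [:: 6; 7; 5; 8; 9; 1; 2; 0; 3; 4]);
(16, [:: 6; 7; 8; 5; 9; 1; 2; 3; 0; 4]);
(26, [:: 7; 5; 8; 6; 9; 2; 0; 3; 1; 4]);
(7, [:: 6; 5; 7; 8; 9; 1; 0; 2; 3; 4]);
(15, [:: 6; 7; 8; 5; 9; 1; 2; 3; 0; 4]);
(14, [:: 6; 7; 8; 5; 9; 1; 2; 3; 0; 4]);
(41, [:: 5; 6; 8; 9; 7; 0; 1; 3; 4; 2]);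
(27, [:: 5; 7; 6; 8; 9; 0; 2; 1; 3; 4]);
(21, [:: 5; 6; 9; 7; 8; 0; 1; 4; 2; 3]);
(32, [:: 7; 8; 5; 6; 9; 2; 3; 0; 1; 4]);
(12, [:: 6; 7; 5; 8; 9; 1; 2; 0; 3; 4]);
(25, [:: 6; 5; 9; 7; 8; 1; 0; 4; 2; 3]);
(6, [:: 6; 5; 7; 8; 9; 1; 0; 2; 3; 4]);
(11, [:: 6; 7; 8; 5; 9; 1; 2; 3; 0; 4]);
(9, [:: 5; 7; 8; 9; 6; 0; 2; 3; 4; 1]);
(8, [:: 5; 7; 8; 9; 6; 0; 2; 3; 4; 1]);
(3, [:: 5; 6; 8; 9; 7; 0; 1; 3; 4; 2]);
(10, [:: 6; 7; 8; 5; 9; 1; 2; 3; 0; 4]);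
(4, [:: 5; 7; 8; 6; 9; 0; 2; 3; 1; 4]);
(24, [:: 5; 8; 9; 7; 6; 0; 3; 4; 2; 1]);
(5, [:: 7; 6; 5; 8; 9; 2; 1; 0; 3; 4]);
(1, [:: 6; 5; 7; 8; 9; 1; 0; 2; 3; 4]);
(2, [:: 5; 8; 9; 6; 7; 0; 3; 4; 1; 2]);
(0, [:: 5; 8; 6; 7; 9; 0; 3; 1; 2; 4])].

Local Open Scope Z_scope.

(* Polytopes realizing the Bier spheres on [n] elements: the points of the vertices
   0, ..., n - 1 and then of their copies, the empty list being put at the origin
   for ghost vertices. They were found by numerical optimization and rounding. *)
Definition points6 : seq (seq (seq Z)) := [::
[:: [:: 1; 1; -1; 1; 0]; [:: -1; 0; 1; 1; 1]; [:: -1; -1; 1; 1; 0]; [:: 0; 0; -2; 0; 0]; [:: 1; 0;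
  0; -1; 0]; [::]; [:: -3; -1; -1; -1; -1]; [:: 2; -3; -2; 0; -2]; [:: 1; 2; -1; -1; 0]; [:: 2; 0;
  4; -1; 0]; [:: -1; 0; 0; 3; -1]; [:: 1; 1; 0; -1; 6]];
[:: [:: 1; 1; 0; 0; 0]; [:: -1; 0; 1; 0; 0]; [:: -1; -1; 0; 0; 0]; [:: 0; 0; -1; 0; 0]; [:: 0; 0;
  0; -1; 0]; [::]; [:: -2; -1; -1; -1; -1]; [:: 2; -1; 0; 0; 0]; [:: 0; 2; -1; -1; -1]; [:: 0; 0;
  2; -1; 0]; [:: 0; -1; 0; 2; -1]; [:: 0; 0; 0; 0; 3]];
[:: [:: 1; 0; -1; -1; 0]; [:: -1; 1; 0; 1; 0]; [:: 0; 0; 1; 1; 0]; [:: 0; 0; -2; 0; 0]; [:: 0; 0;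
  0; -1; 0]; [::]; [:: -4; -1; 1; 1; 0]; [:: 1; -3; -1; -1; 0]; [:: -2; 2; -2; -1; -1]; [:: 1; 1;
  2; -1; -1]; [:: 2; 1; -2; 2; -1]; [:: 0; 0; 0; 0; 3]];
[:: [:: 2; 1; 0; 1; 1]; [:: -1; 1; 2; 1; 0]; [:: -1; -1; 2; 0; 0]; [:: 0; -1; -1; 1; 1]; [:: 1; 0;
  0; -1; 0]; [::]; [:: -2; -1; 0; -1; -1]; [:: 1; -2; -1; -1; 0]; [:: 0; 2; -1; 0; -1]; [:: 1; 0;
  4; 0; -1]; [:: 0; -1; 1; 4; 0]; [:: -1; 0; 0; -1; 4]];
[:: [:: 1; 0; 0; 0; 0]; [:: -1; 0; 0; 0; 0]; [:: 0; -1; 1; 0; 0]; [:: 0; 1; -1; 0; 0]; [:: 0; 0;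
  0; -1; 0]; [::]; [:: -2; -1; -1; -1; -1]; [:: 2; -1; -1; -1; -1]; [:: 0; 3; 0; 0; -1]; [:: 0; 0;
  3; 0; 0]; [:: 0; 0; 0; 1; 0]; [:: 0; 0; 0; -1; 3]];
[:: [:: 1; 0; 1; 0; 0]; [:: -2; 0; 0; 1; 0]; [:: -1; -1; 1; 0; 0]; [:: 0; 0; -1; 1; 0]; [:: 0; 0;
  0; -1; 0]; [::]; [:: -2; -2; -3; -1; 0]; [:: 2; -1; -2; -1; 0]; [:: 0; 3; -1; 0; -1]; [:: -1; 0;
  2; -1; 0]; [:: 0; 0; 0; 2; -1]; [:: -1; 0; 1; 1; 2]];
[:: [:: 2; 1; 1; 0; 0]; [:: -1; 1; 0; 1; 0]; [:: 0; -1; 1; 1; 0]; [:: -1; 0; -1; 0; 0]; [:: 1; 0;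
  0; -1; 0]; [::]; [:: -2; -1; -1; -1; -1]; [:: 2; -1; -1; -1; 0]; [:: 0; 3; -1; -1; -1]; [:: 0;
  0; 2; 0; -1]; [:: 0; 0; -1; 3; 0]; [:: -1; 0; 0; -1; 3]];
[:: [:: 1; 1; 2; 0; 1]; [:: -2; 0; 1; 2; 0]; [:: 0; -1; 1; 1; 1]; [:: 0; 0; -1; 0; 0]; [:: 0; 0;
  0; -1; 0]; [::]; [:: -2; -2; -1; -1; -1]; [:: 2; -1; -1; -1; 0]; [:: 0; 2; -1; -1; -1]; [:: -1;
  0; 3; -1; -1]; [:: 1; -1; 0; 3; -1]; [:: 0; 0; -1; 0; 3]];
[:: [:: 2; 0; 1; 1; 0]; [:: -2; 0; 0; 1; 0]; [:: 0; -1; 1; 0; 0]; [:: 0; 0; -1; 1; 0]; [:: 1; 0;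
  0; -1; 0]; [::]; [:: -3; -2; -2; -1; 0]; [:: 2; -2; -2; -1; 0]; [:: 0; 2; 0; 0; -1]; [:: 0; 0;
  2; -1; -1]; [:: 0; 0; 1; 2; -1]; [:: 1; 0; 1; 1; 3]];
[:: [:: 2; 0; 0; 1; 1]; [:: -1; 0; 0; 0; 0]; [:: 0; -1; 1; 1; 0]; [:: 0; 0; -1; 0; 0]; [:: 0; 0;
  0; -2; 0]; [::]; [:: -2; -2; -1; -1; -1]; [:: 2; -2; -1; 0; 0]; [:: 0; 2; -1; -1; 0]; [:: 0; 0;
  2; -1; -1]; [:: 1; 0; 0; 2; -1]; [:: 0; 0; 0; 0; 3]];
[:: [:: 1; 1; 0; -1; 0]; [:: -1; 1; 0; 1; 1]; [:: 0; -1; 0; 1; 1]; [:: 0; 0; -2; 1; 0]; [:: 0; 0;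
  0; -2; 0]; [::]; [:: -4; -1; -1; -1; 0]; [:: 2; -1; -2; -1; -2]; [:: -1; 4; 0; -1; -1]; [:: 0;
  -1; 3; -1; -1]; [:: 1; 0; 0; 4; 0]; [:: 1; 0; 0; -1; 4]];
[:: [:: 1; 1; 1; -1; 0]; [:: -2; 1; 1; 0; 1]; [:: -1; -2; 1; 0; 0]; [:: 0; 0; -2; 1; 0]; [:: 1; 0;
  0; -2; 0]; [::]; [:: -3; -1; -1; -1; -1]; [:: 4; 0; -1; -1; -2]; [:: 0; 3; -1; -2; 0]; [:: 0;
  -2; 4; -2; -1]; [:: 0; 0; 1; 3; -1]; [:: 1; -1; -1; 0; 6]];
[:: [:: 2; 1; 1; 1; 1]; [:: -2; 2; 0; 1; 0]; [:: 0; -2; 1; 1; 0]; [:: 0; 0; -2; 1; 0]; [:: 1; 0;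
  0; -2; 0]; [::]; [:: -2; -1; -2; -1; -2]; [:: 2; -3; 0; -1; -1]; [:: 2; 4; -3; -1; -1]; [:: -2;
  1; 3; -2; -1]; [:: 1; 1; -1; 5; -1]; [:: -1; -1; 0; -1; 5]];
[:: [:: 1; 1; 1; 0; 0]; [:: -1; 1; 0; 1; 0]; [:: 0; -1; 0; 1; 1]; [:: -1; 0; -1; 0; 0]; [:: 0; 0;
  0; -1; 0]; [::]; [:: -2; -1; 0; -1; 0]; [:: 2; -1; 0; -1; 0]; [:: 0; 2; -1; -1; -1]; [:: -1; 0;
  2; 0; -1]; [:: 0; 0; -1; 2; -1]; [:: -1; 1; 0; 0; 2]];
[:: [:: 1; 0; 0; 0; 0]; [:: -2; 0; 0; 0; 1]; [:: -1; -1; 0; 1; 1]; [:: -1; 0; -1; 1; 1]; [:: 1; 0;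
  0; -1; 0]; [::]; [:: -3; -2; -1; -1; -1]; [:: 3; -2; -2; 0; -1]; [:: 0; 3; -1; -1; -1]; [:: 0;
  -1; 2; -1; -1]; [:: 0; 1; 0; 3; 0]; [:: 1; 0; 0; -1; 4]];
[:: [:: 1; 1; 1; 0; 0]; [:: -1; 1; 1; 1; 0]; [:: 0; -1; 0; 1; 0]; [:: 0; 0; -1; 1; 0]; [:: 0; -1;
  0; -1; 1]; [::]; [:: -2; -1; -1; -1; -1]; [:: 2; -2; -1; -1; 0]; [:: 0; 2; 0; -1; -1]; [:: 0;
  -2; 2; 0; 0]; [:: 2; 0; 0; 2; -1]; [:: 0; 0; 0; 0; 3]];
[:: [:: 2; 1; 0; 0; 1]; [:: -2; 1; 1; 1; 0]; [:: 0; -2; 0; 1; 0]; [:: -1; -1; -1; 1; 0]; [:: 1; 0;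
  0; -2; 0]; [::]; [:: -2; -3; 0; -3; -1]; [:: 4; -1; -2; -1; 0]; [:: -1; 4; -1; -2; 0]; [:: 1; 0;
  2; -1; -1]; [:: 0; 1; -1; 4; -1]; [:: 0; 0; 0; 0; 3]];
[:: [:: 2; 0; 2; 0; 1]; [:: -2; 0; 1; 1; 1]; [:: 0; -2; 1; 1; 1]; [:: -1; -1; -1; 1; 1]; [:: 1; 0;
  0; -2; 0]; [::]; [:: -3; -1; -1; -1; -1]; [:: 3; -2; -2; -1; -1]; [:: 0; 3; -1; -1; -1]; [:: 0;
  -1; 3; -2; -1]; [:: 1; 0; 0; 3; -1]; [:: 0; 0; 0; -1; 3]];
[:: [:: 2; 1; 1; 0; 1]; [:: -1; 0; 1; 1; 0]; [:: 0; -1; 0; 1; 0]; [:: 0; 0; -1; 1; 0]; [:: 0; 0;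
  0; -1; 1]; [::]; [:: -2; -1; -1; -2; 0]; [:: 2; -2; -2; -1; 0]; [:: -1; 3; -1; -2; -1]; [:: 0;
  -1; 2; -1; 0]; [:: 1; 0; 0; 2; -2]; [:: 0; 0; 0; 1; 3]];
[:: [:: 1; 1; 2; -1; -1]; [:: -2; 0; 1; 1; -1]; [:: 0; -2; 1; 1; 0]; [:: 0; 0; -2; 1; 2]; [:: 1;
  0; 0; -2; -1]; [::]; [:: -1; -3; -3; 0; -1]; [:: 3; -1; -2; -1; 0]; [:: -1; 2; -1; -1; -1]; [::
  0; -1; 1; -1; -3]; [:: 1; 1; 1; 3; -1]; [:: 0; -1; 1; -2; 2]];
[:: [:: 2; 1; 1; 1; 1]; [:: -2; 0; 1; 2; 1]; [:: -1; -2; 0; 1; 0]; [:: 0; 0; -2; 1; 1]; [:: 1; 0;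
  0; -1; 0]; [::]; [:: -2; -1; -1; -1; 0]; [:: 2; -1; -1; -1; -1]; [:: 0; 2; -1; -1; 0]; [:: 0; 0;
  4; -1; -1]; [:: 0; -1; -1; 2; 0]; [:: 0; 0; 0; 0; 3]];
[:: [:: 2; 1; 1; 0; 0]; [:: -1; 1; 1; 0; 0]; [:: 1; -2; 0; 0; 0]; [:: 1; -1; -2; 1; 0]; [:: 0; 1;
  0; -2; 0]; [::]; [:: -3; -3; -1; -1; 0]; [:: 3; -2; -1; -1; -1]; [:: -1; 2; -2; -1; -1]; [:: 0;
  0; 4; -1; -1]; [:: 0; -1; 0; 3; -1]; [:: 1; 1; 0; 0; 3]];
[:: [:: 2; 1; 0; 1; 0]; [:: -1; 0; 0; 0; 0]; [:: 1; -1; -1; 1; 0]; [:: 1; 0; -2; 1; 0]; [:: 0; 0;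
  0; -2; 0]; [::]; [:: -2; -2; -2; -1; 0]; [:: 2; -1; -2; -2; -1]; [:: 0; 2; -1; -1; -1]; [:: 0;
  -1; 2; -1; -1]; [:: 0; -1; -1; 3; -1]; [:: 0; 0; 0; 0; 2]];
[:: [:: 2; 2; 1; 1; 1]; [:: -1; 2; 0; -1; 1]; [:: 0; -1; 1; 1; 0]; [:: 0; -1; -1; 1; 0]; [:: 0; 0;
  0; -2; 1]; [::]; [:: -4; -1; -1; 0; 0]; [:: 1; -3; -1; -1; -1]; [:: 0; 2; -2; 0; 0]; [:: 0; 1;
  1; -2; -1]; [:: -1; 2; 1; 2; -1]; [:: -1; -1; 2; 0; 3]];
[:: [:: 1; 1; 0; 0; 0]; [:: -1; 0; 1; 0; 1]; [:: -1; -2; 0; 0; 0]; [:: 1; 0; -1; 0; 0]; [:: 0; 1;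
  1; -1; 1]; [::]; [:: -2; -1; -1; -1; 0]; [:: 3; -2; 0; -2; -1]; [:: 0; 2; -1; 0; 0]; [:: 0; 0;
  4; 0; 0]; [:: -1; 0; 0; 3; -1]; [:: 1; 0; 0; 0; 2]];
[:: [:: 1; 1; 0; 0; 0]; [:: -1; 0; 1; 0; 1]; [:: -1; -1; 0; 0; 0]; [:: 1; -1; -1; 1; 0]; [:: 0; 0;
  0; -2; 0]; [::]; [:: -2; -1; -1; -1; 0]; [:: 2; -2; -1; -1; -1]; [:: 0; 2; -1; 0; 0]; [:: 0; 0;
  2; -1; -1]; [:: 0; 0; 0; 3; 0]; [:: 1; -1; 0; -1; 3]];
[:: [:: 2; 0; 1; 0; 1]; [:: -2; 0; 0; 0; 0]; [:: 0; -1; 1; 1; 0]; [:: 0; -1; -1; 1; 0]; [:: 0; 0;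
  1; -1; 1]; [::]; [:: -3; -1; -1; -1; -1]; [:: 2; -1; -1; -2; -1]; [:: 0; 2; -1; 0; 0]; [:: 0; 0;
  3; -1; 0]; [:: 0; 0; 0; 3; 0]; [:: 0; -1; 1; 0; 3]];
[:: [:: 2; 2; 0; 1; 1]; [:: -2; 0; 2; 0; 0]; [:: 0; -2; 0; 1; 0]; [:: 1; 0; -2; 1; 0]; [:: 0; 1;
  0; -2; 0]; [::]; [:: -2; -2; -2; -2; -1]; [:: 3; -1; -1; -1; 0]; [:: -1; 4; -1; 0; -1]; [:: 0;
  0; 4; -1; -1]; [:: 0; 0; 0; 3; -1]; [:: 0; 0; -1; 1; 4]];
[:: [:: 2; 0; 1; 1; 0]; [:: -1; 0; 1; 0; 1]; [:: -1; -1; 1; 0; 0]; [:: 0; 0; -1; 1; -1]; [:: 0; 1;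
  0; -1; 0]; [::]; [:: -2; 0; -2; -1; -1]; [:: 2; 0; -1; 0; -2]; [:: 0; 3; 0; 0; 1]; [:: 0; 0; 2;
  -1; 0]; [:: -1; 0; 0; 2; -1]; [:: 1; -1; -1; 0; 2]];
[:: [:: 2; 2; 0; 1; 0]; [:: -1; 1; 1; 0; 0]; [:: 0; -1; 0; 1; 1]; [:: 0; 0; -1; 1; 0]; [:: 0; 0;
  0; -1; 0]; [::]; [:: -2; -1; -1; 0; 0]; [:: 1; -1; -1; 0; 0]; [:: 0; 3; -1; 0; -1]; [:: 0; -1;
  3; -1; 0]; [:: 0; 1; 1; 2; -1]; [:: 0; 0; -1; 0; 2]];
[:: [:: 1; 0; -1; 1; 1]; [:: 0; 1; 0; 1; -1]; [:: -1; -1; 1; 2; 1]; [:: -1; 0; -1; 0; 1]; [:: 0;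
  0; 0; -2; 0]; [::]; [:: -4; 1; 0; -1; 0]; [:: -2; -1; -1; -2; 1]; [:: 1; 1; -2; 0; -1]; [:: 1;
  -2; 1; 0; 0]; [:: -1; 1; -1; 2; -1]; [:: 1; 1; 1; 0; 2]];
[:: [:: 2; 1; 1; 1; 0]; [:: -1; 1; 0; 0; 1]; [:: 0; -2; 0; 1; 1]; [:: 1; -1; -1; 1; 0]; [:: 0; 1;
  0; -1; 0]; [::]; [:: -2; -2; -1; -1; -1]; [:: 2; -1; -1; -1; -1]; [:: -1; 2; -1; 0; -1]; [:: 0;
  -1; 2; 0; -1]; [:: 0; 0; 0; 4; 0]; [:: 0; 0; 0; -1; 3]];
[:: [:: 3; 1; 0; 0; 1]; [:: -2; 1; -1; 0; 0]; [:: 0; -1; 1; 1; 0]; [:: 1; -1; -2; 1; 0]; [:: 0; 1;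
  1; -2; 0]; [::]; [:: -3; -3; -1; -1; -1]; [:: 3; -1; 0; -1; -1]; [:: 0; 4; -2; -1; 0]; [:: 0; 0;
  3; -1; -1]; [:: 1; 0; -1; 2; -1]; [:: -1; -1; 0; 1; 4]];
[:: [:: 1; 1; 1; 0; 0]; [:: -1; 1; 1; 0; 0]; [:: 0; -1; 0; 1; 0]; [:: 0; 0; -1; 1; 0]; [:: 0; 1;
  0; -1; 0]; [::]; [:: -1; -1; -1; -1; 0]; [:: 2; -1; -1; 0; 0]; [:: 0; 2; -1; 0; -1]; [:: 0; -1;
  2; -1; 0]; [:: 0; 0; 0; 2; -1]; [:: 0; 0; 0; 0; 2]];
[:: [:: 3; 0; 1; 0; 1]; [:: -2; 2; 1; 0; 1]; [:: -1; -2; 1; 1; 1]; [:: 0; 0; -2; 1; 0]; [:: 1; 1;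
  0; -2; 1]; [::]; [:: -3; 0; -1; -1; -1]; [:: 2; -3; -1; -2; 0]; [:: 1; 2; -1; 0; -1]; [:: 0; -1;
  2; -2; -1]; [:: 0; 0; 0; 4; -1]; [:: 0; -1; -1; -1; 4]];
[:: [:: 1; 1; 0; 0; 0]; [:: -1; 0; 1; 0; 0]; [:: 0; -1; 1; 1; 1]; [:: 0; 1; -1; 1; 0]; [:: 0; 1;
  1; -2; 0]; [::]; [:: -1; -1; -1; -1; 0]; [:: 1; -1; -1; -2; 0]; [:: 0; 2; 0; -1; -1]; [:: 0; 0;
  2; -1; 0]; [:: 0; 0; 0; 2; -1]; [:: -1; 1; 1; 0; 3]];
[:: [:: 2; 1; 1; 0; 1]; [:: -2; 2; 1; 0; 0]; [:: 0; -2; 0; 1; 0]; [:: 1; 0; -2; 1; 1]; [:: 0; 0;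
  0; -2; 0]; [::]; [:: -2; -2; -1; -1; -1]; [:: 2; -1; -2; -2; 0]; [:: 0; 3; 0; -1; 0]; [:: 0; -1;
  3; -1; -1]; [:: 0; 1; 0; 3; -1]; [:: 0; 0; 0; 0; 2]];
[:: [:: 3; 1; 1; 0; 1]; [:: -2; 1; 1; 1; 1]; [:: 1; -1; 1; 1; 0]; [:: 0; -1; -2; 1; 1]; [:: 0; 0;
  0; -2; 0]; [::]; [:: -2; -2; -1; 0; -1]; [:: 1; -2; -2; -2; -1]; [:: 0; 3; -1; -1; 0]; [:: 1; 0;
  3; -2; -1]; [:: 0; 0; 0; 3; -1]; [:: -1; -1; 0; 0; 4]];
[:: [:: 2; 0; 2; 1; 0]; [:: -3; 2; 0; -1; -1]; [:: -1; -1; 0; 1; -1]; [:: 0; -1; -3; 1; 1]; [::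
  -1; 1; 1; -2; 1]; [::]; [:: -3; -1; -3; -3; 1]; [:: 2; -1; 0; -1; 0]; [:: 2; 2; -2; 0; 0]; [::
  -1; 0; 3; -2; -2]; [:: -1; 1; -1; 3; -3]; [:: -3; 0; 1; 0; 4]];
[:: [:: 1; 0; 0; 0; 0]; [:: -1; 1; 0; 0; 1]; [:: 0; -1; 0; 1; 0]; [:: 0; 0; -1; 1; 0]; [:: 0; 1;
  0; -2; 0]; [::]; [:: -1; -1; 0; -1; 0]; [:: 1; -1; 0; 0; -1]; [:: 0; 2; -1; -1; 0]; [:: 0; 0; 2;
  -1; 0]; [:: 0; 1; 0; 2; 0]; [:: 0; 0; -1; -1; 2]];
[:: [:: 2; 1; 1; 1; 0]; [:: -2; 1; 0; 1; 1]; [:: 0; -1; 0; 1; 0]; [:: 0; 0; -1; 1; 0]; [:: 0; 0;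
  0; -1; 0]; [::]; [:: -1; -1; -1; -1; -1]; [:: 1; -2; -1; -1; -1]; [:: 0; 2; 0; 0; -1]; [:: 0;
  -1; 2; 0; 0]; [:: 0; 1; 0; 2; 0]; [:: 0; 0; 0; -1; 3]];
[:: [:: 1; 1; 1; 1; 1]; [:: -2; 1; 1; 0; 0]; [:: 0; -3; 1; 1; 1]; [:: 0; 0; -2; 1; 0]; [:: 0; 0;
  0; -2; 0]; [::]; [:: -3; -2; -2; -2; -1]; [:: 2; -1; -2; 0; 0]; [:: 1; 2; -2; 0; -1]; [:: 0; -1;
  6; 0; -1]; [:: -1; -1; 2; 4; 0]; [:: -1; 1; 0; -1; 3]];
[:: [:: 2; 1; 0; 1; 1]; [:: -2; 2; 0; 1; 0]; [:: 0; -2; 0; 0; 0]; [:: -1; 0; -1; 1; 0]; [:: 0; 0;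
  1; -2; 0]; [::]; [:: -2; -1; -1; -1; -1]; [:: 2; -1; -1; 0; 0]; [:: 0; 3; -1; -1; -1]; [:: 0; 0;
  2; -1; -1]; [:: -1; 0; 1; 3; -1]; [:: -1; 0; 0; -1; 3]];
[:: [:: 2; 1; 1; 1; 1]; [:: -2; 1; 0; 0; 0]; [:: 0; -2; 1; 0; 1]; [:: 0; -1; -1; 1; 1]; [:: -1; 1;
  0; -2; 0]; [::]; [:: -3; -2; 0; 0; -1]; [:: 1; -1; -1; -1; -1]; [:: 0; 2; -2; -1; -1]; [:: 0; 0;
  3; 0; -1]; [:: -1; 0; 1; 3; 0]; [:: 0; 0; 0; -1; 3]];
[:: [:: 2; 1; 0; 1; 0]; [:: -1; 1; 0; 1; 1]; [:: 0; -2; 1; 1; 0]; [:: 0; 0; -1; 1; 0]; [:: 0; 0;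
  0; -2; 0]; [::]; [:: -3; -1; -1; -1; -1]; [:: 2; -1; -1; -1; -1]; [:: 0; 2; -1; -1; 0]; [:: 1;
  0; 3; -1; -1]; [:: 0; -1; 0; 3; -1]; [:: 0; 0; 0; 0; 2]];
[:: [:: 2; 2; 1; 1; 0]; [:: -3; 0; 0; 1; 0]; [:: -1; -3; 0; 2; -1]; [:: 1; 1; -1; 1; 2]; [:: 0; 0;
  1; -2; 1]; [::]; [:: -1; -1; -3; 0; -1]; [:: 2; -2; -1; -1; 0]; [:: -1; 3; -1; -1; 0]; [:: 0; 0;
  2; 0; -2]; [:: 1; 1; -1; 2; -2]; [:: -1; -1; 1; 0; 2]];
[:: [:: 2; 2; 2; 0; 1]; [:: -1; 1; 1; 1; 1]; [:: -1; -2; 2; 1; 1]; [:: 0; 0; -2; 1; 0]; [:: 0; 0;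
  -1; -3; 1]; [::]; [:: -2; -1; -3; 0; 0]; [:: 1; -3; -1; -2; -1]; [:: -1; 1; -2; 0; -1]; [:: -1;
  -1; 2; -1; -1]; [:: 0; 0; 1; 1; -1]; [:: 1; 1; 1; -1; 2]];
[:: [:: 2; 0; 1; 1; 1]; [:: -2; 1; 0; 0; 1]; [:: 0; -1; 2; 1; 1]; [:: 0; 0; -3; 1; 1]; [:: 0; 0;
  0; -3; 0]; [::]; [:: -1; -1; -1; -1; 0]; [:: 1; -2; -1; -1; 0]; [:: 0; 2; -1; -1; -1]; [:: 0; 0;
  2; 0; -1]; [:: 0; 0; 0; 1; -1]; [:: 0; 0; 0; -1; 2]];
[:: [:: 3; 1; 0; 1; 1]; [:: -2; 1; 1; 1; 1]; [:: 1; -1; 0; 1; 0]; [:: 1; 0; -1; 0; 0]; [:: 0; 0;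
  0; -1; 1]; [::]; [:: -2; -1; 0; -1; -1]; [:: 3; -1; -1; -2; -1]; [:: 0; 2; -1; 0; 0]; [:: 0; 1;
  2; 0; 0]; [:: 0; 1; -1; 2; -1]; [:: -1; -1; 0; 0; 2]];
[:: [:: 2; 0; 1; 0; 1]; [:: -1; 0; 1; 0; 0]; [:: 0; -1; 0; 1; 0]; [:: 0; 0; -2; 0; 0]; [:: 0; 0;
  0; -1; 0]; [::]; [:: -1; -1; -1; -1; -1]; [:: 1; -1; -2; -2; -1]; [:: 0; 2; -1; -1; 0]; [:: 0;
  -1; 1; -1; -1]; [:: 0; 0; 0; 1; -1]; [:: -1; -1; 0; 0; 2]];
[:: [:: 3; 1; -1; 1; 1]; [:: -2; 1; 1; 1; 1]; [:: 0; -1; 0; 2; 0]; [:: -1; 0; -2; 1; -1]; [:: 0;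
  0; 0; -2; 1]; [::]; [:: -2; -2; 0; -2; -1]; [:: 2; -2; -1; -2; -1]; [:: -1; 3; -1; -1; -1]; [::
  2; 0; 3; -1; 0]; [:: 0; 1; 0; 2; -2]; [:: -1; 0; -2; 0; 3]];
[:: [:: 2; 2; 0; 1; -1]; [:: -2; 1; -1; -1; 2]; [:: 0; -2; 1; 1; 1]; [:: 1; -2; -2; 2; 1]; [:: 0;
  1; 0; -2; 0]; [::]; [:: -2; -3; -1; -2; 0]; [:: 2; -2; -1; -1; -2]; [:: -1; 1; -4; -1; -1]; [::
  -1; 1; 3; -1; -1]; [:: 0; 1; -1; 3; -1]; [:: 2; 0; -1; -1; 3]];
[:: [:: 2; 1; 1; 0; 1]; [:: -2; 1; 1; 0; 0]; [:: 0; -2; 0; 1; 0]; [:: 0; -1; -1; 1; 1]; [:: 0; 1;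
  0; -1; 0]; [::]; [:: -1; -1; -1; -1; -1]; [:: 2; -1; -2; -1; 0]; [:: 0; 1; -1; 0; -1]; [:: 1; 0;
  2; -1; -1]; [:: 0; 0; 0; 2; -1]; [:: 0; 0; 0; 0; 3]];
[:: [:: 1; 1; 0; 1; 0]; [:: -1; 1; 0; 0; 0]; [:: 0; -1; 0; 0; 0]; [:: 0; 0; -1; 1; 0]; [:: 0; 0;
  1; -1; 0]; [::]; [:: -1; -1; 0; 0; 0]; [:: 1; -1; -1; -1; -1]; [:: 0; 2; -1; -1; -1]; [:: 0; 0;
  2; 0; 0]; [:: 0; 0; 0; 1; 0]; [:: 0; 0; 0; 0; 2]];
[:: [:: 2; 1; 0; 0; 1]; [:: -1; 2; -1; 0; 0]; [:: 1; -2; 0; 0; 1]; [:: 0; 0; -2; 1; 0]; [:: -1; 0;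
  0; -1; 0]; [::]; [:: -2; -1; -1; -1; -1]; [:: 2; -1; 0; -1; 0]; [:: 0; 1; -1; -1; -1]; [:: 0; 0;
  3; 0; 0]; [:: 0; 0; 0; 2; -1]; [:: 0; 0; 0; 0; 2]];
[:: [:: 1; 2; 0; 1; 1]; [:: -1; 1; 0; 0; 1]; [:: 1; -2; 1; 0; 0]; [:: 0; 0; -3; 1; 0]; [:: 0; 0;
  2; -1; 1]; [::]; [:: -2; -2; -1; -1; -1]; [:: 2; 0; 0; -1; -1]; [:: 1; 2; 0; -1; 0]; [:: -1; 0;
  3; 0; 0]; [:: 0; 0; 1; 2; -1]; [:: 0; -1; -1; 0; 1]];
[:: [:: 1; 2; 2; 0; 0]; [:: -3; 1; 2; 0; 1]; [:: 1; -2; 0; 1; -1]; [:: 0; 1; -1; 1; 1]; [:: 0; 0;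
  1; -2; 0]; [::]; [:: -2; -1; -1; -1; 0]; [:: 2; 0; -2; 0; -1]; [:: -1; 3; -1; -3; 0]; [:: 0; -1;
  3; -1; -2]; [:: -1; 2; 0; 4; -1]; [:: 1; -1; 1; 0; 2]];
[:: [:: 2; 1; 0; 1; 1]; [:: -1; 1; 1; 1; 0]; [:: 0; -2; 1; 1; 1]; [:: 0; 0; -1; 1; 1]; [:: 0; 0;
  0; -2; 0]; [::]; [:: -2; -1; -1; 0; 0]; [:: 2; -1; -1; -1; 0]; [:: 0; 2; -2; -1; -1]; [:: 1; 0;
  2; -1; -1]; [:: 0; 0; 0; 3; -1]; [:: 0; 0; 1; 0; 3]];
[:: [:: 1; 1; 1; 0; 0]; [:: -1; 1; 1; 0; 0]; [:: 0; -2; 0; 1; 0]; [:: 0; 0; -1; 1; 1]; [:: 0; 0;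
  0; -2; 0]; [::]; [:: -2; -2; -2; 0; 0]; [:: 1; -1; -1; -1; -1]; [:: 0; 2; -1; -1; 0]; [:: 0; 0;
  2; 0; -1]; [:: 0; 1; 0; 2; -1]; [:: 0; 0; 0; 0; 3]];
[:: [:: 2; 1; 2; 0; 0]; [:: -2; 2; 1; 1; 0]; [:: 0; -3; 2; 0; 0]; [:: 1; 0; -2; 2; 0]; [:: 0; 0;
  0; -2; 1]; [::]; [:: -3; -1; -1; 0; 0]; [:: 3; -2; -3; -3; -1]; [:: 0; 2; -3; -1; -1]; [:: 0;
  -1; 2; -3; -2]; [:: 1; 1; 0; 3; -2]; [:: 0; 0; 1; 1; 4]];
[:: [:: 1; 1; 1; 1; 1]; [:: -1; 1; 0; 0; 1]; [:: 0; -2; 0; 0; 1]; [:: 1; 1; -2; 1; 0]; [:: 0; 0;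
  1; -2; 0]; [::]; [:: -1; -1; -2; -1; -1]; [:: 3; 0; -1; -1; -2]; [:: 1; 2; -1; 0; -1]; [:: 0;
  -1; 2; -1; 0]; [:: 0; -1; 0; 1; 0]; [:: 0; 0; 0; -1; 4]];
[:: [:: 1; 1; 1; 0; 0]; [:: -2; 1; 1; 1; 0]; [:: 1; -2; 0; 0; 1]; [:: 0; 0; -1; 1; 0]; [:: 0; 0;
  0; -1; 0]; [::]; [:: -2; -1; 0; 0; -1]; [:: 1; 0; -1; -1; -1]; [:: -1; 2; -1; 0; -1]; [:: 0; -1;
  2; 0; 0]; [:: 0; -1; 0; 2; -1]; [:: 0; 0; -1; 0; 2]];
[:: [:: 1; 0; 0; 1; 0]; [:: 1; 0; 1; -1; 1]; [:: -1; -2; 0; 0; 1]; [:: 0; -1; 0; 2; 1]; [:: 0; 0;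
  0; -1; 0]; [::]; [:: -1; 0; 0; -1; 1]; [:: 0; 0; -1; 1; 0]; [:: 1; 2; 0; 0; 0]; [:: -1; 0; 1;
  -1; -1]; [:: -1; -1; 1; 2; 0]; [:: 1; -1; 0; -1; 1]];
[:: [:: 3; 1; 0; 0; 0]; [:: -2; 1; 1; -1; 1]; [:: 0; -2; 1; 1; 0]; [:: 0; -1; -1; 2; 1]; [:: 1; 0;
  0; -2; 1]; [::]; [:: -1; -2; -2; 0; 0]; [:: 3; -1; -1; 0; -1]; [:: 0; 2; -3; -1; 0]; [:: 0; -1;
  3; -1; -1]; [:: -1; 1; 0; 2; -1]; [:: 1; -1; 1; 1; 3]];
[:: [:: 2; 1; 1; 1; 1]; [:: -2; 1; 1; 1; 1]; [:: 0; -3; 0; 1; 0]; [:: 0; -1; -2; 1; 0]; [:: 0; 1;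
  0; -2; 0]; [::]; [:: -2; -1; -2; -1; -1]; [:: 2; -1; 0; -1; -1]; [:: 1; 3; -2; 0; -1]; [:: -1;
  0; 2; -1; -1]; [:: 0; 1; 0; 2; -1]; [:: 0; 0; 0; 0; 3]];
[:: [:: 2; 2; 0; 0; 1]; [:: -1; 2; 0; 0; 1]; [:: 0; -3; 0; 1; 0]; [:: 0; 0; -1; 1; 0]; [:: 0; 1;
  0; -2; 0]; [::]; [:: -2; -1; -1; -1; -1]; [:: 2; -1; -1; -1; -1]; [:: 1; 2; -1; -1; 0]; [:: 0;
  0; 3; 0; -1]; [:: 0; 0; 1; 1; -1]; [:: 0; -1; 0; 0; 3]];
[:: [:: 2; 1; 1; 0; 1]; [:: -2; 2; 0; 2; 0]; [:: 0; -3; 0; 0; 1]; [:: 1; 0; -1; 2; 0]; [:: 0; 0;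
  1; -3; 1]; [::]; [:: -2; -1; -2; -2; 0]; [:: 2; -2; -1; -1; 0]; [:: 0; 2; -1; -2; -1]; [:: -2;
  -1; 2; -1; -1]; [:: 1; 0; 1; 4; -2]; [:: 0; 0; -1; 0; 4]];
[:: [:: 2; 1; 2; 0; 1]; [:: -2; 1; 2; 1; 1]; [:: -1; -2; 1; 0; 0]; [:: -1; 1; -2; 1; 1]; [:: 1; 0;
  1; -2; 0]; [::]; [:: -2; 0; -1; -2; -1]; [:: 2; -1; -2; 0; -1]; [:: 1; 2; -1; -1; -1]; [:: -1;
  0; 3; 0; -1]; [:: 0; 0; 0; 3; -1]; [:: 0; 0; -1; -1; 3]];
[:: [:: 2; 2; 1; 0; 1]; [:: -2; 1; 0; 0; 0]; [:: 0; -2; 0; 0; 0]; [:: 0; 0; -2; 1; 0]; [:: 0; 1;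
  1; -1; 1]; [::]; [:: -2; -1; -1; -1; -1]; [:: 1; -1; -2; -1; 0]; [:: 0; 1; -1; -1; 0]; [:: 0; 0;
  2; 0; 0]; [:: 0; 0; 1; 2; -1]; [:: 0; 0; 0; 0; 2]];
[:: [:: 2; 1; 1; 1; 1]; [:: -1; 1; 1; 0; 1]; [:: -1; -2; 1; -1; 1]; [:: 0; 0; -1; 1; 1]; [:: 0; 0;
  1; -2; 1]; [::]; [:: -1; -1; -1; -1; -1]; [:: 1; -1; -1; -1; -1]; [:: 0; 1; -1; 0; 0]; [:: 0; 0;
  2; 0; 0]; [:: 0; 0; 1; 2; 0]; [:: 0; 0; 0; 0; 3]];
[:: [:: 2; 3; 2; 1; 1]; [:: -2; 2; 0; 0; -1]; [:: -1; -2; 1; 1; 1]; [:: 0; 0; -2; 1; 1]; [:: 0; 0;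
  1; -2; 0]; [::]; [:: -2; -3; -2; -2; -1]; [:: 3; -1; 1; -1; 0]; [:: 1; 4; -1; 0; -1]; [:: 0; 0;
  3; 0; -2]; [:: -1; 0; -1; 3; -1]; [:: -2; 1; 1; 0; 3]];
[:: [:: 3; 1; 2; 2; 1]; [:: -2; 1; 2; 1; 1]; [:: 1; -3; 0; 1; 0]; [:: 0; 0; -2; 1; 0]; [:: 0; 1;
  0; -2; 1]; [::]; [:: -2; -1; -1; 0; -1]; [:: 3; 0; -1; -1; -1]; [:: 0; 3; 0; 1; 0]; [:: 0; 0; 2;
  -1; -1]; [:: 0; 0; 1; 3; -1]; [:: 0; -1; 0; 1; 4]];
[:: [:: 2; 2; 0; 1; 0]; [:: -1; 1; 1; 0; 1]; [:: 0; -3; 1; 0; 1]; [:: 0; 0; -2; 1; 1]; [:: 0; 0;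
  1; -3; 0]; [::]; [:: -2; -2; -1; 0; 0]; [:: 1; 0; -1; -1; -1]; [:: -1; 2; -1; -1; -1]; [:: -1;
  -1; 2; -1; -1]; [:: 0; -1; 1; 3; 0]; [:: 0; 0; 0; 0; 4]];
[:: [:: 1; 1; 1; 0; 0]; [:: -2; 1; 1; 0; -1]; [:: 0; -2; 0; 1; 0]; [:: 0; -1; -2; 1; 1]; [:: -1;
  0; 0; -2; 0]; [::]; [:: -2; -1; -1; -1; -1]; [:: 2; -1; -1; -1; 0]; [:: 0; 1; -1; 0; 0]; [:: 0;
  -1; 2; 0; -2]; [:: 0; 0; 0; 2; -1]; [:: -1; 0; 1; 0; 2]];
[:: [:: 2; 1; 2; 0; 1]; [:: -3; 1; 0; 0; 0]; [:: 0; -3; 0; 1; 1]; [:: 0; -1; -3; 0; 1]; [:: 1; 0;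
  0; -3; 0]; [::]; [:: -2; -1; -2; -2; -1]; [:: 3; -1; -1; -1; 0]; [:: 0; 4; -2; 0; -1]; [:: 1; 0;
  4; 0; -2]; [:: 0; 2; -1; 3; -1]; [:: 0; -1; -1; -2; 3]];
[:: [:: 3; 1; 1; 0; 0]; [:: -2; 2; 1; 1; 0]; [:: -1; -2; 0; 1; 0]; [:: -2; 1; -2; 1; 1]; [:: 1;
  -1; 0; -2; 0]; [::]; [:: -2; -1; -1; -1; -1]; [:: 1; -1; -2; 0; 0]; [:: 0; 2; -1; -1; -1]; [::
  0; -1; 1; 0; -1]; [:: 0; 1; 0; 3; 0]; [:: 0; 0; 0; 0; 2]];
[:: [:: 1; 1; 1; 0; 0]; [:: -1; 1; 2; 1; 0]; [:: 0; -2; 0; 1; 1]; [:: -1; 1; -2; 1; 1]; [:: 0; 0;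
  0; -3; 1]; [::]; [:: -3; -1; 0; -1; 0]; [:: 2; -1; -2; 0; 0]; [:: 0; 2; -1; -1; -1]; [:: -1; 0;
  2; -1; -1]; [:: 1; -1; 0; 2; -1]; [:: 0; 0; -1; -1; 4]];
[:: [:: 3; 2; 1; 0; 0]; [:: -3; 1; 1; 2; 1]; [:: 1; -2; 0; 0; 1]; [:: 0; 0; -2; 1; 1]; [:: -1; 1;
  1; -3; 1]; [::]; [:: -4; -1; -1; -1; 0]; [:: 1; -1; -1; -2; -1]; [:: 0; 3; -1; -1; -1]; [:: -1;
  -1; 4; 0; -1]; [:: 1; -1; 1; 3; -1]; [:: 0; 1; 0; 0; 3]];
[:: [:: 3; 1; 2; -1; 1]; [:: -2; 1; 0; 1; 1]; [:: -1; -2; 0; 1; 1]; [:: 0; 0; -2; 0; 0]; [:: 2; 0;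
  1; -3; 0]; [::]; [:: -5; -2; -1; -2; -1]; [:: 3; -3; -1; 0; -2]; [:: 0; 2; -1; -1; -1]; [:: -1;
  -1; 5; 0; -1]; [:: 0; 0; 1; 3; 0]; [:: 0; 0; -1; 0; 3]];
[:: [:: 1; 1; 1; 0; 0]; [:: -2; 0; 1; 0; 0]; [:: 0; -2; 1; 0; 1]; [:: 0; 0; -1; 1; 0]; [:: 1; 0;
  0; -2; 0]; [::]; [:: -2; -2; 0; -1; 0]; [:: 2; -2; 0; 0; -1]; [:: -1; 2; 0; 0; -1]; [:: -1; -1;
  1; -1; 0]; [:: 1; -1; 1; 2; -1]; [:: 0; 0; 0; 0; 2]];
[:: [:: 1; 3; 0; 0; 0]; [:: -2; 2; 1; 2; 1]; [:: 0; -1; 1; 1; 1]; [:: -1; 0; -2; 1; 2]; [:: 1; 0;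
  0; -3; 0]; [::]; [:: -2; -1; 0; 0; 0]; [:: 2; -1; 0; -2; -1]; [:: -2; 2; -1; -1; -2]; [:: -1; 0;
  2; 0; -1]; [:: 1; 0; -1; 2; -1]; [:: 0; 0; -1; 0; 4]];
[:: [:: 1; 1; 0; 0; 0]; [:: -1; 1; 1; 1; 0]; [:: 0; -2; 1; 0; 0]; [:: 0; 0; -2; 1; 0]; [:: 0; 0;
  0; -1; 0]; [::]; [:: -1; -2; 0; -1; -1]; [:: 1; 0; -1; -1; -1]; [:: -1; 1; -1; -1; -1]; [:: 0;
  0; 2; 1; -1]; [:: 0; 0; 1; 2; -1]; [:: 0; 0; 0; 0; 1]];
[:: [:: 2; 1; 0; 1; 0]; [:: -2; 0; 1; 1; 1]; [:: 0; -2; 1; 0; 0]; [:: 0; 0; -2; 1; 1]; [:: 0; 0;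
  0; -2; 0]; [::]; [:: -2; -1; -1; -1; 0]; [:: 1; -2; 0; -1; -1]; [:: 0; 2; 0; 0; -1]; [:: 0; 1;
  2; -1; -1]; [:: 0; 0; 0; 2; -1]; [:: 0; 0; 0; 0; 2]];
[:: [:: 2; 1; 0; 0; 0]; [:: -2; 0; 2; 0; 1]; [:: -1; -3; 2; 1; 0]; [:: 0; 0; -2; 2; 0]; [:: 0; 0;
  0; -3; 1]; [::]; [:: -3; -1; -1; -2; -1]; [:: 1; -2; -1; -2; -1]; [:: -1; 2; -1; 0; -1]; [:: 1;
  -1; 3; -1; -1]; [:: 0; 1; 1; 3; -2]; [:: 0; 0; 0; 0; 3]];
[:: [:: 2; 1; 0; 0; 1]; [:: -2; 1; 1; 1; 1]; [:: 0; -2; 1; 1; 0]; [:: 0; 0; -2; 0; 1]; [:: -1; 0;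
  0; -2; 0]; [::]; [:: -3; -1; -1; -1; -1]; [:: 1; -2; -1; -1; -1]; [:: -1; 2; -1; 0; -1]; [:: 1;
  0; 2; -1; -2]; [:: 0; 1; 0; 2; -1]; [:: 0; 0; 0; 0; 3]];
[:: [:: 2; 3; 1; 1; 0]; [:: -2; 0; 1; 1; 0]; [:: 0; -3; 1; 0; 0]; [:: 0; 0; -2; 1; 1]; [:: 0; 1;
  0; -3; 1]; [::]; [:: -2; -1; -2; -2; 0]; [:: 2; -2; -2; -1; -1]; [:: 0; 3; -1; 0; -1]; [:: 1;
  -1; 2; -2; -2]; [:: 0; 0; 0; 2; -2]; [:: 0; 0; 0; 0; 3]];
[:: [:: 2; 2; 0; 1; 2]; [:: -2; 1; 1; 0; -1]; [:: 0; -2; 1; 1; 0]; [:: -1; 1; -2; 1; 0]; [:: 0; 0;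
  1; -3; 1]; [::]; [:: -1; -1; -1; -1; -1]; [:: 1; -1; -1; -1; 0]; [:: -1; 2; 0; -1; -1]; [:: 1;
  0; 2; 0; 0]; [:: 1; 0; 1; 2; 0]; [:: -2; -1; -1; 0; 2]];
[:: [:: 2; 2; 0; 2; 2]; [:: -2; -1; 0; 1; 0]; [:: 1; -3; 2; 1; 1]; [:: 0; 1; -3; 0; 1]; [:: -1; 0;
  0; -4; 0]; [::]; [:: -1; -2; -1; -2; -2]; [:: 2; 0; 0; 0; 0]; [:: -2; 3; 0; 0; -1]; [:: -1; 1;
  3; 1; 0]; [:: 1; 0; 0; 4; 0]; [:: 0; -1; -1; -1; 2]]].

Definition points5 : seq (seq (seq Z)) := [::
[:: [:: 1; 1; 0; 1]; [:: -1; 0; 1; 0]; [:: -1; -1; 1; 0]; [:: 1; 0; -2; 1]; [:: 0; 0; 0; -1]; [::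
  -2; -3; -1; 0]; [:: 2; -1; -1; 0]; [:: -1; 2; -1; -1]; [:: 0; 1; 3; -1]; [:: 0; 1; 1; 2]];
[:: [:: 1; 1; 0; 1]; [:: -2; 1; 1; 1]; [:: -1; -1; 1; 0]; [:: 0; 0; -1; 1]; [:: 0; 0; 0; -2]; [::
  -2; -1; -1; -2]; [:: 3; -1; -1; -1]; [:: -1; 2; -2; -1]; [:: 1; 0; 3; -2]; [:: -1; 0; 0; 3]];
[:: [:: 1; 2; 0; 0]; [:: -2; 0; 1; -1]; [:: -1; -2; 1; 1]; [:: 0; 2; -3; 0]; [:: 1; 1; 0; -2]; [::
  -1; -3; 0; -2]; [:: 2; 0; -3; -1]; [:: -2; 4; -1; -3]; [:: 1; -1; 3; 0]; [:: -2; 0; -1; 3]];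
[:: [:: 0; 3; 1; 0]; [:: -2; 0; 1; 1]; [:: 0; -1; 0; 0]; [:: 1; 0; -2; 0]; [:: -1; 1; 1; -1]; [::
  -2; -2; -2; 0]; [:: 4; -3; -2; -3]; [:: -3; 1; -1; 0]; [:: -1; 1; 3; 0]; [:: 1; 0; 0; 2]];
[:: [:: 2; 0; 0; 0]; [:: -1; 0; 0; 0]; [:: 0; -1; 1; 1]; [:: 0; 0; -1; 1]; [:: 0; 0; 0; -1]; [::
  -1; -1; -1; 0]; [:: 2; -1; -1; -1]; [:: 0; 2; 0; -2]; [:: 0; 0; 2; -1]; [:: 0; 0; 0; 2]];
[:: [:: 2; 0; 1; 1]; [:: -1; 1; 0; 0]; [:: 0; -1; 2; 1]; [:: 0; 0; -2; 0]; [:: 1; 1; 1; -1]; [::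
  -2; -2; -1; -2]; [:: 2; -2; -1; -1]; [:: 0; 3; -1; -1]; [:: 0; 0; 4; -1]; [:: 1; 1; -1; 3]];
[:: [:: 1; 1; 2; -1]; [:: -2; 1; 0; 2]; [:: 0; -1; 1; 1]; [:: 0; 0; -3; 0]; [:: 1; 1; 1; -2]; [::
  -3; -2; -1; -2]; [:: 3; -2; -1; -1]; [:: 2; 2; -2; -2]; [:: -1; 1; 3; -1]; [:: 1; 0; 0; 3]];
[:: [:: 1; 0; 1; 0]; [:: -1; 0; 1; 2]; [:: 0; -1; 1; 1]; [:: 0; 0; -2; 0]; [:: 0; 0; 1; -3]; [::
  -2; -3; -1; -1]; [:: 3; -2; -1; -2]; [:: -1; 3; -1; -2]; [:: -1; 0; 3; -1]; [:: 1; 0; -1; 2]];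
[:: [:: 2; 0; 0; 0]; [:: -2; 0; 0; 1]; [:: 0; -2; 1; 1]; [:: -1; 1; -1; 1]; [:: 0; 1; 0; -2]; [::
  -3; -2; -1; -1]; [:: 1; -2; -2; -1]; [:: -1; 3; -1; -2]; [:: 0; 0; 2; -1]; [:: 0; 0; 0; 3]];
[:: [:: 1; 1; 0; -1]; [:: -2; 0; 0; 0]; [:: 0; -1; 0; 0]; [:: 0; 1; -1; 1]; [:: 0; 1; 0; -2]; [::
  -1; -1; -1; -1]; [:: 1; 0; -1; -1]; [:: 0; 2; -1; -1]; [:: 0; 0; 1; -1]; [:: 0; 0; 0; 2]];
[:: [:: 3; 1; 0; -1]; [:: -1; 1; 0; 1]; [:: -1; -1; 1; 1]; [:: 0; -1; -1; 1]; [:: 1; 0; 0; -2];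
  [:: -3; -1; -1; -1]; [:: 4; -2; -1; -1]; [:: 1; 3; -2; -1]; [:: 1; 0; 3; 0]; [:: 1; 0; 1; 3]];
[:: [:: 2; 3; 2; 0]; [:: -2; 2; 0; 2]; [:: -1; -2; 1; 0]; [:: 0; -1; -1; 1]; [:: 1; 1; 1; -2]; [::
  -4; -1; 0; -1]; [:: 2; -2; -1; -2]; [:: 1; 4; -1; -1]; [:: -1; 0; 3; -2]; [:: 3; 0; 1; 4]];
[:: [:: 2; 1; 2; 0]; [:: -2; 2; 0; 1]; [:: -1; -2; 1; 2]; [:: -1; -1; -2; 0]; [:: 1; 0; 0; -1];
  [:: -2; -1; -1; -1]; [:: 2; -1; -1; -1]; [:: 0; 3; 0; -1]; [:: 0; 0; 3; 0]; [:: -1; 0; 0; 3]];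
[:: [:: 1; 1; 3; 0]; [:: -2; 1; 0; 1]; [:: -1; -2; 1; 1]; [:: 0; 0; -2; 1]; [:: 2; 0; 0; -2]; [::
  -2; -1; -2; -1]; [:: 3; -2; -1; 0]; [:: 1; 3; -1; -1]; [:: -1; 0; 1; -3]; [:: 0; 0; 0; 3]];
[:: [:: 2; 1; 0; -1]; [:: -2; 1; 1; 2]; [:: 0; -2; 1; 0]; [:: -1; -1; -1; 1]; [:: 0; 0; 0; -2];
  [:: -2; -2; 0; -1]; [:: 2; -2; -1; -1]; [:: 0; 3; -1; -1]; [:: 0; 0; 3; -1]; [:: 1; 1; 0; 3]];
[:: [:: 0; 1; 1; 0]; [:: -2; 0; 0; 2]; [:: -1; -1; 0; 1]; [:: 0; -1; -1; 1]; [:: 0; 0; 0; -2]; [::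
  -2; -1; -1; -1]; [:: 1; -2; -1; -2]; [:: 0; 2; -1; -1]; [:: -1; -1; 2; -1]; [:: 1; 0; 0; 2]];
[:: [:: 1; 0; 1; 0]; [:: -2; 1; 0; 1]; [:: -1; -2; 0; 1]; [:: -1; 0; -1; 1]; [:: 1; 0; 0; -1]; [::
  -1; -1; -1; -1]; [:: 1; -1; -1; 0]; [:: 0; 2; -1; 0]; [:: 0; -1; 3; -2]; [:: 0; 0; 0; 2]];
[:: [:: 2; 0; 1; 1]; [:: -2; 1; 0; 1]; [:: 0; -2; 0; 1]; [:: 0; 0; -1; 1]; [:: 0; 0; 0; -2]; [::
  -2; -2; -1; -1]; [:: 2; -1; 0; -1]; [:: 0; 2; -1; -1]; [:: -1; 0; 1; -1]; [:: 2; 0; 0; 2]];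
[:: [:: 1; 1; 0; 0]; [:: -2; 0; 0; 1]; [:: 0; -1; 1; 0]; [:: 0; -1; -1; 1]; [:: 0; 0; 0; -2]; [::
  -2; -1; 0; -1]; [:: 2; -1; -1; -1]; [:: -1; 1; -1; -1]; [:: -1; 0; 2; -1]; [:: 0; 0; 0; 2]];
[:: [:: 2; 2; 1; 1]; [:: -1; 0; 2; 1]; [:: -1; -2; 1; 1]; [:: -1; 0; -3; 1]; [:: 0; 0; 0; -1]; [::
  -2; -2; 0; -2]; [:: 2; -2; -2; 0]; [:: -1; 2; -1; -1]; [:: 0; 0; 2; -1]; [:: 0; 0; -1; 2]];
[:: [:: 2; 3; 2; 1]; [:: -1; 0; 2; 1]; [:: -1; -3; 1; 1]; [:: 0; 0; -2; 2]; [:: 1; 1; 1; -1]; [::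
  -1; -1; -1; -1]; [:: 1; -2; -1; -1]; [:: 0; 1; -1; 0]; [:: -1; 0; 3; -1]; [:: 1; 0; 0; 2]];
[:: [:: 2; 1; 2; 1]; [:: -2; 1; 1; 0]; [:: 0; -2; 0; 1]; [:: 0; 0; -2; 1]; [:: 0; 1; 0; -2]; [::
  -3; -2; 0; 0]; [:: 2; -1; -1; -2]; [:: 0; 3; -2; 0]; [:: 0; 0; 3; -1]; [:: 0; 0; 1; 4]];
[:: [:: 2; 1; 0; 1]; [:: -1; 1; 0; -1]; [:: 0; -1; 1; 1]; [:: 0; -1; -2; 1]; [:: 0; 0; 0; -2]; [::
  -2; -2; -1; -1]; [:: 1; -1; -1; 0]; [:: 0; 2; -2; -1]; [:: 0; 0; 3; -1]; [:: -1; 0; 0; 1]];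
[:: [:: 1; 1; 0; 1]; [:: -1; 1; 1; 0]; [:: 0; -1; 0; 1]; [:: 0; 0; -1; 1]; [:: 0; 0; 0; -2]; [::
  -1; -1; -1; -1]; [:: 1; -1; -1; -1]; [:: -1; 1; -1; 0]; [:: 0; 0; 2; 0]; [:: -1; 0; 0; 1]];
[:: [:: 1; 1; -1; 0]; [:: -1; 0; 1; 0]; [:: 0; -2; 1; 0]; [:: 1; 0; -2; 2]; [:: 0; 0; 0; -2]; [::
  -1; -2; -1; -1]; [:: 2; -1; -1; -1]; [:: -1; 2; -1; 0]; [:: 0; 0; 3; -1]; [:: 1; 0; 0; 3]];
[:: [:: 2; 2; 0; 0]; [:: -1; 0; 1; 0]; [:: -1; -2; 0; 1]; [:: 0; 0; -2; 1]; [:: 0; 0; 1; -2]; [::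
  -2; -1; -1; -1]; [:: 2; -2; 0; -1]; [:: -1; 2; -2; -1]; [:: 1; 0; 3; -1]; [:: -1; 0; -1; 3]];
[:: [:: 2; 0; 0; 0]; [:: -1; 0; 1; 0]; [:: 0; -1; 1; 1]; [:: 1; 0; -1; 1]; [:: 0; 0; 0; -1]; [::
  -1; -1; -1; 0]; [:: 1; -1; -1; -1]; [:: 0; 1; -1; 0]; [:: 0; 0; 1; -1]; [:: 0; 1; 0; 1]];
[:: [:: 3; 2; 0; 1]; [:: -2; 1; 0; 1]; [:: -1; -1; 1; 2]; [:: 0; -1; -2; 1]; [:: 0; 0; 0; -2]; [::
  -2; -1; -1; 0]; [:: 2; -2; -1; -1]; [:: -1; 2; -2; 0]; [:: 0; 0; 3; -1]; [:: 0; 1; -1; 3]];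
[:: [:: 2; 1; 1; 0]; [:: -2; 0; 2; 0]; [:: -1; -2; 2; 1]; [:: 0; -1; -2; 1]; [:: 0; 0; 0; -2]; [::
  -3; -1; -2; 0]; [:: 2; -2; -1; -2]; [:: -1; 3; -1; 0]; [:: 0; -1; 2; -2]; [:: 0; 0; 0; 2]];
[:: [:: 2; 1; 0; 1]; [:: -1; 1; 1; 0]; [:: 0; -2; 0; 1]; [:: 0; 0; -1; 1]; [:: 0; 1; 0; -2]; [::
  -3; -1; -1; -1]; [:: 1; -1; -1; -1]; [:: 0; 2; -1; 0]; [:: 1; 0; 2; -1]; [:: 0; 0; 0; 2]];
[:: [:: 2; 1; 1; 1]; [:: -2; 0; 1; 0]; [:: 0; -2; 1; 0]; [:: 1; -1; -2; 1]; [:: 0; 0; 0; -1]; [::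
  -2; -2; -1; -1]; [:: 1; -1; -1; -1]; [:: -1; 2; -2; 1]; [:: 0; 0; 2; -1]; [:: -1; 0; -1; 1]];
[:: [:: 2; 1; 1; 1]; [:: -1; 1; 0; 0]; [:: 0; -1; 1; 1]; [:: 1; 0; -1; 2]; [:: 0; 0; 0; -2]; [::
  -1; 0; -1; 0]; [:: 1; -1; -2; 0]; [:: 0; 1; -1; 0]; [:: 0; -1; 2; -2]; [:: 0; 1; 0; 2]];
[:: [:: 2; 0; 1; 0]; [:: -2; 0; 0; 0]; [:: 0; -1; 1; 1]; [:: 0; 0; -2; 1]; [:: -1; 0; 1; -3]; [::
  -2; -2; -1; -1]; [:: 2; -1; 0; -1]; [:: 0; 2; -1; -1]; [:: 0; 0; 2; -1]; [:: 0; 0; 0; 2]];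
[:: [:: 2; 1; 1; 1]; [:: -2; 1; 1; 0]; [:: 0; -2; 1; 1]; [:: 0; 0; -2; 0]; [:: 0; 1; 1; -1]; [::
  -2; -1; 0; -1]; [:: 1; -2; 0; -1]; [:: 0; 1; -1; -1]; [:: 0; -1; 2; 0]; [:: 1; 0; 0; 2]];
[:: [:: 2; 1; 2; 1]; [:: -2; 1; 1; 0]; [:: 0; -1; 1; 1]; [:: 0; 0; -2; 1]; [:: 0; 1; 0; -1]; [::
  -2; -1; -1; -1]; [:: 2; -1; -1; -2]; [:: 0; 2; -1; 0]; [:: 0; -1; 1; -1]; [:: 0; 0; 0; 2]];
[:: [:: 2; 1; 0; 1]; [:: -6; 1; 0; 0]; [:: 1; -2; 0; 1]; [:: 0; 0; -2; 1]; [:: -2; 2; 0; -3]; [::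
  -3; -4; -1; -1]; [:: 1; -1; 0; -2]; [:: -1; 3; -2; -2]; [:: -2; 2; 2; 0]; [:: -1; 1; -1; 2]];
[:: [:: 2; 1; 1; 0]; [:: -2; 1; 1; 0]; [:: 0; -1; 0; 1]; [:: 0; 1; -1; 1]; [:: 1; 0; 0; -2]; [::
  -2; 0; -1; -1]; [:: 1; -1; -1; -2]; [:: 1; 2; -1; -1]; [:: 0; 0; 2; -1]; [:: 0; 1; 0; 2]];
[:: [:: 2; 0; 1; 1]; [:: -2; 2; 0; 1]; [:: 0; -1; 0; 1]; [:: 0; -1; -2; 1]; [:: 1; 1; 0; -2]; [::
  -2; -1; -1; -1]; [:: 1; -1; -1; -1]; [:: 1; 3; -1; -1]; [:: 0; 0; 2; -1]; [:: 0; 0; -1; 2]];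
[:: [:: 3; 1; 2; 0]; [:: -2; 1; 1; 0]; [:: -1; -2; 0; 1]; [:: 1; 0; -2; 1]; [:: 0; 1; 1; -3]; [::
  -2; -1; -1; -1]; [:: 1; 0; 0; -2]; [:: 1; 3; -1; -2]; [:: 0; -1; 2; -1]; [:: 0; 0; 0; 3]];
[:: [:: 1; 0; 1; 1]; [:: -2; 1; 0; 0]; [:: 0; -2; 0; 1]; [:: 0; 0; -1; 1]; [:: 0; 0; 1; -2]; [::
  -1; -1; 0; -1]; [:: 1; -1; 0; -2]; [:: 0; 2; -1; -1]; [:: -1; 0; 2; 0]; [:: 0; 1; 0; 2]];
[:: [:: 3; 2; 1; 1]; [:: -4; 1; -1; 0]; [:: 0; -2; 0; 1]; [:: 1; -2; -3; 2]; [:: 0; 1; 0; -2]; [::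
  -2; -1; -1; -1]; [:: 1; -1; -1; -1]; [:: 0; 3; -1; -1]; [:: 0; 1; 2; -1]; [:: 0; 0; -1; 3]];
[:: [:: 3; 2; 1; 0]; [:: -3; 5; 2; 1]; [:: 1; -3; 0; 0]; [:: -1; 0; -2; 2]; [:: 0; 0; 2; -3]; [::
  -3; -2; 0; -2]; [:: 2; -2; -2; -1]; [:: 0; 4; -2; -1]; [:: 0; 1; 5; -2]; [:: -1; 0; 1; 4]];
[:: [:: 2; 1; 1; 0]; [:: -1; 1; 0; 1]; [:: 0; -1; 0; 0]; [:: 0; 0; -2; 1]; [:: -1; 0; 1; -2]; [::
  -3; -1; -1; 0]; [:: 1; -1; -1; -2]; [:: 0; 1; 0; -1]; [:: 0; 0; 2; 0]; [:: 0; 0; 0; 2]];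
[:: [:: 2; 1; 1; 1]; [:: -2; 1; 1; 0]; [:: 0; -2; 0; 0]; [:: 1; 0; -3; 1]; [:: 0; 0; 1; -2]; [::
  -2; -1; 0; -1]; [:: 2; 0; 0; -2]; [:: 1; 2; -1; -1]; [:: 0; -1; 1; 0]; [:: -1; 0; 0; 2]];
[:: [:: 2; 1; 0; 1]; [:: -3; 2; 0; 1]; [:: 0; -2; 1; 1]; [:: 0; 0; -2; 1]; [:: 0; 0; 0; -2]; [::
  -2; -1; -1; -1]; [:: 2; -1; -2; -1]; [:: 0; 1; -1; -1]; [:: 0; 0; 2; 0]; [:: 0; 0; 0; 3]];
[:: [:: 2; 1; 0; 1]; [:: -2; 1; 1; 0]; [:: -1; -2; 2; 1]; [:: 1; 0; -2; 1]; [:: 0; 0; 0; -3]; [::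
  0; -1; -1; -1]; [:: 1; -2; 0; 0]; [:: 0; 2; 0; -2]; [:: 0; 0; 3; -1]; [::]];
[:: [:: 2; 1; 1; 0]; [:: -2; 2; 1; 1]; [:: -1; -2; 1; 1]; [:: 1; 0; -2; 1]; [:: 0; 0; 0; -3]; [::
  -1; -1; -1; 0]; [:: 1; -2; 0; -1]; [:: -1; 2; -1; 0]; [:: 0; -1; 1; 0]; [::]];
[:: [:: 1; 1; 0; 1]; [:: -2; 1; 0; 0]; [:: 0; -2; 1; 1]; [:: 0; 0; -1; 0]; [:: 0; 0; 0; -2]; [::
  -1; -1; 0; 0]; [:: 0; -1; 0; 0]; [:: 0; 1; 0; 0]; [:: 0; 1; 1; 0]; [::]]].

(* one realization for each of n = 4, 5, 6, 7 *)
Definition points4 : seq (seq (seq (seq Z))) := [::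
[:: [:: [:: 1; 1; 1]; [:: -1; 0; 0]; [:: 0; -2; 1]; [:: 1; 1; -1]; [:: -1; -1; -1]; [:: 2; -1; 0];
  [:: 0; 2; 0]; [:: 1; -1; 2]]; [:: [:: 1; 1; 0; 0]; [:: -1; 0; 1; 0]; [:: 0; -1; 0; 0]; [:: 1; 0;
  -2; 0]; [::]; [:: -1; -1; -1; -1]; [:: 2; -1; -1; -1]; [:: 0; 2; -1; 0]; [:: 0; 0; 2; 0]; [:: 0;
  -1; -1; 3]]; [:: [:: 1; 1; 0; 0; 0]; [:: -1; 0; 0; 0; 0]; [:: -1; -1; 0; 0; 0]; [:: 1; 1; -1; 0;
  0]; [::]; [::]; [:: -2; -1; -2; -1; -1]; [:: 2; -2; 0; 0; -1]; [:: 0; 2; 0; -1; -1]; [:: 0; 0;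
  2; 0; 0]; [:: 0; 0; 0; 3; 0]; [:: 0; 1; 0; -1; 2]]; [:: [:: 1; 1; 0; 0; 0; 0]; [:: -1; 0; 1; 0;
  0; 0]; [:: 0; -1; 0; -1; 0; -1]; [:: 0; 0; -1; 1; 0; 0]; [::]; [::]; [::]; [:: -2; -2; -2; 0;
  -2; 0]; [:: 2; 0; -2; -1; 0; 0]; [:: -1; 2; 0; 1; -1; 1]; [:: 0; 1; 2; -2; -1; 0]; [:: 1; 0; 1;
  1; -1; -2]; [:: -2; 1; -1; 0; 2; -2]; [:: 0; -2; 1; 0; 2; 2]]];
[:: [:: [:: 1; 1; 0]; [:: -1; 1; 1]; [:: 0; -3; 1]; [:: 0; 0; -2]; [:: -1; -1; -1]; [:: 2; -2;
  -2]; [:: -1; 1; -1]; [:: 0; 0; 2]]; [:: [:: 1; 2; 1; 0]; [:: -1; 0; 1; 0]; [:: -1; -2; 0; 0];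
  [:: 0; 1; -1; 1]; [::]; [:: -2; -2; -1; -1]; [:: 1; -1; 0; 0]; [:: 0; 2; -1; -1]; [:: 0; -1; 2;
  -1]; [:: -1; 0; 0; 3]]; [:: [:: 1; 1; 1; 0; 1]; [:: -1; 0; 1; 0; 0]; [:: 0; -1; 1; 0; 0]; [:: 1;
  1; -1; 0; 1]; [::]; [::]; [:: -3; -1; -1; -2; -1]; [:: 3; -2; 0; -1; 0]; [:: 1; 3; -1; -1; -1];
  [:: 1; 0; 2; -1; -1]; [:: 0; -1; -1; 3; 0]; [:: 0; 1; 2; 0; 4]]; [:: [:: 1; 1; 0; 0; 0; 0]; [::
  -1; 0; 0; 0; 0; 0]; [:: -1; -1; 0; 0; 0; 0]; [:: 1; 0; -1; 0; 0; 0]; [::]; [::]; [::]; [:: -2;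
  -1; -1; -1; 0; 0]; [:: 2; -1; 0; -1; -1; -1]; [:: 0; 2; -1; -1; 0; 0]; [:: 0; 0; 1; 0; -1; 0];
  [:: 0; -1; -1; 2; -1; -1]; [:: 0; 0; 0; 0; 3; -1]; [:: 0; -1; 0; 0; 0; 2]]];
[:: [:: [:: 3; 1; 1]; [:: -2; 1; 1]; [:: 0; -2; 1]; [:: 0; 0; -4]; [:: -2; -1; -1]; [:: 2; -2;
  -2]; [:: 1; 2; 0]; [:: 0; 1; 3]]; [:: [:: 1; 1; 0; 1]; [:: -1; 0; 0; 0]; [:: 0; -1; 1; 1]; [::
  0; 1; -1; 0]; [::]; [:: -1; -1; 0; 0]; [:: 1; -1; -1; 0]; [:: 0; 1; 0; -1]; [:: 0; 0; 1; 0]; [::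
  0; 1; 0; 2]]; [:: [:: 1; 1; 0; 0; 0]; [:: -2; 1; 1; 0; 1]; [:: 0; -2; 2; 0; 1]; [:: -1; 1; -2;
  0; 0]; [::]; [::]; [:: -1; -2; 0; 0; 0]; [:: 1; -1; -1; -1; -1]; [:: -1; 2; -1; 0; -1]; [:: 0;
  1; 4; -1; -1]; [:: 0; 0; -1; 4; 0]; [:: -1; 2; -1; -2; 3]]; [:: [:: 1; 0; 0; 1; 1; 0]; [:: -1;
  0; 0; 0; 0; 0]; [:: 0; -1; 1; 1; -1; 0]; [:: 0; 0; -1; 0; 1; 0]; [::]; [::]; [::]; [:: 0; -1;
  -1; -1; -1; 0]; [:: 2; -1; -1; 0; 0; 0]; [:: 1; 2; -1; -1; 1; -1]; [:: 0; 1; 2; 0; -1; 0]; [::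
  -1; 0; 0; 3; 0; -2]; [:: -1; -1; 1; -1; 1; 0]; [:: 0; 1; 0; 1; 0; 3]]]].

Local Close Scope Z_scope.
Definition nonthreshold m := nth [::] [:: [::]; [::]; [::]; [::]; nonthreshold4; nonthreshold5] m.

(** For [m = 5] this runs through the 7581 monotone families on five elements, a Dedekind number.
    For [m <= 3] the list is empty, so every complex has to pass the weight test. *)
Lemma nonthreshold_classification m : (m <= 5)%N -> classification m (nonthreshold m).
Proof.
have /allP H : all (fun m => classification m (nonthreshold m)) (iota 0 6).
  by vm_compute.
by move=> m5; apply: H; rewrite mem_iota.
Qed.

Definition proper_table m t :=
  [&& is_complex t, lookup t [::] & ~~ lookup t (nseq m true)].

Lemma nonthreshold_proper_table m fs : fs \in nonthreshold m ->
  proper_table m (facets_table m fs).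
Proof.
have /allP H : all (fun m => all (fun fs => proper_table m (facets_table m fs)) (nonthreshold m))
    (iota 0 6) by vm_compute.
have [m5|m5] := leqP m 5; last by rewrite /nonthreshold nth_default.
by move=> fs_in; apply: (allP (H m _)) fs_in; rewrite mem_iota.
Qed.

Lemma proper_model n m fs : (m <= n)%N -> fs \in nonthreshold m ->
  proper_complex (model n (facets_table m fs)).
Proof.
move=> mn /nonthreshold_proper_table/and3P[tc t0 tT].
rewrite /proper_complex simplicial_model //; apply: contra tT => /eqP KT.
have : setT \in model n (facets_table m fs) by rewrite KT powersetE.
rewrite in_model_tabulate // => /andP[+ _].
suff -> : take m (ord_word [set: 'I_n]) = nseq m true.
  by rewrite -[X in lookup _ X]cats0 lookup_tabulate ?size_nseq ?andbT.
apply: (@eq_from_nth _ false); rewrite size_takel ?size_word ?size_nseq // => k km.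
rewrite nth_take // nth_nseq km -[k]/(val (Ordinal (leq_trans km mn))) nth_ord_word.
by rewrite inE.
Qed.

(** * Bier spheres on words *)

Section SumWords.
Variable n : nat.

Definition sum_word : {set 'I_n + 'I_n} -> bitseq := word (@split n n).

Lemma sum_wordE X : sum_word X = ord_word (inl @^-1: X) ++ ord_word (inr @^-1: X).
Proof.
apply: (word_eqP (e := @unsplit n n)).
- exact: unsplitK.
- exact: splitK.
- by rewrite size_cat !size_word.
- case=> i /=; rewrite nth_cat size_word ?ltn_ord ?nth_ord_word ?inE //.
  by rewrite ltnNge leq_addr /= addKn nth_ord_word inE.
Qed.

(** Nested conditionals skip the disjointness test for the words already rejected by a lookup. *)
Definition bier_word t (a : bitseq) :=
  if lookup t (take n a) then
    if lookup t (map negb (drop n a)) then false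
    else all (fun b => ~~ (b.1 && b.2)) (zip (take n a) (drop n a))
  else false.

Lemma bier_wordP t (X : {set 'I_n + 'I_n}) :
  (X \in bier (model n t)) = bier_word t (sum_word X).
Proof.
rewrite in_bier !inE sum_wordE /bier_word take_size_cat ?size_word //.
rewrite drop_size_cat ?size_word //.
rewrite -[RHS]/(_ && _); congr (_ && _).
have -> : map negb (ord_word (inr @^-1: X)) = ord_word (~: (inr @^-1: X)).
  by rewrite /word -map_comp; apply: eq_map => i; rewrite /= in_setC.
rewrite -[RHS]/(if _ then false else _); case: (lookup _ _) => //=.
rewrite -setI_eq0 /word zip_map all_map; apply/eqP/allP => [H i _|H].
  by move/setP/(_ i): H; rewrite !inE /= => ->.
by apply/setP => i; have := H i; rewrite mem_enum !inE => /(_ isT)/negbTE.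
Qed.

End SumWords.

Lemma bier_permute n s t r : perm_eq s (iota 0 (n + n)) ->
  all (fun a => bier_word n t a == bier_word n r (permute s a)) (words (n + n)) ->
  complex_iso (bier (model n r)) (bier (model n t)).
Proof.
move=> sn /allP H.
have [f fI fE] := @permute_word _ (n + n) (@unsplit n n) (@split n n) s
  (@unsplitK n n) (@splitK n n) sn.
apply: (complex_iso_bij fI) => X; rewrite !bier_wordP /sum_word -(fE X).
by apply/eqP/H; rewrite mem_words size_word.
Qed.

Lemma bier_iso_nonthreshold5 fs : fs \in nonthreshold5 ->
  exists2 fs', fs' \in take 48 nonthreshold5 &
    complex_iso (bier (model 5 (facets_table 5 fs))) (bier (model 5 (facets_table 5 fs'))).
Proof.
have /allP H : all (fun x => perm_eq x.2.2 (iota 0 10) && (x.2.1 < 48)%N &&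
    let t := facets_table 5 x.1 in let r := facets_table 5 (nth [::] nonthreshold5 x.2.1) in
    all (fun a => bier_word 5 r a == bier_word 5 t (permute x.2.2 a)) (words 10))
  (zip (drop 48 nonthreshold5) bier_maps5) by vm_compute.
rewrite -{1}(cat_take_drop 48 nonthreshold5) mem_cat => /orP[fs_in|].
  by exists fs => //; exact: complex_iso_refl.
case/(nthP [::]) => k k_lt fsE.
have sz : size (drop 48 nonthreshold5) = size bier_maps5 by [].
have := H (fs, nth (0%N, [::]) bier_maps5 k).
rewrite -fsE -nth_zip // mem_nth ?size_zip -?sz ?minnn // nth_zip // fsE => /(_ isT).
set q := nth _ bier_maps5 k; move=> /andP[/andP[q_perm q_lt] q_iso].
exists (nth [::] nonthreshold5 q.1); last exact: bier_permute q_iso.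
by rewrite -(nth_take [::] q_lt) mem_nth // size_takel.
Qed.

(** The bounds leave [n] from 4 to 7 for [m = 4] and only 5 and 6 for [m = 5]; each case has its own
    list of points. *)
Lemma polytopal_nonthreshold (R : realType) n m fs : (m <= n)%N -> (n + m <= 11)%N ->
  fs \in nonthreshold m -> polytopal R (bier (model n (facets_table m fs))).
Proof.
move=> mn nm fs_in; have Kp := proper_model mn fs_in.
have realize ps : realizes n (facets_table m fs) ps ->
    polytopal R (bier (model n (facets_table m fs))) by exact: realizes_polytopal.
have zipP (fss : seq (seq (seq nat))) (X : Type) (pss : seq X) (P : seq (seq nat) -> X -> bool) :
    all (fun x => P x.1 x.2) (zip fss pss) -> (size fss <= size pss)%N ->
    forall fs, fs \in fss -> exists ps, P fs ps.
  elim: fss pss => // fs0 fss IH [|ps0 pss] //= /andP[P0 HP] sz fs1.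
  by rewrite inE => /orP[/eqP ->|/(IH _ HP sz)] //; exists ps0.
have m45 : (m == 4%N) || (m == 5%N).
  by case: m fs_in {mn nm Kp realize} => [|[|[|[|[|[|m]]]]]] //; rewrite /nonthreshold nth_default.
case/orP: m45 => /eqP mE; subst m.
- have [|//|pss /andP[/eqP pss4 /allP pssP]] := @zipP nonthreshold4 _ points4 (fun fs pss =>
    (size pss == 4) && all (fun k => realizes (k + 4) (facets_table 4 fs) (nth [::] pss k))
      (iota 0 4))%N _ _ _ fs_in; first by vm_compute.
  apply: (realize (nth [::] pss (n - 4))); rewrite -[X in realizes X](subnK mn).
  by apply: pssP; rewrite mem_iota ltn_subLR //= ; lia.
have [n5|n6] : n = 5%N \/ n = 6%N by lia.
- subst n; have [fs' fs'_in fs_iso] := bier_iso_nonthreshold5 fs_in.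
  have fs'_in5 := mem_take fs'_in.
  have K'p := proper_model (leqnn 5) fs'_in5.
  apply: polytopal_iso (complex_iso_sym (bier_simplicial Kp) fs_iso) _.
    exact: bier_simplicial.
  have [|//|ps] := @zipP (take 48 nonthreshold5) _ points5 (fun fs =>
    realizes 5 (facets_table 5 fs)) _ _ _ fs'_in; first by vm_compute.
  exact: realizes_polytopal.
(* With a ghost the copies are no longer interchangeable, so each of the 88 complexes has its own
   points. *)
- subst n; have [|//|ps] := @zipP nonthreshold5 _ points6 (fun fs =>
    realizes 6 (facets_table 5 fs)) _ _ _ fs_in; first by vm_compute.
  exact: realize.
Qed.

(** * Bier spheres with at most eleven vertices *)

(** List each set followed by its complement and match equal positions. *)
Lemma imset_inj_exists (T : finType) (A B : {set T}) : #|A| = #|B| ->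
  exists2 f : T -> T, injective f & f @: A = B.
Proof.
move=> AB; have nu (C : {set T}) : uniq (enum C ++ enum (~: C)).
  rewrite cat_uniq !enum_uniq andbT; apply/hasPn => x.
  by rewrite !mem_enum inE.
have nm (C : {set T}) x : x \in enum C ++ enum (~: C).
  by rewrite mem_cat !mem_enum inE orbN.
have ns (C : {set T}) : size (enum C ++ enum (~: C)) = #|T|.
  by rewrite size_cat -!cardE cardsC.
pose f x := nth x (enum B ++ enum (~: B)) (index x (enum A ++ enum (~: A))).
have fI : injective f.
  move=> x y; rewrite /f (set_nth_default y) ?ns -?(ns A) ?index_mem // => /eqP.
  rewrite nth_uniq ?ns -?(ns A) ?index_mem // => /eqP xy.
  by rewrite -(nth_index x (nm A x)) xy nth_index.
exists f => //; apply/eqP; rewrite eqEcard card_imset // AB leqnn andbT.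
apply/subsetP => _ /imsetP[x xA ->]; rewrite /f index_cat mem_enum xA nth_cat.
have xB : (index x (enum A) < size (enum B))%N.
  by rewrite -cardE -AB cardE index_mem mem_enum.
by rewrite xB -mem_enum mem_nth.
Qed.

Lemma proper_preimage n (f : 'I_n -> 'I_n) (K : {set {set 'I_n}}) : injective f ->
  proper_complex K -> proper_complex [set A : {set 'I_n} | f @: A \in K].
Proof.
move=> fI Kp; apply/andP; split.
  apply/simplicial_complexP; split; first by rewrite inE imset0 proper_set0.
  by move=> A B AB; rewrite !inE; apply: proper_down; rewrite ?imsetS.
apply: contra (proper_setT Kp) => /eqP KT.
have : setT \in [set A : {set 'I_n} | f @: A \in K] by rewrite KT powersetE.
rewrite inE; suff -> : f @: setT = setT by [].
by apply/eqP; rewrite eqEcard subsetT card_imset //=.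
Qed.

Section FewVertices.
Variables (R : realType) (n : nat).
Implicit Type K : {set {set 'I_n}}.

Lemma polytopal_few_vertices K : proper_complex K -> (n + #|vertices K| <= 11)%N ->
  polytopal R (bier K).
Proof.
move=> Kp nm; set m := #|vertices K| in nm.
have mn : (m <= n)%N by rewrite -[X in (_ <= X)%N]card_ord max_card.
have m_card : #|[set i : 'I_n | (i < m)%N]| = #|vertices K|.
  rewrite -sum1dep_card -(big_ord_widen _ (fun=> 1%N) mn) sum1_card card_ord //.
have [f fI fV] := imset_inj_exists m_card.
pose L := [set A : {set 'I_n} | f @: A \in K].
have Lp : proper_complex L by exact: proper_preimage.
have KL (A : {set 'I_n}) : (f @: A \in K) = (A \in L) by rewrite inE.
apply: polytopal_iso (bier_iso fI KL) _; first exact: bier_simplicial.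
have Ls : simplicial_complex L by case/andP: Lp.
have Lv : vertices L = [set i : 'I_n | (i < m)%N].
  apply/setP => i; rewrite inE -KL imset_set1 -[RHS](mem_imset _ _ fI) fV.
  by rewrite inE.
(* From [m <= n] and [n + m <= 11]. *)
have m5 : (m <= 5)%N by lia.
have [Lt|[fs fs_in [g gI gE]]] :=
  classification_sound R mn (nonthreshold_classification m5) Ls Lv.
  exact: threshold_polytopal.
have Mp := proper_model mn fs_in.
apply: polytopal_iso (bier_iso gI gE) _; first exact: bier_simplicial.
exact: polytopal_nonthreshold.
Qed.

Lemma proper_dual K : proper_complex K -> proper_complex (alexander_dual K).
Proof.
move=> Kp; apply/andP; split.
  apply/simplicial_complexP; split; first by rewrite inE setC0 proper_setT.
  by move=> A B AB; rewrite !inE; apply: contra; apply: proper_down; rewrite ?setCS.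
apply: contraL (proper_set0 Kp) => /eqP KT.
have : setT \in alexander_dual K by rewrite KT powersetE.
by rewrite inE setCT.
Qed.

Lemma vertices_bier K : proper_complex K ->
  vertices (bier K) = sumset (vertices K) (vertices (alexander_dual K)).
Proof.
move=> Kp; apply/setP => -[i|i]; rewrite in_sumset !inE in_bier.
- have -> : [set inl i] = sumset [set i] set0 :> {set 'I_n + 'I_n}.
    by apply/setP => -[j|j]; rewrite in_sumset !inE.
  rewrite preim_inl_sumset preim_inr_sumset setC0 (proper_setT Kp).
  by rewrite -setI_eq0 setI0 eqxx !andbT.
- have -> : [set inr i] = sumset set0 [set i] :> {set 'I_n + 'I_n}.
    by apply/setP => -[j|j]; rewrite in_sumset !inE.
  rewrite preim_inl_sumset preim_inr_sumset (proper_set0 Kp).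
  by rewrite -setI_eq0 set0I eqxx andbT.
Qed.

(* If both [K] and its dual have a ghost vertex then these coincide, and [K]
   consists of all sets that avoid it. *)
Lemma ghosts_threshold K : proper_complex K -> vertices K != setT ->
  vertices (alexander_dual K) != setT -> threshold R K.
Proof.
rewrite -!subTset => Kp /subsetPn[i _] + /subsetPn[j _]; rewrite !inE negbK => iK jK.
have ij : i = j.
  apply/eqP; apply: contraNT iK => ij; apply: proper_down jK => //.
  by rewrite sub1set !inE.
subst j; exists (fun k => if k == i then n%:R else 1), n%:R; split.
  by move=> k; case: ifP => // _; rewrite ltr0n (proper_ord_gt0 Kp).
move=> A; have [iA|iA] := boolP (i \in A).
  rewrite (bigD1 i) //= eqxx; apply/idP/idP => [AK|].
    by case/negP: iK; apply: proper_down AK; rewrite ?sub1set.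
  rewrite gtrDl ltNge sumr_ge0 // => k /andP[_ /negbTE ->]; exact: ler01.
have -> : A \in K.
  by apply: proper_down jK; rewrite // subsetC sub1set inE.
rewrite (eq_bigr (fun=> 1)) => [|k kA]; last by case: eqP => // ki; rewrite -ki kA in iA.
rewrite sumr_const ltr_nat -[X in (_ < X)%N]card_ord; apply/esym.
by rewrite -cardsT proper_card // properE subsetT; apply/subsetPn; exists i.
Qed.

(** The vertices of [bier K] are those of [K] and of its dual. Unless [K] is threshold one of these
    has all [n] vertices, so the bound becomes the one of [polytopal_few_vertices] for the other. *)
Lemma polytopal_le11 K : proper_complex K -> (#|vertices (bier K)| <= 11)%N ->
  polytopal R (bier K).
Proof.
move=> Kp; rewrite vertices_bier // card_sumset.
have [KT|KT] := eqVneq (vertices K) setT.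
  rewrite KT cardsT card_ord => nm.
  apply: polytopal_iso (bier_alexander_dual K) _.
    exact/bier_simplicial/proper_dual.
  exact/polytopal_few_vertices/nm/proper_dual.
have [DT|DT] := eqVneq (vertices (alexander_dual K)) setT.
  by rewrite DT cardsT card_ord addnC; apply: polytopal_few_vertices.
by move=> _; apply/threshold_polytopal/ghosts_threshold.
Qed.

Lemma dimension_bier K d : proper_complex K -> has_dimension (bier K) d -> n = d.+2.
Proof.
move=> Kp; rewrite /has_dimension => dE.
suff : (\max_(A in bier K) #|A|)%N = n.-1 by rewrite dE; have := proper_ord_gt0 Kp; lia.
apply/eqP; rewrite eqn_leq; apply/andP; split.
  apply/bigmax_leqP => A; rewrite bier_facets_cover // => /exists_inP[s sF As].
  have /bier_facetsP[B [j [BK jBK sE]]] := sF.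
  by rewrite -(bier_facet_card BK jBK) -sE subset_leq_card.
have /set0Pn[s sF] := bier_facets_neq0 Kp.
have /bier_facetsP[B [j [BK jBK sE]]] := sF.
rewrite -(bier_facet_card BK jBK) -sE; apply: leq_bigmax_cond.
by rewrite bier_facets_cover //; apply/exists_inP; exists s.
Qed.

End FewVertices.

(** * Counting isomorphism classes *)

Section IsoClasses.
Variables (T : finType).
Implicit Types (K L : {set {set T}}).

Definition degree K v := #|[set A in K | v \in A]|.

(* This invariant is fine enough to tell apart the 88 complexes and the 48 Bier
   spheres. *)
Definition degree_sum K := (\sum_(A in K) (\sum_(v in A) degree K v) ^ 3)%N.

Lemma degree_sum_iso K L : simplicial_complex K -> complex_iso K L ->
  degree_sum K = degree_sum L.
Proof.
move=> Ks /complex_isoP[f fI ->].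
have KV := simplicial_vertices Ks.
have imI : {in K &, injective (fun A : {set T} => f @: A)}.
  move=> A B /KV AV /KV BV AB; have [h _ hfA] := partial_inverse fI.
  by rewrite -(hfA A) // AB hfA.
have fA A : A \in K -> {in A &, injective f}.
  by move=> /KV/subsetP AV x y xA yA; apply: fI; apply: AV.
have degE v : v \in vertices K ->
    degree [set f @: (A : {set T}) | A in K] (f v) = degree K v.
  move=> vK; rewrite /degree -[RHS](card_in_imset (f := fun A : {set T} => f @: A)).
    apply: eq_card => B; rewrite inE; apply/andP/imsetP => [[/imsetP[A AK ->]]|[A]].
      move=> /imsetP[u uA fvu]; exists A => //; rewrite inE AK.
      by rewrite (fI v u) // (subsetP (KV A AK)).
    by rewrite inE => /andP[AK vA] ->; rewrite !imset_f.
  by move=> A B; rewrite !inE => /andP[AK _] /andP[BK _]; apply: imI.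
rewrite /degree_sum big_imset //=; apply: eq_bigr => A AK; congr (_ ^ 3)%N.
rewrite big_imset //=; last exact: fA.
by apply: eq_bigr => v vA; rewrite degE // (subsetP (KV A AK)).
Qed.

(** Taking blocks maps [s] onto the set of classes, and two members of [s] in one block would have
    equal invariants. *)
Lemma card_iso_classes (D : {set {set {set T}}}) (s : seq {set {set T}}) :
  (forall K, K \in D -> simplicial_complex K) -> {subset s <= D} ->
  (forall K, K \in D -> exists2 L, L \in s & complex_iso K L) ->
  uniq [seq degree_sum L | L <- s] -> #|iso_classes D| = size s.
Proof.
move=> Ds sD cover s_uniq.
have eqR : {in D & &, equivalence_rel (@complex_iso T)}.
  move=> K L M /Ds Ks /Ds Ls /Ds Ms; split; first exact: complex_iso_refl.
  move=> KL; apply/idP/idP; last exact: complex_iso_trans.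
  exact/complex_iso_trans/complex_iso_sym.
have /and3P[/eqP covD triv set0P] := equivalence_partitionP eqR.
pose P := iso_classes D.
have pbP K L : K \in D -> L \in D -> (L \in pblock P K) = complex_iso K L.
  exact: pblock_equivalence_partition.
have PE : P =i [seq pblock P L | L <- s].
  move=> B; apply/idP/mapP => [BP|[L Ls ->]]; last first.
    by apply: pblock_mem; rewrite covD sD.
  have /set0Pn[K KB] : B != set0 by apply: contraNneq set0P => <-.
  have KD : K \in D by rewrite -covD; apply/bigcupP; exists B.
  have [L Ls KL] := cover K KD; exists L => //.
  rewrite -(def_pblock triv BP KB); apply/esym/same_pblock => //.
  by rewrite pbP // sD.
rewrite (eq_card PE) (card_uniqP _) ?size_map //.
rewrite map_inj_in_uniq; first by move: s_uniq; apply: map_uniq.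
move=> K L Ks Ls KL.
have : complex_iso L K.
  by rewrite -pbP ?sD // -KL mem_pblock covD sD.
move=> /(degree_sum_iso (Ds _ (sD _ Ls))) dLK.
have sz := s_uniq.
rewrite -(nth_index K Ks) -[L in RHS](nth_index K Ls); congr nth.
apply/eqP; rewrite -(nth_uniq 0%N _ _ s_uniq) ?size_map ?index_mem //.
by rewrite !(nth_map K) ?index_mem // !nth_index // dLK.
Qed.

End IsoClasses.

(** * Certificates for the count *)

Fixpoint wsumN (d : seq N) (a : bitseq) : N :=
  match a, d with
  | b :: a', x :: d' => if b then N.add x (wsumN d' a') else wsumN d' a'
  | _, _ => N0
  end.

(** Sums of cubes over all simplices are too large for unary numbers, hence the binary ones. *)
Definition degree_sum_words n (s : seq bitseq) : N :=
  let d := [seq bin_of_nat (count (fun a => nth false a k) s) | k <- iota 0 n] in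
  foldr (fun a x => let y := wsumN d a in N.add (N.mul y (N.mul y y)) x) N0 s.

Lemma nat_of_binD : {morph nat_of_bin : x y / N.add x y >-> (x + y)%N}.
Proof. by case=> [|p] [|q] //=; rewrite ?addn0 ?nat_of_add_pos. Qed.

Lemma nat_of_binM : {morph nat_of_bin : x y / N.mul x y >-> (x * y)%N}.
Proof. by case=> [|p] [|q] //=; rewrite ?muln0 ?nat_of_mul_pos. Qed.

Lemma wsumN_nat d a : nat_of_bin (wsumN (map bin_of_nat d) a) = wsum 0 d a.
Proof.
elim: a d => [|b a IH] [|x d] //=.
  by rewrite muln0 add0n; elim: a {IH} => //= ? ? <-; rewrite muln0.
by case: b; rewrite ?mul1n ?mul0n ?add0n // nat_of_binD bin_of_natK IH.
Qed.

Lemma degree_sum_wordsE (T : finType) n (e : T -> 'I_n) (g : 'I_n -> T)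
    (K : {set {set T}}) (kw : pred bitseq) :
  cancel e g -> cancel g e -> (forall A, (A \in K) = kw (word g A)) ->
  degree_sum K = degree_sum_words n (filter kw (words n)).
Proof.
move=> eK gK KE; set s := filter kw (words n).
have KsE a : a \in words n -> (word_set e a \in K) = kw a.
  by rewrite mem_words KE => /eqP an; rewrite (word_setK eK gK).
have degE v : degree K v = count (fun a => nth false a (e v)) s.
  rewrite /degree -sum1dep_card (big_words eK gK) -big_filter sum1_size size_filter.
  rewrite count_filter; apply: eq_in_count => a aw /=.
  by rewrite KsE // inE andbC.
rewrite /degree_sum (big_words eK gK) big_seq_cond.
rewrite (eq_bigl (fun a => (a \in words n) && kw a)); last first.
  by move=> a; case aw : (a \in words n) => //=; rewrite KsE.
rewrite -big_seq_cond -big_filter -/s /degree_sum_words.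
set d := map _ (iota 0 n).
have dE : d = map bin_of_nat [seq count (fun a => nth false a k) s | k <- iota 0 n].
  by rewrite -map_comp.
have : {subset s <= words n} by move=> a; rewrite mem_filter => /andP[].
move: (s) => s0; elim: s0 => [|a s' IH] s'w; first by rewrite big_nil.
rewrite big_cons /= nat_of_binD !nat_of_binM -IH => [|b bs]; last first.
  by apply: s'w; rewrite inE bs orbT.
congr addn; suff -> : nat_of_bin (wsumN d a) = (\sum_(v in word_set e a) degree K v)%N.
  by rewrite !expnS expn0 muln1.
have /eqP an : size a == n by rewrite -mem_words s'w ?mem_head.
rewrite dE wsumN_nat wsumE an [RHS]big_mkcond (reindex e) /=; last first.
  by exists g => x _.
apply: eq_bigr => v _; rewrite inE degE (nth_map 0%N) ?size_iota ?ltn_ord //.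
by rewrite nth_iota ?ltn_ord // add0n; case: nth; rewrite ?mul1n.
Qed.

Definition contains_vertices m t := all (fun i => lookup t (unit_word m i)) (iota 0 m).

Fixpoint has_if (A : Type) (P : A -> bool) (s : seq A) :=
  if s is x :: s' then if P x then true else has_if P s' else false.

Lemma has_ifE (A : Type) (P : A -> bool) s : has_if P s = has P s.
Proof. by elim: s => //= x s ->. Qed.

Definition vsum (a b : bitseq) := [seq (x.1 + x.2)%N | x : bool * bool <- zip a b].

(* Two faces and two nonfaces with the same sum of indicator vectors. *)
Definition summable m t :=
  let faces := filter (lookup t) (words m) in
  let nonfaces := filter (predC (lookup t)) (words m) in
  has_if (fun a1 => has_if (fun a2 => has_if (fun b1 =>
    let s := vsum a1 a2 in
    let b2 := [seq (x.1 - x.2 == 1)%N | x <- zip s (map nat_of_bool b1)] in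
    if lookup t b2 then false else s == vsum b1 b2) nonfaces) faces) faces.

(** The two faces would weigh less than twice the quota together and the two nonfaces at least that
    much, although the totals agree. *)
Lemma summable_nonthreshold (R : realType) n t : summable n t -> ~ threshold R (model n t).
Proof.
rewrite /summable has_ifE => /hasP[a1]; rewrite mem_filter mem_words => /andP[a1t /eqP a1n].
rewrite has_ifE => /hasP[a2]; rewrite mem_filter mem_words => /andP[a2t /eqP a2n].
rewrite has_ifE => /hasP[b1]; rewrite mem_filter mem_words => /andP[/= b1t /eqP b1n].
(* The second nonface is determined by the other three words; it is computed by a truncated
   difference, and the equality test rejects the cases where truncation matters. *)
set b2 := map _ _; case: ifP => // /negbT b2t /eqP sE [w [q [_ wq]]].
have b2n : size b2 = n by rewrite !(size_map, size_zip) a1n a2n b1n !minnn.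
have in_model a : size a = n -> lookup t a = (\sum_(i < n) (nth false a i)%:R * w i < q).
  move=> an; rewrite -[a in LHS](ord_setK an).
  have := wq (ord_set a); rewrite inE => ->; congr (_ < q).
  rewrite big_mkcond; apply: eq_bigr => i _; rewrite inE.
  by case: nth; rewrite ?mul1r ?mul0r.
have sumE (a b : bitseq) : size a = n -> size b = n ->
    \sum_(i < n) (nth false a i)%:R * w i + \sum_(i < n) (nth false b i)%:R * w i =
    \sum_(i < n) (nth 0%N (vsum a b) i)%:R * w i.
  move=> an bn; rewrite -big_split; apply: eq_bigr => i _ /=.
  rewrite -mulrDl -natrD (nth_map (false, false)) ?size_zip ?an ?bn ?minnn //.
  by rewrite nth_zip ?an ?bn.
have := sumE a1 a2 a1n a2n; rewrite sE -(sumE b1 b2 b1n b2n) => /eqP.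
move: a1t a2t b1t b2t; rewrite !in_model // -!leNgt => h1 h2 h3 h4.
by rewrite lt_eqF // (lt_le_trans (ltrD h1 h2)) // lerD.
Qed.

Lemma degree_sum_model n t :
  degree_sum (model n t) = degree_sum_words n (filter (lookup t) (words n)).
Proof. by apply: (@degree_sum_wordsE _ n id id) => // A; rewrite inE. Qed.

Lemma degree_sum_bier n t : degree_sum (bier (model n t)) =
  degree_sum_words (n + n) (filter (bier_word n t) (words (n + n))).
Proof.
apply: (@degree_sum_wordsE _ _ (@unsplit n n) (@split n n)).
- exact: unsplitK.
- exact: splitK.
- exact: bier_wordP.
Qed.

Section Counting.
Variable R : realType.

Lemma threshold_powerset n : threshold R (powerset [set: 'I_n]).
Proof.
exists (fun=> 1), n.+1%:R; split=> [i|A]; first exact: ltr01.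
rewrite powersetE subsetT sumr_const ltr_nat ltnS.
by rewrite -[X in (_ <= X)%N]card_ord max_card.
Qed.

Lemma nonthreshold_complexesP n (K : {set {set 'I_n}}) :
  reflect [/\ simplicial_complex K, vertices K = setT & ~ threshold R K]
    (K \in nonthreshold_complexes R n).
Proof.
rewrite inE; apply: (iffP and3P) => -[Ks Kv Kt]; split=> //; try exact/eqP.
  by move/asboolP: Kt.
exact/asboolP.
Qed.

Lemma nonthreshold_proper n (K : {set {set 'I_n}}) :
  K \in nonthreshold_complexes R n -> proper_complex K.
Proof.
move=> /nonthreshold_complexesP[Ks _ Kt]; rewrite /proper_complex Ks.
by apply/eqP => KE; apply: Kt; rewrite KE; exact: threshold_powerset.
Qed.

Local Notation rep fs := (model 5 (facets_table 5 fs)).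

Lemma nonthreshold_complexes5 fs : fs \in nonthreshold5 ->
  rep fs \in nonthreshold_complexes R 5.
Proof.
have /allP H : all (fun fs => let t := facets_table 5 fs in
  contains_vertices 5 t && summable 5 t) nonthreshold5 by vm_compute.
move=> fs_in; have /andP[/allP Hv Hs] := H fs fs_in.
apply/nonthreshold_complexesP; split.
- by case/andP: (proper_model (m := 5) (leqnn 5) fs_in).
- apply/setP => i; rewrite !inE -(Hv i); last by rewrite mem_iota ltn_ord.
  congr lookup; apply: (@word_eqP _ _ id id) => //.
    by rewrite size_set_nth size_nseq (maxn_idPr (ltn_ord i)).
  by move=> j; rewrite nth_unit_word inE.
- exact: summable_nonthreshold.
Qed.

Lemma nonthreshold5_cover (K : {set {set 'I_5}}) : K \in nonthreshold_complexes R 5 ->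
  exists2 fs, fs \in nonthreshold5 & exists2 g : 'I_5 -> 'I_5, injective g &
    forall A : {set 'I_5}, (g @: A \in K) = (A \in rep fs).
Proof.
move=> /nonthreshold_complexesP[Ks Kv Kt].
have Kv' : vertices K = [set i : 'I_5 | (i < 5)%N].
  by rewrite Kv; apply/setP => i; rewrite !inE ltn_ord.
by have [] := classification_sound R (leqnn 5) (nonthreshold_classification (leqnn 5)) Ks Kv'.
Qed.

Lemma card_nonthreshold_complexes5 : #|iso_classes (nonthreshold_complexes R 5)| = 88%N.
Proof.
rewrite (card_iso_classes (s := [seq rep fs | fs <- nonthreshold5])) //.
- by move=> K /nonthreshold_complexesP[].
- by move=> _ /mapP[fs fs_in ->]; exact: nonthreshold_complexes5.
- move=> K KD; have [fs fs_in [g gI gE]] := nonthreshold5_cover KD.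
  exists (rep fs); first exact: map_f.
  apply: complex_iso_sym (complex_iso_bij gI gE).
  by have /nonthreshold_complexesP[] := nonthreshold_complexes5 fs_in.
- pose d fs := degree_sum_words 5 (filter (lookup (facets_table 5 fs)) (words 5)).
  have -> : [seq degree_sum L | L <- [seq rep fs | fs <- nonthreshold5]]
      = [seq nat_of_bin x | x <- [seq d fs | fs <- nonthreshold5]].
    by rewrite -!map_comp; apply: eq_map => fs; exact: degree_sum_model.
  (* Distinctness is decided on the binary numbers, without converting them to unary ones. *)
  rewrite (map_inj_uniq (can_inj nat_of_binK)); by vm_compute.
Qed.

(** Every sphere is identified with one of the first 48 in two stages: a relabelling of [K] to a
    listed complex, then the tabulated isomorphism of Bier spheres. *)
Lemma card_bier_nonthreshold_complexes5 :
  #|iso_classes [set bier K | K in nonthreshold_complexes R 5]| = 48%N.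
Proof.
rewrite (card_iso_classes (s := [seq bier (rep fs) | fs <- take 48 nonthreshold5])) //.
- by move=> _ /imsetP[K /nonthreshold_proper Kp ->]; exact: bier_simplicial.
- move=> _ /mapP[fs /mem_take fs_in ->]; apply: imset_f; exact: nonthreshold_complexes5.
- move=> _ /imsetP[K KD ->]; have [fs fs_in [g gI gE]] := nonthreshold5_cover KD.
  have [fs' fs'_in fs_iso] := bier_iso_nonthreshold5 fs_in.
  exists (bier (rep fs')); first by apply/mapP; exists fs'.
  have Ms := bier_simplicial (nonthreshold_proper (nonthreshold_complexes5 fs_in)).
  apply: complex_iso_trans fs_iso; first exact/bier_simplicial/nonthreshold_proper.
  exact: complex_iso_sym (bier_iso gI gE).
- pose d fs := degree_sum_words (5 + 5)
    (filter (bier_word 5 (facets_table 5 fs)) (words (5 + 5))).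
  have -> : [seq degree_sum L | L <- [seq bier (rep fs) | fs <- take 48 nonthreshold5]]
      = [seq nat_of_bin x | x <- [seq d fs | fs <- take 48 nonthreshold5]].
    by rewrite -!map_comp; apply: eq_map => fs; exact: degree_sum_bier.
  rewrite (map_inj_uniq (can_inj nat_of_binK)); by vm_compute.
Qed.

End Counting.

Theorem theorem1p3 (R : realType) :
  (forall (n : nat) (K : {set {set 'I_n}}),
     proper_complex K -> (#|vertices (bier K)| <= 11)%N ->
     polytopal R (bier K)) /\
  (forall (n : nat) (K : {set {set 'I_n}}),
     proper_complex K -> has_dimension (bier K) 3 ->
     polytopal R (bier K)) /\
  #|iso_classes (nonthreshold_complexes R 5)| = 88%N /\
  #|iso_classes [set bier K | K in nonthreshold_complexes R 5]%SET| = 48%N.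
Proof.
split; first by move=> n K; apply: polytopal_le11.
split; last first.
  by split; [exact: card_nonthreshold_complexes5 | exact: card_bier_nonthreshold_complexes5].
move=> n K Kp /(dimension_bier Kp) n5; apply: polytopal_le11 => //.
(* Dimension 3 forces [n = 5], so the ground set of the sphere has only ten elements. *)
by apply: leq_trans (max_card _) _; rewrite card_sum card_ord n5.
Qed.
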